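(* Assume: (I) $\sigma(B)\subset\{0\}\cup[\delta,\infty)$ for some $\delta>0$; (II) $\dim\operatorname{Ker}B<\infty$; (III) $J\mathcal K\subset\mathcal V$; (IV) $H^*=H$. Then for any $X(0)\in\mathcal V$: i) The equation $\dot X(t)=AX(t)$ admits a unique (mild) solution $X(t)\in C(\mathbb R,\mathcal V)$ with the given initial value $X(0)$. ii) The solution admits the spectral representation $$X(t)=\Lambda_+^{-1}e^{-iHt}\Lambda X(0)+X_{\mathcal K}(0)+tP\Pi_0\Lambda X(0)+iP(e^{-iH_Rt}-1)H_R^{-1}\Pi_R\Lambda X(0),\qquad t\in\mathbb R,$$ where $X_{\mathcal K}(0)=\Pi_{\mathcal K}X(0)$.
   Context: $\mathcal X$ is a complex Hilbert space; $J:\mathcal X\to\mathcal X$ is bounded with $J^*=-J$, $J^2=-1$; $B$ is a densely defined selfadjoint nonnegative operator in $\mathcal X$; $A=JB$ with domain $D(B)$. $\Lambda:=B^{1/2}\ge0$; $\mathcal V$ is the domain of $\Lambda$ with norm $\|X\|_{\mathcal V}=\|\Lambda X\|_{\mathcal X}+\|X\|_{\mathcal X}$. $\mathcal K:=\operatorname{Ker}\Lambda=\operatorname{Ker}B$, $\mathcal R:=\operatorname{Ran}\Lambda=\mathcal K^\perp$ (with the norm of $\mathcal X$). $\Lambda_+:=\Lambda|_{\mathcal R\cap\mathcal V}:\mathcal R\cap\mathcal V\to\mathcal R$, which under (I) has a bounded inverse $\Lambda_+^{-1}:\mathcal R\to\mathcal V$. $\Pi_{\mathcal K}$ is the orthogonal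 projection of $\mathcal X$ onto $\mathcal K$. $P:=\Pi_{\mathcal K}J\Lambda$, which under (II), (III) extends from $\mathcal V$ to a bounded operator $\mathcal X\to\mathcal V$; $P$ denotes this extension. $H:=\Lambda iJ\Lambda$ with domain $D(H)=\{Z\in\mathcal V: J\Lambda Z\in\mathcal V\}$. $R:=\operatorname{Ran}H\subset\mathcal R$; $\Pi_0$ and $\Pi_R$ are the spectral (orthogonal) projections of $\mathcal X$ onto $\operatorname{Ker}H\cap\mathcal R$ and onto $R$; $H_R:=H|_{R\cap D(H)}$. Mild solution: $X(t)-X(0)=A\int_0^tX(s)\,ds$ for all $t\in\mathbb R$, with the Riemann integral converging in $\mathcal V$ (in particular belonging to $D(A)$). *)

(* Defs.v *)
From Stdlib Require Import Reals ClassicalEpsilon.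
From Coquelicot Require Import Coquelicot.
Open Scope R_scope.

(** A complete normed space over [C] whose norm comes from an inner product,
    linear in the first and conjugate-linear in the second argument. *)
Record HilbertSpace := {
  hs_space :> CompleteNormedModule C_AbsRing;
  inner : hs_space -> hs_space -> C;
  inner_plus_l : forall x y z, inner (plus x y) z = Cplus (inner x z) (inner y z);
  inner_scal_l : forall (a : C) x y, inner (scal a x) y = Cmult a (inner x y);
  inner_conj : forall x y, inner y x = Cconj (inner x y);
  inner_norm : forall x, inner x x = RtoC (norm x * norm x)
}.
Arguments inner {h} x y.

(** Restriction of scalars to [R]: Coquelicot's Riemann sums and derivatives of
    functions of a real variable take values in a real normed module. *)
Lemma realify_assoc (E : NormedModule C_AbsRing) (x y : R_Ring) (u : E) :
  scal (RtoC x) (scal (RtoC y) u) = scal (RtoC (mult x y)) u.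
Proof.
rewrite scal_assoc; apply (f_equal (fun c : C => scal c u)).
symmetry; apply RtoC_mult.
Qed.

Lemma realify_one (E : NormedModule C_AbsRing) (u : E) : scal (RtoC (@one R_Ring)) u = u.
Proof. exact (scal_one u). Qed.

Lemma realify_distr_l (E : NormedModule C_AbsRing) (x : R_Ring) (u v : E) :
  scal (RtoC x) (plus u v) = plus (scal (RtoC x) u) (scal (RtoC x) v).
Proof. exact (scal_distr_l (RtoC x) u v). Qed.

Lemma realify_distr_r (E : NormedModule C_AbsRing) (x y : R_Ring) (u : E) :
  scal (RtoC (plus x y)) u = plus (scal (RtoC x) u) (scal (RtoC y) u).
Proof.
rewrite <- scal_distr_r; apply (f_equal (fun c : C => scal c u)).
apply RtoC_plus.
Qed.

Definition realify_module_mixin (E : NormedModule C_AbsRing) :=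
  ModuleSpace.Mixin R_Ring _ (fun (a : R) (u : E) => scal (RtoC a) u)
    (realify_assoc E) (realify_one E) (realify_distr_l E) (realify_distr_r E).

Definition realify_module (E : NormedModule C_AbsRing) : ModuleSpace R_Ring :=
  ModuleSpace.Pack R_Ring E (ModuleSpace.Class R_Ring E _ (realify_module_mixin E)) E.

Definition realify_aux (E : NormedModule C_AbsRing) : NormedModuleAux R_AbsRing :=
  NormedModuleAux.Pack R_AbsRing E
    (NormedModuleAux.Class R_AbsRing E (ModuleSpace.class _ (realify_module E))
       (UniformSpace.class E)) E.

Lemma realify_norm_scal (E : NormedModule C_AbsRing) (a : R_AbsRing) (u : realify_aux E) :
  norm (V := E) (scal (V := realify_aux E) a u) <= abs a * norm (V := E) u.
Proof.
change (abs a) with (Rabs a); rewrite <- Cmod_R.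
exact (norm_scal (V := E) (RtoC a) u).
Qed.

Definition realify_normed_mixin (E : NormedModule C_AbsRing) :=
  NormedModule.Mixin R_AbsRing (realify_aux E) (@norm _ E) (@norm_factor _ E)
    (@norm_triangle _ E) (realify_norm_scal E) (@norm_compat1 _ E)
    (@norm_compat2 _ E) (@norm_eq_zero _ E).

Definition realify (E : NormedModule C_AbsRing) : NormedModule R_AbsRing :=
  NormedModule.Pack R_AbsRing E
    (NormedModule.Class R_AbsRing E _ (realify_normed_mixin E)) E.

(** An operator with its domain; the values of [op_fun] off the domain are
    irrelevant, and [op_eq] is equality of operators including their domains. *)
Record operator (E : HilbertSpace) := mk_op {
  dom : E -> Prop;
  op_fun :> E -> E
}.
Arguments mk_op {E} dom op_fun.
Arguments dom {E} o x.
Arguments op_fun {E} o x.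

Definition everywhere {E : HilbertSpace} (f : E -> E) : operator E :=
  mk_op (fun _ => True) f.

Definition op_eq {E : HilbertSpace} (S T : operator E) : Prop :=
  (forall x, dom S x <-> dom T x) /\ (forall x, dom S x -> S x = T x).

Definition comp {E : HilbertSpace} (S T : operator E) : operator E :=
  mk_op (fun x => dom T x /\ dom S (T x)) (fun x => S (T x)).

Definition restrict {E : HilbertSpace} (T : operator E) (S : E -> Prop) :
    operator E :=
  mk_op (fun x => S x /\ dom T x) T.

Definition Ker {E : HilbertSpace} (T : operator E) (x : E) : Prop :=
  dom T x /\ T x = zero.

Definition Ran {E : HilbertSpace} (T : operator E) (y : E) : Prop :=
  exists x, dom T x /\ T x = y.

(** Here and below [epsilon] picks the object with the stated property, when
    there is one; no existence is assumed. *)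
Definition inverse {E : HilbertSpace} (T : operator E) : operator E :=
  mk_op (Ran T)
    (fun y => epsilon (inhabits zero) (fun x => dom T x /\ T x = y)).

Definition linear_operator {E : HilbertSpace} (T : operator E) : Prop :=
  dom T zero /\
  (forall x y, dom T x -> dom T y ->
    dom T (plus x y) /\ T (plus x y) = plus (T x) (T y)) /\
  (forall (a : C) x, dom T x ->
    dom T (scal a x) /\ T (scal a x) = scal a (T x)).

Definition dense {E : HilbertSpace} (S : E -> Prop) : Prop :=
  forall (x : E) (eps : R), 0 < eps -> exists y, S y /\ norm (minus x y) < eps.

(** [w] represents the functional [x |-> inner (T x) y]; it is unique when [T]
    is densely defined. *)
Definition adjoint_at {E : HilbertSpace} (T : operator E) (y w : E) : Prop :=
  forall x, dom T x -> inner (T x) y = inner x w.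

Definition adjoint {E : HilbertSpace} (T : operator E) : operator E :=
  mk_op (fun y => exists w, adjoint_at T y w)
    (fun y => epsilon (inhabits zero) (adjoint_at T y)).

Definition selfadjoint {E : HilbertSpace} (T : operator E) : Prop :=
  linear_operator T /\ dense (dom T) /\ op_eq (adjoint T) T.

(** For selfadjoint [T] the numbers [inner (T x) x] are real. *)
Definition nonnegative {E : HilbertSpace} (T : operator E) : Prop :=
  forall x, dom T x -> 0 <= Re (inner (T x) x).

Definition op_sqrt {E : HilbertSpace} (B : operator E) : operator E :=
  epsilon (inhabits (everywhere (fun x => x)))
    (fun L => selfadjoint L /\ nonnegative L /\ op_eq (comp L L) B).

(** Coquelicot's [is_linear] includes boundedness. *)
Definition in_resolvent_set {E : HilbertSpace} (T : operator E) (z : C) : Prop :=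
  exists Q : E -> E, is_linear Q /\
    (forall y, dom T (Q y) /\ minus (T (Q y)) (scal z (Q y)) = y) /\
    (forall x, dom T x -> Q (minus (T x) (scal z x)) = x).

Definition in_spectrum {E : HilbertSpace} (T : operator E) (z : C) : Prop :=
  ~ in_resolvent_set T z.

Definition finite_dimensional {E : HilbertSpace} (S : E -> Prop) : Prop :=
  exists (n : nat) (e : nat -> E), (forall k, S (e k)) /\
    forall x, S x ->
      exists c : nat -> C, x = sum_n (fun k => scal (c k) (e k)) n.

Definition proj {E : HilbertSpace} (S : E -> Prop) (x : E) : E :=
  epsilon (inhabits zero)
    (fun y => S y /\ forall s, S s -> inner (minus x y) s = RtoC 0).

(** [U] is the strongly continuous unitary group [exp (- i t T)] on the closed
    subspace [S], for an operator [T] in the Hilbert space [S]: by the last two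
    clauses, [- i T] is exactly its infinitesimal generator. *)
Definition is_unitary_group {E : HilbertSpace} (S : E -> Prop) (T : operator E)
    (U : R -> E -> E) : Prop :=
  (forall t x, S x -> S (U t x)) /\
  (forall t x y, S x -> S y -> U t (plus x y) = plus (U t x) (U t y)) /\
  (forall t (a : C) x, S x -> U t (scal a x) = scal a (U t x)) /\
  (forall t x, S x -> norm (U t x) = norm x) /\
  (forall x, S x -> U 0 x = x) /\
  (forall s t x, S x -> U (s + t) x = U s (U t x)) /\
  (forall x, S x -> forall t, continuous (fun s => U s x) t) /\
  (forall x, dom T x ->
    S x /\ is_derive (V := realify E) (fun t => U t x) 0 (opp (scal Ci (T x)))) /\
  (forall x y, S x -> is_derive (V := realify E) (fun t => U t x) 0 y -> dom T x).

Definition unitary_group {E : HilbertSpace} (S : E -> Prop) (T : operator E) :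
    R -> E -> E :=
  epsilon (inhabits (fun _ x => x)) (is_unitary_group S T).

Definition opA {E : HilbertSpace} (J : E -> E) (B : operator E) : operator E :=
  mk_op (dom B) (fun x => J (B x)).

Definition Lam {E : HilbertSpace} (B : operator E) : operator E := op_sqrt B.

Definition spV {E : HilbertSpace} (B : operator E) : E -> Prop := dom (Lam B).

Definition normV {E : HilbertSpace} (B : operator E) (x : E) : R :=
  norm (Lam B x) + norm x.

Definition spK {E : HilbertSpace} (B : operator E) : E -> Prop := Ker (Lam B).

Definition ranL {E : HilbertSpace} (B : operator E) : E -> Prop := Ran (Lam B).

Definition Lam_plus {E : HilbertSpace} (B : operator E) : operator E :=
  restrict (Lam B) (ranL B).

(** The extension of [proj K J Lam] from [V] to a bounded operator from the
    whole space to [V]. *)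
Definition opP {E : HilbertSpace} (J : E -> E) (B : operator E) : E -> E :=
  epsilon (inhabits (fun x => x))
    (fun P => is_linear P /\ (forall x, spV B (P x)) /\
      (exists M, forall x, normV B (P x) <= M * norm x) /\
      (forall z, spV B z -> P z = proj (spK B) (J (Lam B z)))).

Definition opH {E : HilbertSpace} (J : E -> E) (B : operator E) : operator E :=
  mk_op (fun z => spV B z /\ spV B (J (Lam B z)))
    (fun z => Lam B (scal Ci (J (Lam B z)))).

Definition ranH {E : HilbertSpace} (J : E -> E) (B : operator E) : E -> Prop :=
  Ran (opH J B).

Definition kerH0 {E : HilbertSpace} (J : E -> E) (B : operator E) (x : E) : Prop :=
  Ker (opH J B) x /\ ranL B x.

Definition opHR {E : HilbertSpace} (J : E -> E) (B : operator E) : operator E :=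
  restrict (opH J B) (ranH J B).

Definition expH {E : HilbertSpace} (J : E -> E) (B : operator E) :
    R -> E -> E :=
  unitary_group (fun _ => True) (opH J B).

Definition expHR {E : HilbertSpace} (J : E -> E) (B : operator E) :
    R -> E -> E :=
  unitary_group (ranH J B) (opHR J B).

(** Functions of time are total functions into [E] with values in [V];
    continuity and Riemann sums are taken in the norm of [V]. *)
Definition continuousV {E : HilbertSpace} (B : operator E) (X : R -> E) : Prop :=
  (forall t, spV B (X t)) /\
  (forall t, filterlim (fun s => normV B (minus (X s) (X t)))
    (locally t) (locally 0)).

(** Coquelicot's [is_RInt], with convergence in the norm of [V]. *)
Definition is_RIntV {E : HilbertSpace} (B : operator E) (X : R -> E) (a b : R)
    (Y : E) : Prop :=
  spV B Y /\
  filterlim (fun ptd => normV B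
      (minus (scal (RtoC (sign (b - a))) (Riemann_sum (V := realify E) X ptd)) Y))
    (Riemann_fine a b) (locally 0).

Definition mild_solution {E : HilbertSpace} (J : E -> E) (B : operator E)
    (X : R -> E) : Prop :=
  forall t, exists Y, is_RIntV B X 0 t Y /\ dom (opA J B) Y /\
    minus (X t) (X 0) = opA J B Y.

(* Main.v *)
(** Write [L] for the square root of [B], [K = Ker L], [Z = L X] and [W(t)] for
    [L] applied to the integral of [X] over [[0, t]]. A mild solution satisfies
    [X(t) = X(0) + J L W(t)], and applying [L] gives
    [Z(t) = Z(0) - i H W(t)]; since [Z] is the derivative of [W], this is a linear
    equation for [W], with at most one solution because [H] is symmetric. Splitting
    [Z(0) = p + r] along [Ker H] and [Ran H] and writing [r = H w], its solution is
    [W(t) = t p + i (exp(-iHt) w - w)]. Hence [Z(t) = exp(-iHt) Z(0)] determines the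
    component of [X(t)] orthogonal to [K], and [P W(t)] is the increment of the
    component in [K].

    The spectral gap makes [Ran L] closed, equal to the orthogonal complement of [K];
    as [K] is finite-dimensional, [Ran H] is closed too. *)

(* The square root, the projections, the inverses, both unitary groups and [P] are picked by
   [epsilon], so the formula says nothing until their existence is proved. This is why a square
   root, Stone's theorem and orthogonal projections are constructed here. No functional calculus is
   used: resolvents, closed graphs and the conservation of the norm by skew equations take its
   place. For Stone's theorem the generator is regularised by a^2 (a^2 + T^2)^-1, a choice for which
   the bounded approximations of -iT stay skew.

   The obstacle behind the unknown W is regularity. X(t) need not lie in the domain of A, nor Z(t)
   in that of H, so neither curve need be differentiable. One integration gains what is missing: J L
   W(t) = X(t) - X(0) lies in V, which puts W(t) in the domain of H. For the same reason the formula
   evolves w, which lies in that domain, and not r.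

   The two groups [expH] and [expHR] are chosen independently; their agreement on the range of H has
   to be derived from uniqueness of strong solutions. *)
Require Import Defs.
From Stdlib Require Import Arith Reals Psatz ClassicalEpsilon FunctionalExtensionality.
From Coquelicot Require Import Coquelicot.
Open Scope R_scope.

(* The structure arguments are spelled out so that all vector operations are
   syntactically those of [Defs]: inference may otherwise pick convertible
   paths through the algebraic hierarchy, which [rewrite] does not identify. *)
Local Notation "x ⊕ y" := (@plus (CompleteNormedModule.AbelianMonoid C_AbsRing (hs_space _)) x y)
  (at level 50, left associativity).
Local Notation "x ⊖ y" := (@minus (CompleteNormedModule.AbelianGroup C_AbsRing (hs_space _)) x y)
  (at level 50, left associativity).
Local Notation "⊖ x" := (@opp (CompleteNormedModule.AbelianGroup C_AbsRing (hs_space _)) x)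
  (at level 35, right associativity).
Local Notation "a • x" := (@scal C_Ring (CompleteNormedModule.ModuleSpace C_AbsRing (hs_space _)) a x)
  (at level 40, left associativity).
Local Notation Rs a x := (RtoC a • x) (only parsing).
Local Notation vzero := (@zero (CompleteNormedModule.AbelianMonoid C_AbsRing (hs_space _))).
Local Notation vnorm := (@norm C_AbsRing (CompleteNormedModule.NormedModule C_AbsRing (hs_space _))).

(** * Inner products and norms *)

Section Inner.
Context {E : HilbertSpace}.
Implicit Types x y z u v : E.

Lemma inner_plus_r x y z : inner x (y ⊕ z) = Cplus (inner x y) (inner x z).
Proof.
rewrite inner_conj, inner_plus_l, Cplus_conj.
now rewrite <- (inner_conj _ y x), <- (inner_conj _ z x).
Qed.

Lemma inner_scal_r (a : C) x y : inner x (a • y) = Cmult (Cconj a) (inner x y).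
Proof.
rewrite inner_conj, inner_scal_l, Cmult_conj.
now rewrite <- (inner_conj _ y x).
Qed.

Lemma inner_zero_l x : inner vzero x = RtoC 0.
Proof.
replace (vzero : E) with (Rs 0 (vzero : E)) by apply (scal_zero_r (V := E)).
rewrite inner_scal_l. ring.
Qed.

Lemma inner_opp_l x y : inner (⊖ x) y = Copp (inner x y).
Proof.
replace (⊖ x) with (Copp (RtoC 1) • x) by apply (scal_opp_one (V := E)).
rewrite inner_scal_l. ring.
Qed.

Lemma inner_zero_r x : inner x vzero = RtoC 0.
Proof. rewrite inner_conj, inner_zero_l. unfold Cconj, RtoC; simpl. f_equal; ring. Qed.

Lemma inner_opp_r x y : inner x (⊖ y) = Copp (inner x y).
Proof.
rewrite inner_conj, inner_opp_l, (inner_conj _ x y).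
unfold Cconj, Copp; simpl. f_equal; ring.
Qed.

Lemma inner_minus_l x y z : inner (x ⊖ y) z = Cminus (inner x z) (inner y z).
Proof. unfold minus, Cminus; now rewrite inner_plus_l, inner_opp_l. Qed.

Lemma inner_minus_r x y z : inner x (y ⊖ z) = Cminus (inner x y) (inner x z).
Proof. unfold minus, Cminus; now rewrite inner_plus_r, inner_opp_r. Qed.

Lemma norm_eq_0 x : vnorm x = 0 -> x = vzero.
Proof. apply (norm_eq_zero (V := E)). Qed.

Lemma inner_ext x y : (forall v, inner x v = inner y v) -> x = y.
Proof.
intro H.
assert (H0 : x ⊖ y = vzero).
{ apply norm_eq_0.
  assert (H1 : inner (x ⊖ y) (x ⊖ y) = RtoC 0).
  { rewrite inner_minus_l, H. ring. }
  rewrite inner_norm in H1. apply (f_equal Re) in H1. simpl in H1. nra. }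
apply (plus_reg_r (⊖ y)). rewrite plus_opp_r. exact H0.
Qed.

End Inner.

Ltac innexp :=
  repeat first
    [ rewrite inner_plus_l | rewrite inner_minus_l | rewrite inner_scal_l
    | rewrite inner_opp_l | rewrite inner_zero_l
    | rewrite inner_plus_r | rewrite inner_minus_r | rewrite inner_scal_r
    | rewrite inner_opp_r | rewrite inner_zero_r ].

Ltac cscal :=
  repeat first [ rewrite RtoC_plus | rewrite RtoC_minus | rewrite RtoC_mult | rewrite RtoC_opp ].

(** Vector identities are verified by pairing both sides with an arbitrary vector. *)
Ltac vec :=
  apply inner_ext; let v := fresh "v" in intro v; innexp; cscal; try ring.

Section Real.
Context {E : HilbertSpace}.
Implicit Types x y z u v : E.

(** The inner product of the underlying real space: norms, derivatives and energy estimates see only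
    this part. The imaginary part is recovered by testing against [Ci • y], see [inner_rip]. *)
Definition rip x y : R := Re (inner x y).

Lemma rip_sym x y : rip x y = rip y x.
Proof. unfold rip. now rewrite (inner_conj _ y x). Qed.

Lemma rip_plus_l x y z : rip (x ⊕ y) z = rip x z + rip y z.
Proof. unfold rip. now rewrite inner_plus_l. Qed.
Lemma rip_plus_r x y z : rip x (y ⊕ z) = rip x y + rip x z.
Proof. unfold rip. now rewrite inner_plus_r. Qed.
Lemma rip_opp_l x y : rip (⊖ x) y = - rip x y.
Proof. unfold rip. now rewrite inner_opp_l. Qed.
Lemma rip_opp_r x y : rip x (⊖ y) = - rip x y.
Proof. unfold rip. now rewrite inner_opp_r. Qed.
Lemma rip_minus_l x y z : rip (x ⊖ y) z = rip x z - rip y z.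
Proof. unfold rip. now rewrite inner_minus_l. Qed.
Lemma rip_minus_r x y z : rip x (y ⊖ z) = rip x y - rip x z.
Proof. unfold rip. now rewrite inner_minus_r. Qed.
Lemma rip_zero_l x : rip vzero x = 0.
Proof. unfold rip. now rewrite inner_zero_l. Qed.
Lemma rip_zero_r x : rip x vzero = 0.
Proof. unfold rip. now rewrite inner_zero_r. Qed.
Lemma rip_scal_l (a : R) x y : rip (Rs a x) y = a * rip x y.
Proof. unfold rip, Re. rewrite inner_scal_l. simpl. ring. Qed.
Lemma rip_scal_r (a : R) x y : rip x (Rs a y) = a * rip x y.
Proof. unfold rip, Re. rewrite inner_scal_r. simpl. ring. Qed.
Lemma rip_Ci_r x y : rip x (Ci • y) = - rip (Ci • x) y.
Proof. unfold rip, Re. rewrite inner_scal_r, inner_scal_l. simpl. ring. Qed.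
Lemma rip_CiCi x y : rip (Ci • x) (Ci • y) = rip x y.
Proof. unfold rip, Re. rewrite inner_scal_r, inner_scal_l. simpl. ring. Qed.
Lemma rip_self x : rip x x = vnorm x * vnorm x.
Proof. unfold rip. now rewrite inner_norm. Qed.
Lemma inner_rip x y : inner x y = (rip x y, rip x (Ci • y)).
Proof.
unfold rip, Re. rewrite inner_scal_r. destruct (inner x y) as [a b]; simpl. f_equal; ring.
Qed.

End Real.

Ltac ripexp := 
  repeat first
    [ rewrite rip_plus_l | rewrite rip_minus_l | rewrite rip_scal_l
    | rewrite rip_opp_l | rewrite rip_zero_l
    | rewrite rip_plus_r | rewrite rip_minus_r | rewrite rip_scal_r
    | rewrite rip_opp_r | rewrite rip_zero_r ].

Ltac ripexp_in H := 
  repeat first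
    [ rewrite rip_plus_l in H | rewrite rip_minus_l in H | rewrite rip_scal_l in H
    | rewrite rip_opp_l in H | rewrite rip_zero_l in H
    | rewrite rip_plus_r in H | rewrite rip_minus_r in H | rewrite rip_scal_r in H
    | rewrite rip_opp_r in H | rewrite rip_zero_r in H ].

Section Norm.
Context {E : HilbertSpace}.
Implicit Types x y z : E.

Lemma CiCi x : Ci • (Ci • x) = ⊖ x.
Proof.
vec. transitivity (Cmult (Cmult Ci Ci) (inner x v)); [ring|].
replace (Cmult Ci Ci) with (Copp (RtoC 1)); [ring|].
unfold Ci, Cmult, Copp, RtoC; simpl. f_equal; ring.
Qed.

Lemma Ci_oppCi x : Ci • (Copp Ci • x) = x.
Proof. replace (Ci • (Copp Ci • x)) with (⊖ (Ci • (Ci • x))) by vec. rewrite CiCi. vec. Qed.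

Lemma oppCi_Ci x : Copp Ci • (Ci • x) = x.
Proof. replace (Copp Ci • (Ci • x)) with (⊖ (Ci • (Ci • x))) by vec. rewrite CiCi. vec. Qed.

Lemma norm_pos x : 0 <= vnorm x.
Proof. apply norm_ge_0. Qed.

Lemma nrm_zero : vnorm (vzero : E) = 0.
Proof. apply (norm_zero (V := E)). Qed.

Lemma nrm_le x y : vnorm x * vnorm x <= vnorm y * vnorm y -> vnorm x <= vnorm y.
Proof. intro H. pose proof (norm_pos x); pose proof (norm_pos y); nra. Qed.

Lemma sq_le (a b : R) : 0 <= b -> a * a <= b * b -> a <= b.
Proof. intros; nra. Qed.

Lemma nrm_opp x : vnorm (⊖ x) = vnorm x.
Proof. apply (norm_opp (V := E)). Qed.

Lemma minus_sym x y : vnorm (x ⊖ y) = vnorm (y ⊖ x).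
Proof. rewrite <- nrm_opp. f_equal. vec. Qed.

Lemma nrm_scal (a : C) x : vnorm (a • x) = Cmod a * vnorm x.
Proof.
assert (H : vnorm (a • x) * vnorm (a • x) = (Cmod a * vnorm x) * (Cmod a * vnorm x)).
{ rewrite <- rip_self. unfold rip. rewrite inner_scal_l, inner_scal_r, inner_norm.
  assert (Hc : Cmod a * Cmod a = fst a * fst a + snd a * snd a).
  { unfold Cmod. rewrite sqrt_sqrt; [ring | nra]. }
  replace (Cmod a * vnorm x * (Cmod a * vnorm x)) with (Cmod a * Cmod a * (vnorm x * vnorm x)) by ring.
  rewrite Hc. simpl. ring. }
pose proof (norm_pos (a • x)); pose proof (norm_pos x); pose proof (Cmod_ge_0 a).
assert (0 <= Cmod a * vnorm x) by (apply Rmult_le_pos; lra).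
apply Rle_antisym; apply sq_le; lra.
Qed.

Lemma nrm_rscal (a : R) x : vnorm (Rs a x) = Rabs a * vnorm x.
Proof. now rewrite nrm_scal, Cmod_R. Qed.

Lemma nrm_Ci x : vnorm (Ci • x) = vnorm x.
Proof.
rewrite nrm_scal. replace (Cmod Ci) with 1; [ring|].
unfold Cmod; simpl. replace (0 * (0 * 1) + 1 * (1 * 1)) with 1 by ring. now rewrite sqrt_1.
Qed.

Lemma nrm_triangle x y : vnorm (x ⊕ y) <= vnorm x + vnorm y.
Proof. apply (norm_triangle (V := E)). Qed.

Lemma nrm_triangle_m x y : vnorm (x ⊖ y) <= vnorm x + vnorm y.
Proof. unfold minus. rewrite <- (nrm_opp y). apply nrm_triangle. Qed.

Lemma dist_triangle y x z : vnorm (x ⊖ z) <= vnorm (x ⊖ y) + vnorm (y ⊖ z).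
Proof. replace (x ⊖ z) with ((x ⊖ y) ⊕ (y ⊖ z)) by vec. apply nrm_triangle. Qed.

Lemma nrm_le_dist x y : vnorm x <= vnorm y + vnorm (x ⊖ y).
Proof. replace x with (y ⊕ (x ⊖ y)) at 1 by vec. apply nrm_triangle. Qed.

Lemma cauchy_schwarz x y : Rabs (rip x y) <= vnorm x * vnorm y.
Proof.
pose proof (norm_pos x) as Hx; pose proof (norm_pos y) as Hy.
assert (H : rip x y * rip x y <= (vnorm x * vnorm y) * (vnorm x * vnorm y)).
{ destruct (Req_dec (vnorm y) 0) as [H0|H0].
  - apply norm_eq_0 in H0. subst y. rewrite rip_zero_r. 
    pose proof (norm_pos (vzero : E)). nra.
  (* This vector is ‖y‖² times the part of [x] orthogonal to [y]. With a, b the norms of [x], [y]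
     and c their pairing, its squared norm is b²(a²b² - c²). *)
  - pose proof (rip_self (Rs (vnorm y * vnorm y) x ⊖ Rs (rip x y) y)) as H.
    ripexp_in H. rewrite !rip_self, (rip_sym y x) in H.
    set (c := rip x y) in *. set (a := vnorm x) in *. set (b := vnorm y) in *.
    match type of H with _ = ?r * ?r => assert (0 <= r * r) by nra end.
    assert (0 < b * b) by nra. 
    assert (0 <= (b * b) * (a * b * (a * b) - c * c)) by nra. nra. }
apply Rabs_le. assert (0 <= vnorm x * vnorm y) by nra. split; nra.
Qed.

Lemma rip_le x y : rip x y <= vnorm x * vnorm y.
Proof. eapply Rle_trans; [apply Rle_abs | apply cauchy_schwarz]. Qed.

Lemma parallelogram x y :
  vnorm (x ⊕ y) * vnorm (x ⊕ y) + vnorm (x ⊖ y) * vnorm (x ⊖ y) = 2 * (vnorm x * vnorm x) + 2 * (vnorm y * vnorm y).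
Proof. rewrite <- !rip_self. ripexp. ring. Qed.

Lemma minus_eq_zero x y : x ⊖ y = vzero -> x = y.
Proof.
intro H. replace x with ((x ⊖ y) ⊕ y) by vec. rewrite H. vec.
Qed.

Lemma nrm_dist_0 x y : vnorm (x ⊖ y) = 0 -> x = y.
Proof. intro H. apply minus_eq_zero, norm_eq_0, H. Qed.

Lemma dist_small_eq x y : (forall eps, 0 < eps -> vnorm (x ⊖ y) <= eps) -> x = y.
Proof.
intro H. apply nrm_dist_0. pose proof (norm_pos (x ⊖ y)) as [H1|H1]; [|easy].
specialize (H (vnorm (x ⊖ y) / 2)). lra.
Qed.

(** * Convergence of sequences in norm *)

Definition cv (u : nat -> E) (l : E) :=
  forall eps, 0 < eps -> exists N : nat, forall n, (N <= n)%nat -> vnorm (u n ⊖ l) < eps.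

Lemma cv_unique (u : nat -> E) (l : E) (m : E) : cv u l -> cv u m -> l = m.
Proof.
intros Hl Hm. apply dist_small_eq. intros eps He.
destruct (Hl (eps / 2)) as [N1 H1]; [lra|]. destruct (Hm (eps / 2)) as [N2 H2]; [lra|].
specialize (H1 (max N1 N2) ltac:(lia)). specialize (H2 (max N1 N2) ltac:(lia)).
pose proof (dist_triangle (u (max N1 N2)) l m). rewrite (minus_sym l (u _)) in H. lra.
Qed.

Lemma cv_const x : cv (fun _ => x) x.
Proof.
intros eps He. exists 0%nat. intros. replace (x ⊖ x) with (vzero : E) by vec.
rewrite nrm_zero. lra.
Qed.

Lemma cv_lip (u : nat -> E) (l : E) (v : nat -> E) (m : E) (M : R) : (forall n, vnorm (v n ⊖ m) <= M * vnorm (u n ⊖ l)) -> cv u l -> cv v m.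
Proof.
intros H Hu eps He.
set (M' := Rabs M + 1). assert (HM : 0 < M') by (unfold M'; pose proof (Rabs_pos M); lra).
destruct (Hu (eps / M')) as [N HN]; [now apply Rdiv_lt_0_compat|].
exists N. intros n Hn. specialize (HN n Hn). specialize (H n).
pose proof (norm_pos (u n ⊖ l)). pose proof (Rle_abs M).
assert (M' * vnorm (u n ⊖ l) < eps).
{ apply (Rmult_lt_compat_l M') in HN; [|easy]. 
  replace (M' * (eps / M')) with eps in HN by (field; lra). lra. }
unfold M' in *. nra.
Qed.

Lemma cv_plus (u : nat -> E) (v : nat -> E) (l : E) (m : E) : cv u l -> cv v m -> cv (fun n => u n ⊕ v n) (l ⊕ m).
Proof.
intros Hu Hv eps He.
destruct (Hu (eps / 2)) as [N1 H1]; [lra|]. destruct (Hv (eps / 2)) as [N2 H2]; [lra|].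
exists (max N1 N2). intros n Hn. specialize (H1 n ltac:(lia)). specialize (H2 n ltac:(lia)).
replace (u n ⊕ v n ⊖ (l ⊕ m)) with ((u n ⊖ l) ⊕ (v n ⊖ m)) by vec.
eapply Rle_lt_trans; [apply nrm_triangle|lra].
Qed.

Lemma cv_scal (a : C) (u : nat -> E) (l : E) : cv u l -> cv (fun n => a • u n) (a • l).
Proof.
apply (cv_lip _ _ _ _ (Cmod a)). intro n.
replace (a • u n ⊖ a • l) with (a • (u n ⊖ l)) by vec. rewrite nrm_scal. lra.
Qed.

Lemma cv_minus (u : nat -> E) (v : nat -> E) (l : E) (m : E) : cv u l -> cv v m -> cv (fun n => u n ⊖ v n) (l ⊖ m).
Proof.
intros Hu Hv eps He.
destruct (Hu (eps / 2)) as [N1 H1]; [lra|]. destruct (Hv (eps / 2)) as [N2 H2]; [lra|].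
exists (max N1 N2). intros n Hn. specialize (H1 n ltac:(lia)). specialize (H2 n ltac:(lia)).
replace (u n ⊖ v n ⊖ (l ⊖ m)) with ((u n ⊖ l) ⊖ (v n ⊖ m)) by vec.
eapply Rle_lt_trans; [apply nrm_triangle_m|lra].
Qed.

Lemma cv_ext (u : nat -> E) (v : nat -> E) (l : E) : (forall n, u n = v n) -> cv u l -> cv v l.
Proof. intros H Hu eps He. destruct (Hu eps He) as [N HN]. exists N. intros. rewrite <- H. auto. Qed.

Lemma cv_shift (u : nat -> E) (l : E) : cv u l -> cv (fun n => u (S n)) l.
Proof. intros Hu eps He. destruct (Hu eps He) as [N HN]. exists N. intros. apply HN. lia. Qed.

Lemma cv_norm_le (u : nat -> E) (l : E) (M : R) : cv u l -> (forall n, vnorm (u n) <= M) -> vnorm l <= M.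
Proof.
intros Hu H. apply le_epsilon. intros eps He. destruct (Hu eps He) as [N HN].
specialize (HN N (le_n _)). specialize (H N). pose proof (nrm_le_dist l (u N)).
rewrite (minus_sym l) in H0. lra.
Qed.

Lemma cv_rip (u : nat -> E) (v : nat -> E) (l m : E) (a : R) : cv u l -> cv v m -> (forall n, rip (u n) (v n) = a) -> rip l m = a.
Proof.
intros Hu Hv H. apply cond_eq. intros eps He.
pose proof (norm_pos l) as Pl. pose proof (norm_pos m) as Pm.
set (d := Rmin 1 (eps / (2 + vnorm l + vnorm m))).
assert (Hd : 0 < d) by (apply Rmin_pos; [lra|apply Rdiv_lt_0_compat; lra]).
destruct (Hu d Hd) as [N1 H1]. destruct (Hv d Hd) as [N2 H2].
specialize (H1 (max N1 N2) ltac:(lia)). specialize (H2 (max N1 N2) ltac:(lia)).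
specialize (H (max N1 N2)). set (p := u (max N1 N2)) in *. set (q := v (max N1 N2)) in *.
replace (rip l m - a) with (- (rip (p ⊖ l) (q ⊖ m) + rip l (q ⊖ m) + rip (p ⊖ l) m)).
2: { rewrite <- H. ripexp. ring. }
rewrite Rabs_Ropp.
pose proof (cauchy_schwarz (p ⊖ l) (q ⊖ m)). pose proof (cauchy_schwarz l (q ⊖ m)).
pose proof (cauchy_schwarz (p ⊖ l) m).
pose proof (norm_pos (p ⊖ l)). pose proof (norm_pos (q ⊖ m)).
assert (Hd1 : d <= 1) by apply Rmin_l.
assert (Hd2 : d * (2 + vnorm l + vnorm m) <= eps).
{ assert (Hdd : d <= eps / (2 + vnorm l + vnorm m)) by apply Rmin_r.
  apply (Rmult_le_compat_r (2 + vnorm l + vnorm m)) in Hdd; [|lra].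
  replace (eps / (2 + vnorm l + vnorm m) * (2 + vnorm l + vnorm m)) with eps in Hdd by (field; lra). lra. }
eapply Rle_lt_trans; [eapply Rle_trans; [apply Rabs_triang|apply Rplus_le_compat_r, Rabs_triang]|].
assert (vnorm (p ⊖ l) * vnorm (q ⊖ m) <= d * 1) by (apply Rmult_le_compat; lra).
assert (vnorm l * vnorm (q ⊖ m) <= vnorm l * d) by (apply Rmult_le_compat_l; lra).
assert (vnorm (p ⊖ l) * vnorm m <= d * vnorm m) by (apply Rmult_le_compat_r; lra).
nra.
Qed.

Lemma cv_inner (u : nat -> E) (v : nat -> E) (l : E) (m : E) : cv u l -> cv v m -> (forall n, inner (u n) (v n) = RtoC 0) -> inner l m = RtoC 0.
Proof.
intros Hu Hv H. rewrite inner_rip.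
rewrite (cv_rip u v l m 0), (cv_rip u (fun n => Ci • v n) l (Ci • m) 0); auto using cv_scal.
- intro n. specialize (H n). rewrite inner_rip in H. now inversion H.
- intro n. specialize (H n). rewrite inner_rip in H. now inversion H.
Qed.

Lemma cauchy_cv (u : nat -> E) :
  (forall eps, 0 < eps -> exists N : nat, forall n m, (N <= n)%nat -> (N <= m)%nat -> vnorm (u n ⊖ u m) < eps) ->
  exists l, cv u l.
Proof.
intro H.
destruct (proj1 (filterlim_locally_cauchy (U := CompleteNormedModule.CompleteSpace C_AbsRing E) (F := eventually) u)) as [l Hl].
- intros eps. destruct (H eps (cond_pos eps)) as [N HN].
  exists (fun n => (N <= n)%nat). split; [now exists N|].
  intros n m Hn Hm. apply (norm_compat1 (V := E)). now apply HN.
- exists l. intros eps He.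
  apply (proj1 (filterlim_locally_ball_norm (U := E) (F := eventually) u l)) with (eps := mkposreal eps He) in Hl.
  destruct Hl as [N HN]. exists N. intros n Hn. apply (HN n Hn).
Qed.

Lemma cauchy_dominated (u : nat -> E) (y : nat -> R) (l : R) (M : R) :
  Un_cv y l ->
  (forall n m, (n <= m)%nat -> vnorm (u m ⊖ u n) <= M * Rabs (y m - y n)) ->
  exists l, cv u l.
Proof.
intros Hy H. apply cauchy_cv. intros eps He.
set (M' := Rabs M + 1). assert (HM : 0 < M') by (unfold M'; pose proof (Rabs_pos M); lra).
destruct (Hy (eps / (2 * M'))) as [N HN]; [apply Rdiv_lt_0_compat; lra|].
exists N.
assert (HH : forall n m, (N <= n)%nat -> (n <= m)%nat -> vnorm (u m ⊖ u n) < eps).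
{ intros n m Hn Hm. eapply Rle_lt_trans; [now apply H|].
  pose proof (HN n Hn) as H1. pose proof (HN m ltac:(lia)) as H2. unfold Rdist in *.
  assert (H3 : Rabs (y m - y n) < eps / M').
  { replace (y m - y n) with ((y m - l) - (y n - l)) by ring.
    eapply Rle_lt_trans; [apply Rabs_triang|]. rewrite Rabs_Ropp.
    replace (eps / M') with (eps / (2 * M') + eps / (2 * M')) by (field; lra). lra. }
  pose proof (Rabs_pos (y m - y n)). pose proof (Rle_abs M).
  apply (Rmult_lt_compat_l M') in H3; [|easy].
  replace (M' * (eps / M')) with eps in H3 by (field; lra). unfold M' in *. nra. }
intros n m Hn Hm. destruct (Nat.le_ge_cases n m); [rewrite minus_sym|]; auto.
Qed.

(** * Orthogonal projections *)

Definition subspace (S : E -> Prop) :=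
  S vzero /\ (forall x y, S x -> S y -> S (x ⊕ y)) /\ (forall (a : C) x, S x -> S (a • x)).

Definition seq_closed (S : E -> Prop) :=
  forall u l, (forall n, S (u n)) -> cv u l -> S l.

Definition orth (S : E -> Prop) (x : E) := forall s, S s -> inner x s = RtoC 0.

Lemma subspace_opp S x : subspace S -> S x -> S (⊖ x).
Proof. intros (_ & _ & H) Hx. replace (⊖ x) with (Rs (-1) x) by vec. auto. Qed.

Lemma subspace_minus S x y : subspace S -> S x -> S y -> S (x ⊖ y).
Proof. intros HS Hx Hy. unfold minus. apply HS; auto. now apply subspace_opp. Qed.

Lemma orth_subspace S : subspace (orth S).
Proof.
repeat split.
- intros s _. apply inner_zero_l.
- intros x y Hx Hy s Hs. rewrite inner_plus_l, Hx, Hy by easy. ring.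
- intros a x Hx s Hs. rewrite inner_scal_l, Hx by easy. ring.
Qed.

Lemma orth_closed S : seq_closed (orth S).
Proof.
intros u l Hu Hl s Hs. apply (cv_inner u (fun _ => s)); auto using cv_const.
intro n. now apply Hu.
Qed.

Lemma orth_self S x : S x -> orth S x -> x = vzero.
Proof.
intros H1 H2. apply norm_eq_0. specialize (H2 x H1). rewrite inner_norm in H2.
apply (f_equal Re) in H2. simpl in H2. nra.
Qed.

(** A complex subspace contains [Ci • s] along with [s], and the real part against [Ci • s] is the
    imaginary part against [s]. *)
Lemma orth_intro S x : subspace S -> (forall s, S s -> rip x s = 0) -> orth S x.
Proof.
intros HS H s Hs. rewrite inner_rip, !H; auto. now apply HS.
Qed.

Lemma inner_0_sym x y : inner x y = RtoC 0 -> inner y x = RtoC 0.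
Proof. intro H. rewrite inner_conj, H. unfold Cconj, RtoC; simpl. f_equal; ring. Qed.

(** A minimising sequence for the distance to [S] is Cauchy by the parallelogram law; at the
    minimiser the first variation of the squared distance vanishes, which is orthogonality. *)
Lemma projection_exists S : subspace S -> seq_closed S ->
  forall x, exists y, S y /\ orth S (x ⊖ y).
Proof.
intros HS HC x.
(* Squared distances enter with a minus sign because [completeness] yields suprema. *)
set (D := fun r : R => exists s, S s /\ r = - (vnorm (x ⊖ s) * vnorm (x ⊖ s))).
destruct (completeness D) as [d' [Hd1 Hd2]].
{ exists 0. intros r (s & _ & ->). pose proof (norm_pos (x ⊖ s)). nra. }
{ exists (- (vnorm (x ⊖ vzero) * vnorm (x ⊖ vzero))), vzero. split; [apply HS|easy]. }
set (d := - d').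
assert (Hd : forall s, S s -> d <= vnorm (x ⊖ s) * vnorm (x ⊖ s)).
{ intros s Hs. unfold d. specialize (Hd1 (- (vnorm (x ⊖ s) * vnorm (x ⊖ s))) (ex_intro _ s (conj Hs eq_refl))). lra. }
assert (Hex : forall n : nat, exists s, S s /\ vnorm (x ⊖ s) * vnorm (x ⊖ s) < d + / (INR n + 1)).
{ intro n. apply NNPP. intro Hn. pose proof (RinvN_pos n).
  assert (d' <= d' - / (INR n + 1)); [|lra].
  apply Hd2. intros r (s & Hs & ->). apply Rnot_lt_le. intro. apply Hn. exists s. split; auto. unfold d; lra. }
destruct (choice _ Hex) as [s Hs].
(* The midpoint of [s n] and [s m] lies in [S], so its squared distance to [x] is at least [d]; the
   parallelogram law turns this into a bound on ‖s n - s m‖². *)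
assert (Hsc : forall n m, vnorm (s n ⊖ s m) * vnorm (s n ⊖ s m) <= 2 * / (INR n + 1) + 2 * / (INR m + 1)).
{ intros n m. pose proof (parallelogram (x ⊖ s n) (x ⊖ s m)) as HP.
  replace (x ⊖ s n ⊖ (x ⊖ s m)) with (⊖ (s n ⊖ s m)) in HP by vec.
  rewrite nrm_opp in HP.
  pose proof (Hd (Rs (/ 2) (s n ⊕ s m))) as H1.
  replace (x ⊖ s n ⊕ (x ⊖ s m)) with (Rs 2 (x ⊖ Rs (/ 2) (s n ⊕ s m))) in HP.
  2: { vec. rewrite RtoC_inv by lra. field. }
  rewrite nrm_rscal, Rabs_right in HP by lra.
  assert (S (Rs (/ 2) (s n ⊕ s m))) by (apply HS, HS; apply Hs).
  specialize (H1 H). pose proof (proj2 (Hs n)). pose proof (proj2 (Hs m)). nra. }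
destruct (cauchy_cv s) as [y Hy].
{ intros eps He. destruct (archimed_cor1 (eps * eps / 4)) as (N & HN1 & HN2); [nra|].
  exists N. intros n m Hn Hm. specialize (Hsc n m).
  assert (Hk : forall k, (N <= k)%nat -> / (INR k + 1) < eps * eps / 4).
  { intros k Hk. eapply Rle_lt_trans; [|apply HN1]. apply Rinv_le_contravar.
    - now apply lt_0_INR.
    - apply le_INR in Hk. lra. }
  pose proof (Hk n Hn). pose proof (Hk m Hm). pose proof (norm_pos (s n ⊖ s m)). nra. }
exists y. assert (HSy : S y) by (apply (HC s); auto; apply Hs). split; auto.
assert (Hyd : vnorm (x ⊖ y) * vnorm (x ⊖ y) <= d).
{ assert (Hb : forall eps, 0 < eps -> vnorm (x ⊖ y) <= sqrt (d + eps) + eps).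
  { intros eps He. destruct (Hy eps He) as [N1 H1].
    destruct (archimed_cor1 eps He) as (N & HN1 & HN2).
    set (k := max N1 N). specialize (H1 k ltac:(lia)).
    pose proof (proj2 (Hs k)) as H2.
    assert (/ (INR k + 1) < eps).
    { eapply Rle_lt_trans; [|apply HN1]. apply Rinv_le_contravar; [now apply lt_0_INR|].
      assert (INR N <= INR k) by (apply le_INR; lia). lra. }
    pose proof (dist_triangle (s k) x y). pose proof (norm_pos (x ⊖ s k)).
    assert (vnorm (x ⊖ s k) <= sqrt (d + eps)).
    { rewrite <- (sqrt_square (vnorm (x ⊖ s k))) by auto. apply sqrt_le_1_alt. lra. }
    lra. }
  apply Rnot_lt_le. intro Hlt.
  assert (Hd0 : 0 <= d).
  { unfold d. assert (d' <= 0); [|lra]. apply Hd2. intros r (s' & _ & ->). pose proof (norm_pos (x ⊖ s')). nra. }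
  set (a := vnorm (x ⊖ y)) in *. pose proof (norm_pos (x ⊖ y)) as Ha. fold a in Ha.
  assert (Ha1 : 0 < a) by nra.
  (* Small enough for (a - e)² > d + e: the difference is a² - d - e(2a + 1) + e², while e(4a + 4)
     is at most a² - d. The bound a / 2 keeps a - e nonnegative, so that squares can be compared. *)
  set (e := Rmin (a / 2) ((a * a - d) / (4 * (a + 1)))).
  assert (He : 0 < e) by (apply Rmin_pos; [lra|apply Rdiv_lt_0_compat; nra]).
  assert (He1 : e <= a / 2) by apply Rmin_l.
  assert (He2 : e * (4 * (a + 1)) <= a * a - d).
  { assert (e <= (a * a - d) / (4 * (a + 1))) by apply Rmin_r.
    apply (Rmult_le_compat_r (4 * (a + 1))) in H; [|lra].
    replace ((a * a - d) / (4 * (a + 1)) * (4 * (a + 1))) with (a * a - d) in H by (field; lra). lra. }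
  specialize (Hb e He).
  assert (Hq : (a - e) * (a - e) <= d + e).
  { rewrite <- (sqrt_sqrt (d + e)) by lra. pose proof (sqrt_pos (d + e)).
    apply Rmult_le_compat; lra. }
  nra. }
apply orth_intro; auto. intros t Ht.
destruct (Req_dec (rip (x ⊖ y) t) 0) as [|Hne]; auto. exfalso.
set (r := rip (x ⊖ y) t) in *.
(* Moving [y] by (r / N) t changes the squared distance by -r²/N - (r/N)², which would take it below
   the infimum. The summand 1 keeps [N] positive when [t] is zero. *)
set (N := vnorm t * vnorm t + 1). assert (HN : 1 <= N) by (unfold N; pose proof (norm_pos t); nra).
assert (HSq : S (y ⊕ Rs (r / N) t)) by (apply HS; auto; now apply HS).
pose proof (Hd _ HSq) as H1.
replace (x ⊖ (y ⊕ Rs (r / N) t)) with ((x ⊖ y) ⊖ Rs (r / N) t) in H1 by vec.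
set (z := x ⊖ y) in *.
assert (HA : vnorm (z ⊖ Rs (r / N) t) * vnorm (z ⊖ Rs (r / N) t) = vnorm z * vnorm z - 2 * (r / N) * r + (r / N) * (r / N) * (N - 1)).
{ rewrite <- !rip_self. ripexp. rewrite (rip_sym t z). fold r. rewrite (rip_self t). unfold N. ring. }
rewrite HA in H1.
assert (HB : - 2 * (r / N) * r + (r / N) * (r / N) * (N - 1) = - (r * r / N) - (r / N) * (r / N)) by (field; lra).
assert (0 < r * r / N) by (apply Rdiv_lt_0_compat; nra).
nra.
Qed.

Lemma closed_orth_full S : subspace S -> seq_closed S -> (forall y, orth S y -> y = vzero) -> forall x, S x.
Proof.
intros HS HC H x. destruct (projection_exists S HS HC x) as (y & Hy & Ho).
apply H in Ho. apply minus_eq_zero in Ho. now subst.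
Qed.

Lemma biorth S x : subspace S -> seq_closed S -> (forall y, orth S y -> inner x y = RtoC 0) -> S x.
Proof.
intros HS HC H. destruct (projection_exists S HS HC x) as (y & Hy & Ho).
assert (x ⊖ y = vzero).
{ apply norm_eq_0. assert (Hi : inner (x ⊖ y) (x ⊖ y) = RtoC 0).
  { rewrite inner_minus_l. rewrite (H _ Ho).
    assert (inner y (x ⊖ y) = RtoC 0) by (apply inner_0_sym; now apply Ho).
    rewrite H0. ring. }
  rewrite inner_norm in Hi. apply (f_equal Re) in Hi. simpl in Hi. nra. }
apply minus_eq_zero in H0. now subst.
Qed.

Lemma proj_unique S x y z : subspace S -> S y -> orth S (x ⊖ y) -> S z -> orth S (x ⊖ z) -> y = z.
Proof.
intros HS Hy Hoy Hz Hoz. apply minus_eq_zero. apply (orth_self S).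
- now apply subspace_minus.
- replace (y ⊖ z) with ((x ⊖ z) ⊖ (x ⊖ y)) by vec. apply subspace_minus; auto using orth_subspace.
Qed.

Lemma proj_spec S x : (exists y, S y /\ orth S (x ⊖ y)) -> S (proj S x) /\ orth S (x ⊖ proj S x).
Proof. intro H. apply (epsilon_spec (inhabits (vzero : E)) _ H). Qed.

Lemma proj_eq S x y : subspace S -> S y -> orth S (x ⊖ y) -> proj S x = y.
Proof.
intros HS Hy Ho. destruct (proj_spec S x) as [H1 H2]; [eauto|].
now apply (proj_unique S x).
Qed.

End Norm.
(** * Selfadjoint operators and square roots *)

Section Operators.
Context {E : HilbertSpace}.
Implicit Types x y z w : E.
Implicit Types T L B : operator E.

Lemma cv_rip_eq (u v : nat -> E) (l m x y : E) :
  cv u l -> cv v m -> (forall n, rip x (u n) = rip y (v n)) -> rip x l = rip y m.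
Proof.
assert (HU : forall (u : nat -> E) l x, cv u l -> Un_cv (fun n => rip x (u n)) (rip x l)).
{ intros u' l' x' H eps He. pose proof (norm_pos x').
  destruct (H (eps / (vnorm x' + 1))) as [N HN]; [apply Rdiv_lt_0_compat; lra|].
  exists N. intros n Hn. unfold Rdist. rewrite <- rip_minus_r.
  eapply Rle_lt_trans; [apply cauchy_schwarz|]. specialize (HN n Hn).
  pose proof (norm_pos (u' n ⊖ l')).
  apply (Rmult_lt_compat_l (vnorm x' + 1)) in HN; [|lra].
  replace ((vnorm x' + 1) * (eps / (vnorm x' + 1))) with eps in HN by (field; lra). nra. }
intros Hu Hv H.
apply (UL_sequence (fun n => rip x (u n))); auto.
intros eps He. destruct (HU v m y Hv eps He) as [N HN]. exists N. intros n Hn. rewrite H. auto.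
Qed.

Lemma dense_orth (S : E -> Prop) y : dense S -> (forall s, S s -> inner s y = RtoC 0) -> y = vzero.
Proof.
intros HS H. apply norm_eq_0. pose proof (norm_pos y) as [Hy|Hy]; [|easy].
destruct (HS y (vnorm y) Hy) as (s & Hs & Hd).
pose proof (rip_le (y ⊖ s) y) as H1. rewrite rip_minus_l, rip_self in H1.
assert (rip s y = 0) by (unfold rip; now rewrite H). rewrite H0 in H1. 
change (vnorm (y ⊖ s) < vnorm y) in Hd. nra.
Qed.

Lemma adjoint_unique T y w w' : dense (dom T) -> adjoint_at T y w -> adjoint_at T y w' -> w = w'.
Proof.
intros HD H1 H2. apply minus_eq_zero. apply (dense_orth (dom T)); auto.
intros s Hs. rewrite inner_minus_r, <- H1, <- H2 by auto. ring.
Qed.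

Lemma selfadjoint_linear T : selfadjoint T -> linear_operator T.
Proof. now intros []. Qed.

Lemma selfadjoint_dense T : selfadjoint T -> dense (dom T).
Proof. now intros (_ & H & _). Qed.

Lemma selfadjoint_adjoint_at T y : selfadjoint T -> dom T y -> adjoint_at T y (T y).
Proof.
intros (_ & _ & H1 & H2) Hy. rewrite <- (H2 y) by now apply H1.
apply (epsilon_spec (inhabits (vzero : E)) (adjoint_at T y)). now apply H1 in Hy.
Qed.

Lemma selfadjoint_sym T x y : selfadjoint T -> dom T x -> dom T y -> inner (T x) y = inner x (T y).
Proof. intros HT Hx Hy. now apply selfadjoint_adjoint_at. Qed.

Lemma selfadjoint_rip T x y : selfadjoint T -> dom T x -> dom T y -> rip (T x) y = rip x (T y).
Proof. intros. unfold rip. now rewrite selfadjoint_sym. Qed.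

(** Selfadjointness in its maximal form: the way to prove membership in [dom T] is to exhibit an
    adjoint value. *)
Lemma selfadjoint_max T y w : selfadjoint T -> adjoint_at T y w -> dom T y /\ T y = w.
Proof.
intros HT H. assert (Hy : dom T y) by (apply HT; now exists w). split; auto.
apply (adjoint_unique T y); auto using selfadjoint_adjoint_at, selfadjoint_dense.
Qed.

Lemma selfadjoint_intro T : linear_operator T -> dense (dom T) ->
  (forall x y, dom T x -> dom T y -> inner (T x) y = inner x (T y)) ->
  (forall y w, adjoint_at T y w -> dom T y) -> selfadjoint T.
Proof.
intros HL HD HS HM. split; [auto|split; [auto|split; [intro x; split|intro x]]].
- intros (w & Hw). now apply (HM x w).
- intro Hx. exists (T x). intros z Hz. auto.
- intros (w & Hw). simpl. pose proof (HM x w Hw).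
  apply (adjoint_unique T x); auto.
  + apply (epsilon_spec (inhabits (vzero : E)) (adjoint_at T x)). eauto.
  + intros z Hz. auto.
Qed.

Lemma lin_minus T x y : linear_operator T -> dom T x -> dom T y ->
  dom T (x ⊖ y) /\ T (x ⊖ y) = T x ⊖ T y.
Proof.
intros (_ & H1 & H2) Hx Hy.
replace (x ⊖ y) with (x ⊕ Rs (-1) y) by vec.
destruct (H2 (RtoC (-1)) y Hy) as [H3 H4]. destruct (H1 x _ Hx H3) as [H5 H6].
split; auto. rewrite H6, H4. vec.
Qed.

Lemma lin_plus T x y : linear_operator T -> dom T x -> dom T y ->
  dom T (x ⊕ y) /\ T (x ⊕ y) = T x ⊕ T y.
Proof. intros (_ & H1 & H2); auto. Qed.

Lemma lin_scal T (a : C) x : linear_operator T -> dom T x ->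
  dom T (a • x) /\ T (a • x) = a • T x.
Proof. intros (_ & H1 & H2); auto. Qed.

Lemma lin_zero T : linear_operator T -> dom T vzero /\ T vzero = vzero.
Proof.
intro HT. pose proof HT as (H0 & _). split; auto.
destruct (lin_minus T vzero vzero HT H0 H0) as [_ H].
replace (vzero ⊖ vzero) with (vzero : E) in H by vec. rewrite H. vec.
Qed.

Lemma adjoint_at_rip T y w : linear_operator T -> (forall x, dom T x -> rip (T x) y = rip x w) -> adjoint_at T y w.
Proof.
intros HT H x Hx. rewrite !inner_rip, H by auto. f_equal.
destruct (lin_scal T Ci x HT Hx) as [H1 H2].
rewrite !rip_Ci_r, <- H2, H; auto.
Qed.

(** An adjoint has a closed graph: the pairings with a fixed vector of [dom T] pass to the limit,
    and [selfadjoint_max] concludes. *)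
Lemma selfadjoint_closed T (u : nat -> E) (l m : E) : selfadjoint T -> (forall n, dom T (u n)) ->
  cv u l -> cv (fun n => T (u n)) m -> dom T l /\ T l = m.
Proof.
intros HT Hu Hl Hm. apply selfadjoint_max; auto. apply adjoint_at_rip; [apply HT|].
intros x Hx. apply (cv_rip_eq u (fun n => T (u n))); auto.
intro n. now apply selfadjoint_rip.
Qed.

Lemma dom_subspace T : linear_operator T -> subspace (dom T).
Proof. intros (H0 & H1 & H2). repeat split; auto; intros; [now apply H1|now apply H2]. Qed.

Lemma Ker_subspace T : linear_operator T -> subspace (Ker T).
Proof.
intros HT. split; [|split].
- now apply lin_zero.
- intros x y [H1 H2] [H3 H4]. destruct (lin_plus T x y HT H1 H3) as [H5 H6].
  split; auto. rewrite H6, H2, H4. vec.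
- intros a x [H1 H2]. destruct (lin_scal T a x HT H1) as [H5 H6].
  split; auto. rewrite H6, H2. vec.
Qed.

Lemma Ran_subspace T : linear_operator T -> subspace (Ran T).
Proof.
intros HT. split; [|split].
- exists vzero. now apply lin_zero.
- intros x y (x' & H1 & <-) (y' & H3 & <-). exists (x' ⊕ y'). now apply lin_plus.
- intros a x (x' & H1 & <-). exists (a • x'). now apply lin_scal.
Qed.

Lemma Ker_closed T : selfadjoint T -> seq_closed (Ker T).
Proof.
intros HT u l Hu Hl. apply (selfadjoint_closed T u); auto.
- intro n. apply Hu.
- apply (cv_ext (fun _ => vzero)); [|apply cv_const]. intro n. symmetry. apply Hu.
Qed.

Lemma orth_Ran_Ker T y : selfadjoint T -> orth (Ran T) y -> Ker T y.
Proof.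
intros HT H. apply selfadjoint_max; auto. intros x Hx. rewrite inner_zero_r.
apply inner_0_sym, H. now exists x.
Qed.

Lemma Ker_orth_Ran T y : selfadjoint T -> Ker T y -> orth (Ran T) y.
Proof.
intros HT [H1 H2] s (x & Hx & <-). rewrite <- selfadjoint_sym, H2 by auto. apply inner_zero_l.
Qed.

(** The lower bound makes the range of T - z closed, and a vector orthogonal to that range is an
    eigenvector of [T] for the conjugate of [z], hence zero. *)
Lemma selfadjoint_surjective T (z : C) (c : R) : selfadjoint T -> 0 < c ->
  (forall x, dom T x -> c * vnorm x <= vnorm (T x ⊖ z • x)) ->
  (forall y, dom T y -> T y = Cconj z • y -> y = vzero) ->
  forall y, exists x, dom T x /\ T x ⊖ z • x = y.
Proof.
intros HT Hc HB HI.
pose proof (selfadjoint_linear T HT) as HL.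
assert (Hlin : linear_operator (mk_op (dom T) (fun x => T x ⊖ z • x))).
{ split; [|split]; simpl.
  - apply HL.
  - intros x y Hx Hy. destruct (lin_plus T x y HL Hx Hy) as [H1 H2]. split; auto.
    rewrite H2. vec.
  - intros a x Hx. destruct (lin_scal T a x HL Hx) as [H1 H2]. split; auto. rewrite H2. vec. }
apply (closed_orth_full (Ran (mk_op (dom T) (fun x => T x ⊖ z • x)))).
- now apply Ran_subspace.
- intros u l Hu Hl. destruct (choice _ Hu) as [x Hx]. simpl in Hx.
  assert (HD : forall n m, c * vnorm (x n ⊖ x m) <= vnorm (u n ⊖ u m)).
  { intros n m. destruct (Hx n) as [Hn <-]. destruct (Hx m) as [Hm <-].
    destruct (lin_minus _ _ _ Hlin Hn Hm) as [H1 H2]. simpl in *. rewrite <- H2. now apply HB. }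
  destruct (cauchy_cv x) as [p Hp].
  { intros eps He. destruct (Hl (c * eps / 2)) as [N HN]; [nra|].
    exists N. intros n m Hn Hm. specialize (HD n m). pose proof (HN n Hn) as A1. pose proof (HN m Hm) as A2.
    pose proof (dist_triangle l (u n) (u m)). rewrite (minus_sym l) in H. nra. }
  assert (HTx : cv (fun n => T (x n)) (l ⊕ z • p)).
  { apply (cv_ext (fun n => u n ⊕ z • x n)); [|now apply cv_plus; [|apply cv_scal]].
    intro n. destruct (Hx n) as [_ <-]. vec. }
  destruct (selfadjoint_closed T x p (l ⊕ z • p)) as [H1 H2]; auto; [intro; apply Hx|].
  exists p. simpl. split; auto. rewrite H2. vec.
- intros y Hy.
  destruct (selfadjoint_max T y (Cconj z • y) HT) as [H1 H2]; [|now apply HI].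
  intros x Hx. 
  assert (H : inner (T x ⊖ z • x) y = RtoC 0) by (apply inner_0_sym, Hy; now exists x).
  rewrite inner_minus_l, inner_scal_l in H. rewrite inner_scal_r, Cconj_conj.
  replace (inner (T x) y) with (Cplus (Cminus (inner (T x) y) (Cmult z (inner x y))) (Cmult z (inner x y))) by ring.
  rewrite H. ring.
Qed.

Definition linmap (A : E -> E) :=
  (forall x y, A (x ⊕ y) = A x ⊕ A y) /\ (forall (a : C) x, A (a • x) = a • A x).
Definition symmetric (A : E -> E) := forall x y, inner (A x) y = inner x (A y).
Definition contraction (A : E -> E) := forall x, vnorm (A x) <= vnorm x.

Lemma linmap_minus A x y : linmap A -> A (x ⊖ y) = A x ⊖ A y.
Proof.
intros [H1 H2]. replace (x ⊖ y) with (x ⊕ Rs (-1) y) by vec. rewrite H1, H2. vec.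
Qed.

Lemma linmap_zero A : linmap A -> A vzero = vzero.
Proof. intros [H1 H2]. replace (vzero : E) with (Rs 0 (vzero : E)) at 1 by vec. rewrite H2. vec. Qed.

Lemma linmap_is_linear A M : linmap A -> (forall x, vnorm (A x) <= M * vnorm x) -> is_linear A.
Proof.
intros [H1 H2] H. split; auto. exists (Rabs M + 1). pose proof (Rabs_pos M). pose proof (Rle_abs M). split; [lra|].
intro x. specialize (H x). pose proof (norm_pos x).
change (vnorm (A x) <= (Rabs M + 1) * vnorm x). nra.
Qed.

Lemma is_linear_linmap (A : E -> E) : is_linear A -> linmap A.
Proof. intro H. split; [exact (linear_plus A H)|exact (linear_scal A H)]. Qed.

Lemma is_linear_bound (A : E -> E) : is_linear A -> exists M, 0 < M /\ forall x, vnorm (A x) <= M * vnorm x.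
Proof. intro H. exact (linear_norm A H). Qed.

Lemma is_linear_cv (A : E -> E) (u : nat -> E) (l : E) : is_linear A -> cv u l -> cv (fun n => A (u n)) (A l).
Proof.
intros HA. destruct (is_linear_bound A HA) as (M & _ & HM).
apply (cv_lip _ _ _ _ M). intro n. rewrite <- linmap_minus by now apply is_linear_linmap. apply HM.
Qed.

Section Sqrt.
Variable A : E -> E.
Hypothesis A_lin : linmap A.
Hypothesis A_sym : symmetric A.
Hypothesis A_contr : contraction A.

(** The iteration [Y <- (A + Y^2) / 2] solves [(1 - Y)^2 = 1 - A]; its
    increments are dominated by those of the same scalar iteration at [A = 1]. *)
Fixpoint sqrt_iter (n : nat) : E -> E :=
  match n with
  | O => fun _ => vzero
  | S n => fun x => Rs (/ 2) (A x ⊕ sqrt_iter n (sqrt_iter n x))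
  end.

Fixpoint sqrt_bound (n : nat) : R :=
  match n with
  | O => 0
  | S n => (1 + sqrt_bound n * sqrt_bound n) / 2
  end.

Lemma sqrt_bound_range n : 0 <= sqrt_bound n <= 1.
Proof. induction n; simpl; [lra|nra]. Qed.

Lemma sqrt_bound_incr n : sqrt_bound n <= sqrt_bound (S n).
Proof. simpl. pose proof (Rle_0_sqr (sqrt_bound n - 1)) as H. unfold Rsqr in H. lra. Qed.

Lemma sqrt_bound_cv : exists l, Un_cv sqrt_bound l.
Proof.
destruct (growing_cv sqrt_bound) as [l Hl].
- intro n. apply sqrt_bound_incr.
- exists 1. intros r (n & ->). apply sqrt_bound_range.
- now exists l.
Qed.

Lemma sqrt_iter_lin n : linmap (sqrt_iter n).
Proof.
destruct A_lin as [A1 A2].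
induction n as [|n [H1 H2]]; split; simpl; intros.
- vec.
- vec.
- rewrite A1, !H1. vec.
- rewrite A2, !H2. vec.
Qed.

Lemma sqrt_iter_sym n : symmetric (sqrt_iter n).
Proof.
induction n; intros x y; simpl.
- now rewrite inner_zero_l, inner_zero_r.
- rewrite inner_scal_l, inner_scal_r, inner_plus_l, inner_plus_r, A_sym, !IHn.
  replace (Cconj (RtoC (/ 2))) with (RtoC (/ 2)); [ring|]. unfold Cconj, RtoC; simpl. f_equal; ring.
Qed.

(** The iterates are polynomials in [A], so whatever commutes with [A] commutes with them. *)
Lemma sqrt_iter_comm D n : linmap D -> (forall x, D (A x) = A (D x)) ->
  forall x, D (sqrt_iter n x) = sqrt_iter n (D x).
Proof.
intros HD HA. induction n; intro x; simpl.
- now apply linmap_zero.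
- destruct HD as [D1 D2]. now rewrite D2, D1, HA, !IHn.
Qed.

Lemma sqrt_iter_comm2 n m x : sqrt_iter n (sqrt_iter m x) = sqrt_iter m (sqrt_iter n x).
Proof.
apply sqrt_iter_comm; [apply sqrt_iter_lin|]. intro y. symmetry. now apply sqrt_iter_comm.
Qed.

Lemma sqrt_iter_norm n x : vnorm (sqrt_iter n x) <= sqrt_bound n * vnorm x.
Proof.
revert x; induction n; intro x; simpl.
- rewrite nrm_zero. lra.
- rewrite nrm_rscal, Rabs_right by lra.
  pose proof (nrm_triangle (A x) (sqrt_iter n (sqrt_iter n x))).
  pose proof (IHn (sqrt_iter n x)). pose proof (IHn x). pose proof (A_contr x).
  pose proof (sqrt_bound_range n).
  assert (sqrt_bound n * vnorm (sqrt_iter n x) <= sqrt_bound n * (sqrt_bound n * vnorm x)) by (apply Rmult_le_compat_l; lra).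
  nra.
Qed.

(** Since the iterates commute, Y_{n+2} - Y_{n+1} = (Y_{n+1} - Y_n)(Y_{n+1} + Y_n) / 2. The scalar
    sequence obeys the same identity, so domination passes from n to n + 1. *)
Lemma sqrt_iter_diff n x :
  vnorm (sqrt_iter (S n) x ⊖ sqrt_iter n x) <= (sqrt_bound (S n) - sqrt_bound n) * vnorm x.
Proof.
revert x; induction n; intro x.
- simpl. replace (Rs (/ 2) (A x ⊕ vzero) ⊖ vzero) with (Rs (/ 2) (A x)) by vec.
  rewrite nrm_rscal, Rabs_right by lra. pose proof (A_contr x). lra.
- set (D := fun x => sqrt_iter (S n) x ⊖ sqrt_iter n x).
  replace (sqrt_iter (S (S n)) x ⊖ sqrt_iter (S n) x) with
    (Rs (/ 2) (D (sqrt_iter (S n) x) ⊕ D (sqrt_iter n x))).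
  2: { unfold D. rewrite (sqrt_iter_comm2 n (S n)).
       symmetry. transitivity (Rs (/ 2) (A x ⊕ sqrt_iter (S n) (sqrt_iter (S n) x)) ⊖
         Rs (/ 2) (A x ⊕ sqrt_iter n (sqrt_iter n x))); [reflexivity|vec]. }
  rewrite nrm_rscal, Rabs_right by lra.
  pose proof (nrm_triangle (D (sqrt_iter (S n) x)) (D (sqrt_iter n x))) as H0.
  pose proof (IHn (sqrt_iter (S n) x)) as H1. pose proof (IHn (sqrt_iter n x)) as H2. fold (D (sqrt_iter (S n) x)) in H1. fold (D (sqrt_iter n x)) in H2.
  pose proof (sqrt_iter_norm (S n) x) as H3. pose proof (sqrt_iter_norm n x) as H4.
  pose proof (sqrt_bound_incr n) as H5.
  change (sqrt_bound (S (S n))) with ((1 + sqrt_bound (S n) * sqrt_bound (S n)) / 2).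
  replace ((1 + sqrt_bound (S n) * sqrt_bound (S n)) / 2 - sqrt_bound (S n)) with
    (/ 2 * ((sqrt_bound (S n) - sqrt_bound n) * (sqrt_bound (S n) + sqrt_bound n))) by (simpl; field).
  set (p := sqrt_bound (S n)) in *. set (q := sqrt_bound n) in *.
  apply (Rmult_le_compat_l (p - q)) in H3; [|lra].
  apply (Rmult_le_compat_l (p - q)) in H4; [|lra]. nra.
Qed.

Lemma sqrt_iter_diff_le n m x : (n <= m)%nat ->
  vnorm (sqrt_iter m x ⊖ sqrt_iter n x) <= (sqrt_bound m - sqrt_bound n) * vnorm x.
Proof.
induction 1 as [|m Hm IH].
- replace (sqrt_iter n x ⊖ sqrt_iter n x) with (vzero : E) by vec. rewrite nrm_zero. lra.
- pose proof (dist_triangle (sqrt_iter m x) (sqrt_iter (S m) x) (sqrt_iter n x)).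
  pose proof (sqrt_iter_diff m x). lra.
Qed.

(** [S] is 1 - Y with Y the limit of the iterates, which satisfies Y² = 2Y - A. The third clause
    stands in for positivity: it says that 1 - S is again a contraction, so the construction can be
    repeated to give a symmetric root of [S]. The last clause lets several such roots commute. *)
Lemma bounded_sqrt : exists S : E -> E,
  linmap S /\ symmetric S /\ (forall x, vnorm (x ⊖ S x) <= vnorm x) /\
  (forall x, S (S x) = x ⊖ A x) /\
  forall D, is_linear D -> (forall x, D (A x) = A (D x)) -> forall x, D (S x) = S (D x).
Proof.
destruct sqrt_bound_cv as [yl Hyl].
assert (Hex : forall x, exists l, cv (fun n => sqrt_iter n x) l).
{ intro x. apply (cauchy_dominated _ sqrt_bound yl (vnorm x)); auto.
  intros n m Hnm. pose proof (sqrt_iter_diff_le n m x Hnm).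
  pose proof (Rle_abs (sqrt_bound m - sqrt_bound n)). pose proof (norm_pos x). nra. }
destruct (choice _ Hex) as [Y HY].
assert (Ylin : linmap Y).
{ split.
  - intros x y. apply (cv_unique (fun n => sqrt_iter n (x ⊕ y))); auto.
    apply (cv_ext (fun n => sqrt_iter n x ⊕ sqrt_iter n y)); [|now apply cv_plus].
    intro n. symmetry. apply sqrt_iter_lin.
  - intros a x. apply (cv_unique (fun n => sqrt_iter n (a • x))); auto.
    apply (cv_ext (fun n => a • sqrt_iter n x)); [|now apply cv_scal].
    intro n. symmetry. apply sqrt_iter_lin. }
assert (Ysym : forall x y, rip (Y x) y = rip x (Y y)).
{ intros x y. rewrite rip_sym. 
  apply (cv_rip_eq (fun n => sqrt_iter n x) (fun n => sqrt_iter n y)); auto.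
  intro n. rewrite rip_sym. unfold rip. now rewrite sqrt_iter_sym. }
assert (Yn : forall n x, vnorm (sqrt_iter n x) <= vnorm x).
{ intros n x. pose proof (sqrt_iter_norm n x). pose proof (sqrt_bound_range n). pose proof (norm_pos x). nra. }
assert (Yc : contraction Y).
{ intro x. now apply (cv_norm_le (fun n => sqrt_iter n x)). }
assert (YY : forall x, Y (Y x) = Rs 2 (Y x) ⊖ A x).
{ intro x. apply (cv_unique (fun n => sqrt_iter n (sqrt_iter n x))).
  - intros eps He. destruct (HY x (eps / 2)) as [N1 H1]; [lra|]. destruct (HY (Y x) (eps / 2)) as [N2 H2]; [lra|].
    exists (max N1 N2). intros n Hn. specialize (H1 n ltac:(lia)). specialize (H2 n ltac:(lia)).
    pose proof (dist_triangle (sqrt_iter n (Y x)) (sqrt_iter n (sqrt_iter n x)) (Y (Y x))) as H3.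
    rewrite <- linmap_minus in H3 by apply sqrt_iter_lin.
    pose proof (Yn n (sqrt_iter n x ⊖ Y x)). lra.
  - apply (cv_ext (fun n => Rs 2 (sqrt_iter (S n) x) ⊖ A x)).
    + intro n. simpl. vec. rewrite RtoC_inv by lra. field.
    + apply cv_minus; [|apply cv_const]. apply cv_scal. apply (cv_shift (fun n => sqrt_iter n x)); auto. }
exists (fun x => x ⊖ Y x). split; [|split; [|split; [|split]]].
- destruct Ylin as [H1 H2]. split; intros; [rewrite H1|rewrite H2]; vec.
- intros x y. rewrite inner_minus_l, inner_minus_r. f_equal.
  rewrite !inner_rip, Ysym. f_equal. rewrite Ysym. destruct Ylin as [_ H2]. now rewrite H2.
- intro x. replace (x ⊖ (x ⊖ Y x)) with (Y x) by vec. apply Yc.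
- intro x. rewrite linmap_minus by auto. rewrite YY. vec.
- intros D HD HA x. pose proof (is_linear_linmap D HD) as HDl.
  rewrite linmap_minus by auto. f_equal.
  apply (cv_unique (fun n => D (sqrt_iter n x))); [now apply is_linear_cv|].
  apply (cv_ext (fun n => sqrt_iter n (D x))); auto.
  intro n. symmetry. now apply sqrt_iter_comm.
Qed.

End Sqrt.

(** With [S^2 = T = (1 + B)^-1] and [Q^2 = 1 - T], the root is [Q S^-1]. *)
Lemma op_sqrt_exists B : selfadjoint B -> nonnegative B ->
  exists L, selfadjoint L /\ nonnegative L /\ op_eq (Defs.comp L L) B.
Proof.
intros HB HN. pose proof (selfadjoint_linear B HB) as HL.
(* The cross term 2<Bx, x> is nonnegative. From this inequality follow the bijectivity of 1 + B and
   the fact that both [T] and 1 - T are contractions, as [bounded_sqrt] requires. *)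
assert (Hsq : forall x, dom B x -> vnorm x * vnorm x + vnorm (B x) * vnorm (B x) <= vnorm (B x ⊕ x) * vnorm (B x ⊕ x)).
{ intros x Hx. rewrite <- !rip_self. ripexp. rewrite (rip_sym x (B x)).
  pose proof (HN x Hx) as H. change (0 <= rip (B x) x) in H. lra. }
assert (Hex : forall y, exists x, dom B x /\ B x ⊕ x = y).
{ intro y. destruct (selfadjoint_surjective B (RtoC (-1)) 1 HB) with (y := y) as (x & Hx & Hy); [lra| | |].
  - intros x Hx. replace (B x ⊖ Rs (-1) x) with (B x ⊕ x) by vec.
    specialize (Hsq x Hx). pose proof (norm_pos x). pose proof (norm_pos (B x ⊕ x)). nra.
  - intros x Hx H. specialize (Hsq x Hx). apply norm_eq_0.
    assert (B x ⊕ x = vzero).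
    { rewrite H. vec. unfold Cconj, RtoC, Cmult, Cplus; simpl. f_equal; ring. }
    rewrite H0, nrm_zero in Hsq. pose proof (norm_pos x). nra.
  - exists x. split; auto. rewrite <- Hy. vec. }
destruct (choice _ Hex) as [T HT].
assert (Tinj : forall x, dom B x -> T (B x ⊕ x) = x).
{ intros x Hx. destruct (HT (B x ⊕ x)) as [H1 H2]. set (x' := T (B x ⊕ x)) in *.
  destruct (lin_minus B x' x HL H1 Hx) as [H3 H4]. apply nrm_dist_0.
  specialize (Hsq _ H3). rewrite H4 in Hsq.
  replace (B x' ⊖ B x ⊕ (x' ⊖ x)) with (vzero : E) in Hsq.
  - rewrite nrm_zero in Hsq. pose proof (norm_pos (x' ⊖ x)). nra.
  - replace (B x' ⊖ B x ⊕ (x' ⊖ x)) with ((B x' ⊕ x') ⊖ (B x ⊕ x)) by vec. rewrite H2. vec. }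
assert (Tlin : linmap T).
{ split.
  - intros x y. destruct (HT x) as [Hx1 Hx2]. destruct (HT y) as [Hy1 Hy2].
    destruct (lin_plus B _ _ HL Hx1 Hy1) as [H1 H2].
    rewrite <- (Tinj _ H1). f_equal. rewrite H2, <- Hx2 at 1. rewrite <- Hy2 at 1. vec.
  - intros a x. destruct (HT x) as [Hx1 Hx2]. destruct (lin_scal B a _ HL Hx1) as [H1 H2].
    rewrite <- (Tinj _ H1). f_equal. rewrite H2, <- Hx2 at 1. vec. }
assert (Tsym : symmetric T).
{ intros x y. destruct (HT x) as [Hx1 Hx2]. destruct (HT y) as [Hy1 Hy2].
  rewrite <- Hy2 at 1. rewrite <- Hx2 at 2. rewrite inner_plus_l, inner_plus_r.
  now rewrite (selfadjoint_sym B) by auto. }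
assert (Tsq : forall x, vnorm (T x) * vnorm (T x) + vnorm (x ⊖ T x) * vnorm (x ⊖ T x) <= vnorm x * vnorm x).
{ intro x. destruct (HT x) as [H1 H2]. pose proof (Hsq _ H1) as H3. rewrite H2 in H3.
  replace (x ⊖ T x) with (B (T x)); [easy|]. rewrite <- H2 at 2. vec. }
assert (Tcon : contraction T).
{ intro x. apply nrm_le. specialize (Tsq x). pose proof (norm_pos (x ⊖ T x)). nra. }
assert (Acon : contraction (fun x => x ⊖ T x)).
{ intro x. apply nrm_le. specialize (Tsq x). pose proof (norm_pos (T x)). nra. }
assert (Alin : linmap (fun x => x ⊖ T x)).
{ destruct Tlin as [H1 H2]. split; intros; [rewrite H1|rewrite H2]; vec. }
assert (Asym : symmetric (fun x => x ⊖ T x)).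
{ intros x y. now rewrite inner_minus_l, inner_minus_r, Tsym. }
destruct (bounded_sqrt _ Alin Asym Acon) as (S & Slin & Ssym & Scon & SS & Scomm).
destruct (bounded_sqrt _ Tlin Tsym Tcon) as (Q & Qlin & Qsym & Qcon & QQ & Qcomm).
assert (SST : forall x, S (S x) = T x) by (intro x; rewrite SS; vec).
assert (bound : forall F : E -> E, linmap F -> (forall x, vnorm (x ⊖ F x) <= vnorm x) -> is_linear F).
{ intros F HF H. apply (linmap_is_linear F 2); auto. intro x. pose proof (nrm_le_dist (F x) x). rewrite minus_sym in H0.
  specialize (H x). lra. }
assert (Sbd : is_linear S) by auto. assert (Qbd : is_linear Q) by auto.
assert (Tbd : is_linear T).
{ apply (linmap_is_linear T 1); auto. intro x. rewrite Rmult_1_l. apply Tcon. }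
assert (QT : forall x, Q (T x) = T (Q x)).
{ intro x. symmetry. now apply Qcomm. }
assert (QS : forall x, Q (S x) = S (Q x)).
{ apply Scomm; auto. intro x. rewrite linmap_minus by auto. now rewrite QT. }
(* The root [P] of [S] serves nonnegativity: for x = S x' the pairing <L x, x> is <Q x', P P x'> =
   <Q P x', P x'>, a quadratic form of [Q]. *)
assert (S2 : exists P, linmap P /\ symmetric P /\ (forall x, P (P x) = S x) /\ forall x, Q (P x) = P (Q x)).
{ destruct (bounded_sqrt (fun x => x ⊖ S x)) as (P & Plin & Psym & _ & PP & Pcomm).
  - destruct Slin as [H1 H2]. split; intros; [rewrite H1|rewrite H2]; vec.
  - intros x y. now rewrite inner_minus_l, inner_minus_r, Ssym.
  - exact Scon.
  - exists P. split; [|split; [|split]]; auto.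
    + intro x. rewrite PP. vec.
    + apply Pcomm; auto. intro x. rewrite linmap_minus by auto. now rewrite QS. }
destruct S2 as (P & Plin & Psym & PP & QP).
assert (Sinj : forall x, S x = vzero -> x = vzero).
{ intros x Hx. assert (HTx : T x = vzero) by (rewrite <- SST, Hx; now apply linmap_zero).
  destruct (HT x) as [H1 H2]. rewrite HTx in H2.
  destruct (lin_zero B HL) as [_ H3]. rewrite H3 in H2. rewrite <- H2. vec. }
assert (Sinj2 : forall x y, S x = S y -> x = y).
{ intros x y H. apply minus_eq_zero, Sinj. rewrite linmap_minus by auto. rewrite H. vec. }
set (L := mk_op (fun x => exists y, S y = x) (fun x => Q (epsilon (inhabits (vzero : E)) (fun y => S y = x)))).
assert (HLS : forall y, L (S y) = Q y).
{ intro y. simpl. f_equal. apply Sinj2. apply (epsilon_spec (inhabits (vzero : E)) (fun z => S z = S y)). now exists y. }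
assert (Ldom : forall y, dom L (S y)) by (intro y; now exists y).
exists L. split; [|split].
- apply selfadjoint_intro.
  + split; [|split].
    * exists vzero. now apply linmap_zero.
    * intros x y (x' & <-) (y' & <-). destruct Slin as [H1 H2]. rewrite <- H1. split; auto. rewrite !HLS. apply Qlin.
    * intros a x (x' & <-). destruct Slin as [H1 H2]. rewrite <- H2. split; auto. rewrite !HLS. apply Qlin.
  + intros x eps He. destruct (selfadjoint_dense B HB x eps He) as (y & Hy & Hd).
    exists y. split; auto. exists (S (B y ⊕ y)). rewrite SST. auto.
  + intros x y (x' & <-) (y' & <-). rewrite !HLS. now rewrite Qsym, QS, Ssym.
  + intros z w Hz.
    assert (H : Q z = S w).
    { apply inner_ext. intro v. specialize (Hz (S v) (Ldom v)). rewrite HLS in Hz.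
      rewrite Qsym, Ssym. rewrite inner_conj, Hz. symmetry. apply inner_conj. }
    (* Since S² + Q² = T + (1 - T) = 1, the vector z equals S(Sz) + Q(Qz) = S(Sz + Qw), so it lies
       in the range of [S], the domain of [L]. *)
    exists (S z ⊕ Q w). destruct Slin as [H1 _]. rewrite H1, SST, <- QS, <- H, QQ. vec.
- intros x (x' & <-). rewrite HLS. rewrite <- PP. 
  replace (inner (Q x') (P (P x'))) with (inner (Q (P x')) (P x')) by now rewrite QP, Psym.
  set (y := P x').
  (* [Q] is the square of a symmetric operator as well *)
  destruct (bounded_sqrt (fun x => x ⊖ Q x)) as (Q2 & _ & Q2sym & _ & QQ2 & _).
  + destruct Qlin as [H1 H2]. split; intros; [rewrite H1|rewrite H2]; vec.
  + intros u v. now rewrite inner_minus_l, inner_minus_r, Qsym.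
  + exact Qcon.
  + replace (Q y) with (Q2 (Q2 y)) by (rewrite QQ2; vec). rewrite Q2sym.
    change (0 <= rip (Q2 y) (Q2 y)). rewrite rip_self. pose proof (norm_pos (Q2 y)). nra.
- split.
  + intro x. split.
    * intros [(y & <-) H]. rewrite HLS in H. destruct H as [u Hu].
      (* The same identity S² + Q² = 1, now with Q y = S u. It gives S y = S(S p) = T p for p = S y
         + Q u, a vector of [dom B]. *)
      replace y with (S (S y ⊕ Q u)).
      { rewrite SST. apply HT. }
      destruct Slin as [H1 _]. rewrite H1, SST, <- QS, Hu, QQ. vec.
    * intro Hx. rewrite <- (Tinj x Hx), <- SST. split; [auto|]. rewrite HLS, QS. auto.
  + intros x [(y & <-) H]. cbn [op_fun Defs.comp]. rewrite HLS in *. destruct H as [u Hu].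
    assert (Hy : y = S (S y ⊕ Q u)).
    { destruct Slin as [H1 _]. rewrite H1, SST, <- QS, Hu, QQ. vec. }
    rewrite <- Hu, HLS.
    set (p := S y ⊕ Q u) in *. assert (Hxp : S y = T p) by (rewrite Hy, SST; reflexivity).
    rewrite Hxp. destruct (HT p) as [H1 H2].
    assert (Hup : u = Q p). { apply Sinj2. rewrite Hu, Hy. now rewrite QS. }
    rewrite Hup, QQ. rewrite <- H2 at 1. vec.
Qed.

End Operators.

(** * The spectral gap *)

Section Gap.
Context {E : HilbertSpace}.
Implicit Types x y z : E.
Implicit Types T L B : operator E.

Lemma selfadjoint_rip_Ci T x : selfadjoint T -> dom T x -> rip (T x) (Ci • x) = 0.
Proof.
intros HT Hx. destruct (lin_scal T Ci x (selfadjoint_linear T HT) Hx) as [H1 H2].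
assert (H : rip (T x) (Ci • x) = - rip (T x) (Ci • x)); [|lra].
rewrite (selfadjoint_rip T) at 1 by auto. rewrite H2, rip_Ci_r, rip_sym. easy.
Qed.

(** <Tx, x> is real, so [T x] and [Ci • x] are orthogonal in the real inner product and the cross
    term vanishes. *)
Lemma shift_norm T (a : R) x : selfadjoint T -> dom T x ->
  vnorm (T x ⊕ Rs a (Ci • x)) * vnorm (T x ⊕ Rs a (Ci • x)) =
  vnorm (T x) * vnorm (T x) + a * a * (vnorm x * vnorm x).
Proof.
intros HT Hx. rewrite <- !rip_self. ripexp.
rewrite (rip_sym (Ci • x) (T x)), selfadjoint_rip_Ci, rip_CiCi by auto. ring.
Qed.

Lemma shift_surjective T (a : R) : selfadjoint T -> a <> 0 ->
  forall y, exists x, dom T x /\ T x ⊕ Rs a (Ci • x) = y.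
Proof.
intros HT Ha y.
assert (Hz : forall x, T x ⊖ Cmult (RtoC (- a)) Ci • x = T x ⊕ Rs a (Ci • x)) by (intro; vec).
destruct (selfadjoint_surjective T (Cmult (RtoC (- a)) Ci) (Rabs a) HT) with (y := y) as (x & Hx & H).
- now apply Rabs_pos_lt.
- intros x Hx. rewrite Hz. apply sq_le; [apply norm_pos|]. rewrite shift_norm by auto.
  replace (Rabs a * vnorm x * (Rabs a * vnorm x)) with (Rabs a * Rabs a * (vnorm x * vnorm x)) by ring.
  rewrite <- Rabs_mult, (Rabs_right (a * a)) by nra. pose proof (norm_pos (T x)). nra.
- intros x Hx H. apply norm_eq_0. pose proof (shift_norm T (- a) x HT Hx) as HN.
  replace (T x ⊕ Rs (- a) (Ci • x)) with (vzero : E) in HN.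
  + rewrite nrm_zero in HN. pose proof (norm_pos (T x)). pose proof (norm_pos x).
    assert (Haa : 0 < a * a) by nra. destruct (norm_pos x) as [Hp|]; [exfalso|easy].
    assert (0 < a * a * (vnorm x * vnorm x)) by (apply Rmult_lt_0_compat; nra). nra.
  + rewrite H. vec. unfold Cconj, RtoC, Cmult, Cplus, Copp, Ci; simpl. f_equal; ring.
- exists x. split; auto. now rewrite <- Hz.
Qed.

(** The resolvent at the midpoint of the gap has norm equal to its spectral
    radius: if the norm [r] exceeded [2 / delta], then [Q - r] and [Q + r] would
    be bounded below, and so would [Q^2 - r^2]. *)
Lemma gap_quadratic B (delta : R) : selfadjoint B -> 0 < delta ->
  (forall lam : R, 0 < lam < delta -> in_resolvent_set B (RtoC lam)) ->
  forall x, dom B x -> delta * rip (B x) x <= vnorm (B x) * vnorm (B x).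
Proof.
intros HB Hd HR.
(* The target is ‖(B - mu)x‖ >= mu ‖x‖: after squaring, mu² ‖x‖² cancels and 2 mu = delta remains in
   front of <Bx, x>. *)
set (mu := delta / 2).
destruct (HR mu) as (Q & Qbd & Q1 & Q2); [unfold mu; lra|].
assert (Qlin := is_linear_linmap Q Qbd).
assert (Q1' : forall y, B (Q y) = y ⊕ Rs mu (Q y)).
{ intro y. destruct (Q1 y) as [_ H]. change (B (Q y) ⊖ Rs mu (Q y) = y) in H. rewrite <- H at 2. vec. }
assert (Qsym : forall x y, rip (Q x) y = rip x (Q y)).
{ intros x y. replace y with (B (Q y) ⊖ Rs mu (Q y)) at 1 by (rewrite Q1'; vec).
  replace x with (B (Q x) ⊖ Rs mu (Q x)) at 2 by (rewrite Q1'; vec).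
  ripexp. rewrite (selfadjoint_rip B) by (auto; apply Q1). ring. }
(* The vector d = p - Qp / nu is (B - mu - 1/nu) Q p, so Q p is the resolvent at mu + 1/nu applied
   to d. As |1/nu| < mu, that point is inside the gap. *)
assert (Hlow : forall r nu, 0 < r -> Rabs nu = r -> / r < mu ->
  exists C, 0 < C /\ forall p, vnorm p <= C * vnorm (Q p ⊖ Rs nu p)).
{ intros r nu Hr Hnu Hrmu.
  assert (Hnu0 : nu <> 0) by (intro; subst nu; rewrite Rabs_R0 in Hnu; lra).
  assert (Hinv : Rabs (/ nu) = / r) by (rewrite Rabs_inv; congruence).
  destruct (HR (mu + / nu)) as (Q' & Q'bd & _ & Q'2).
  { pose proof (Rle_abs (/ nu)). pose proof (Rle_abs (- / nu)). rewrite Rabs_Ropp in H0. unfold mu in *. lra. }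
  destruct (is_linear_bound Q' Q'bd) as (M & HM & HQ').
  assert (Hr' : 0 < / r) by now apply Rinv_0_lt_compat.
  exists ((1 + / r * M) * / r). split; [apply Rmult_lt_0_compat; nra|]. intro p.
  set (d := p ⊖ Rs (/ nu) (Q p)).
  assert (H1 : vnorm (Q p) <= M * vnorm d).
  { specialize (HQ' (B (Q p) ⊖ Rs (mu + / nu) (Q p))).
    pose proof (Q'2 (Q p) (proj1 (Q1 p))) as H. change (Q' (B (Q p) ⊖ Rs (mu + / nu) (Q p)) = Q p) in H.
    rewrite H in HQ'. replace (B (Q p) ⊖ Rs (mu + / nu) (Q p)) with d in HQ'; [auto|].
    unfold d. rewrite Q1'. vec. }
  assert (H2 : vnorm p <= vnorm d + / r * vnorm (Q p)).
  { replace p with (d ⊕ Rs (/ nu) (Q p)) at 1 by (unfold d; vec).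
    eapply Rle_trans; [apply nrm_triangle|]. rewrite nrm_rscal, Hinv. lra. }
  assert (H3 : vnorm d = / r * vnorm (Q p ⊖ Rs nu p)).
  { rewrite <- Hinv, <- nrm_rscal, <- nrm_opp. f_equal. unfold d. vec.
    rewrite RtoC_inv by auto. field. intro H. apply Hnu0. now apply RtoC_inj. }
  apply (Rmult_le_compat_l (/ r)) in H1; [|lra].
  rewrite <- (Rmult_comm (/ r)), Rmult_assoc, (Rmult_comm (1 + _)), (Rmult_comm (/ r) (_ * _)), Rmult_assoc.
  rewrite (Rmult_comm (1 + _)), <- Rmult_assoc, (Rmult_comm _ (/ r)), <- H3. lra. }
(* The supremum of the quotients ‖Qx‖ / ‖x‖, written without division; 0 is included so that the set
   is nonempty even in the zero space. *)
set (D := fun t => t = 0 \/ exists x, x <> vzero /\ t * vnorm x = vnorm (Q x)).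
destruct (is_linear_bound Q Qbd) as (M & HM & HQM).
assert (npos : forall x, x <> vzero -> 0 < vnorm x).
{ intros x Hx. destruct (norm_pos x); auto. exfalso. apply Hx. now apply norm_eq_0. }
destruct (completeness D) as [r [Hr1 Hr2]].
{ exists M. intros t [->|(x & Hx & Ht)]; [lra|]. pose proof (HQM x). pose proof (npos x Hx). nra. }
{ exists 0. now left. }
assert (Hr0 : 0 <= r) by (apply Hr1; now left).
assert (HQr : forall x, vnorm (Q x) <= r * vnorm x).
{ intro x. destruct (classic (x = vzero)) as [->|Hx].
  - rewrite linmap_zero, nrm_zero by auto. lra.
  - pose proof (npos x Hx) as Hp.
    assert (H : vnorm (Q x) / vnorm x <= r).
    { apply Hr1. right. exists x. split; auto. field. lra. }
    apply (Rmult_le_compat_r (vnorm x)) in H; [|lra].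
    replace (vnorm (Q x) / vnorm x * vnorm x) with (vnorm (Q x)) in H by (field; lra). lra. }
assert (Hrmu : r <= / mu).
{ apply Rnot_lt_le. intro Hlt.
  assert (Hmu : 0 < mu) by (unfold mu; lra). assert (0 < / mu) by now apply Rinv_0_lt_compat.
  assert (Hrp : 0 < r) by lra.
  assert (Hinv : / r < mu).
  { rewrite <- (Rinv_inv mu). apply Rinv_lt_contravar; [nra|auto]. }
  destruct (Hlow r r) as (C1 & HC1 & HL1); auto; [apply Rabs_right; lra|].
  destruct (Hlow r (- r)) as (C2 & HC2 & HL2); auto; [rewrite Rabs_Ropp; apply Rabs_right; lra|].
  set (C := C2 * C1). assert (HC : 0 < C) by (unfold C; nra).
  assert (HL : forall x, vnorm x <= C * vnorm (Q (Q x) ⊖ Rs (r * r) x)).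
  { intro x. pose proof (HL2 x) as A1. pose proof (HL1 (Q x ⊖ Rs (- r) x)) as A2.
    replace (Q (Q x ⊖ Rs (- r) x) ⊖ Rs r (Q x ⊖ Rs (- r) x)) with (Q (Q x) ⊖ Rs (r * r) x) in A2.
    - apply (Rmult_le_compat_l C2) in A2; [|lra]. unfold C. lra.
    - rewrite linmap_minus by auto. destruct Qlin as [_ HQs]. rewrite HQs. vec. }
  (* The left side is ‖Q²x‖² - 2r²‖Qx‖² + r⁴‖x‖², and ‖Q²x‖ <= r‖Qx‖. Together with [HL] this yields
     ‖Qx‖² <= (r² - k)‖x‖² with k > 0, against the choice of [r] as supremum. *)
  assert (Hsq : forall x, vnorm (Q (Q x) ⊖ Rs (r * r) x) * vnorm (Q (Q x) ⊖ Rs (r * r) x) <=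
     r * r * (r * r * (vnorm x * vnorm x) - vnorm (Q x) * vnorm (Q x))).
  { intro x. rewrite <- !rip_self. ripexp. rewrite (rip_sym x (Q (Q x))), (Qsym (Q x) x), !rip_self.
    pose proof (HQr (Q x)) as A. pose proof (norm_pos (Q (Q x))). pose proof (norm_pos (Q x)).
    assert (vnorm (Q (Q x)) * vnorm (Q (Q x)) <= (r * vnorm (Q x)) * (r * vnorm (Q x))) by (apply Rmult_le_compat; lra).
    nra. }
  set (k := / (C * C * (r * r))).
  assert (HCr : 0 < C * C * (r * r)) by (apply Rmult_lt_0_compat; nra).
  assert (Hk : 0 < k) by now apply Rinv_0_lt_compat.
  assert (Hfin : forall x, vnorm (Q x) * vnorm (Q x) <= (r * r - k) * (vnorm x * vnorm x)).
  { intro x. specialize (HL x). specialize (Hsq x). set (q := vnorm (Q (Q x) ⊖ Rs (r * r) x)) in *.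
    pose proof (norm_pos x) as Px.
    assert (A : vnorm x * vnorm x <= (C * C) * (q * q)).
    { replace ((C * C) * (q * q)) with ((C * q) * (C * q)) by ring. apply Rmult_le_compat; lra. }
    assert (A2 : vnorm x * vnorm x <= C * C * (r * r) * (r * r * (vnorm x * vnorm x) - vnorm (Q x) * vnorm (Q x))).
    { eapply Rle_trans; [apply A|]. rewrite (Rmult_assoc (C * C)). apply Rmult_le_compat_l; nra. }
    apply (Rmult_le_compat_l k) in A2; [|lra].
    rewrite <- (Rmult_assoc k (C * C * (r * r))) in A2. replace (k * (C * C * (r * r))) with 1 in A2 by (unfold k; field; split; lra).
    lra. }
  set (b := sqrt (Rmax (r * r - k) 0)).
  assert (Hb : b * b = Rmax (r * r - k) 0) by (apply sqrt_sqrt, Rmax_r).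
  assert (Hb0 : 0 <= b) by apply sqrt_pos.
  assert (Hrb : r <= b).
  { apply Hr2. intros t [->|(x & Hx & Ht)]; [auto|].
    pose proof (npos x Hx) as Hp. specialize (Hfin x). rewrite <- Ht in Hfin.
    pose proof (Rmax_l (r * r - k) 0). apply sq_le; auto. rewrite Hb.
    apply Rle_trans with (r * r - k); auto.
    apply (Rmult_le_reg_r (vnorm x * vnorm x)); nra. }
  assert (r * r <= b * b) by (apply Rmult_le_compat; lra).
  rewrite Hb in H0. unfold Rmax in H0. destruct (Rle_dec (r * r - k) 0); nra. }
intros x Hx.
assert (Hmu : 0 < mu) by (unfold mu; lra).
pose proof (HQr (B x ⊖ Rs mu x)) as H.
pose proof (Q2 x Hx) as H2. change (Q (B x ⊖ Rs mu x) = x) in H2. rewrite H2 in H.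
pose proof (norm_pos (B x ⊖ Rs mu x)) as Hp. pose proof (norm_pos x) as Hpx.
assert (H3 : mu * vnorm x <= vnorm (B x ⊖ Rs mu x)).
{ apply (Rmult_le_compat_r (vnorm (B x ⊖ Rs mu x))) in Hrmu; auto.
  apply Rle_trans with (mu * (/ mu * vnorm (B x ⊖ Rs mu x))).
  - apply Rmult_le_compat_l; lra.
  - right. field. lra. }
assert (H4 : (mu * vnorm x) * (mu * vnorm x) <= vnorm (B x ⊖ Rs mu x) * vnorm (B x ⊖ Rs mu x)).
{ apply Rmult_le_compat; auto; nra. }
rewrite <- (rip_self (B x ⊖ Rs mu x)) in H4. ripexp_in H4.
rewrite (rip_sym x (B x)), !rip_self in H4. unfold mu in *. nra.
Qed.

Definition adherent (S : E -> Prop) (f : E) := forall e, 0 < e -> exists g, S g /\ vnorm (f ⊖ g) < e.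

Lemma adherent_subset (S : E -> Prop) f : S f -> adherent S f.
Proof.
intros Hf e He. exists f. split; auto. replace (f ⊖ f) with (vzero : E) by vec. now rewrite nrm_zero.
Qed.

Lemma adherent_subspace S : subspace S -> subspace (adherent S).
Proof.
intros HS. split; [|split].
- apply adherent_subset, HS.
- intros x y Hx Hy e He. destruct (Hx (e / 2)) as (g & Hg & Hgd); [lra|].
  destruct (Hy (e / 2)) as (h & Hh & Hhd); [lra|].
  exists (g ⊕ h). split; [now apply HS|].
  replace (x ⊕ y ⊖ (g ⊕ h)) with ((x ⊖ g) ⊕ (y ⊖ h)) by vec.
  eapply Rle_lt_trans; [apply nrm_triangle|lra].
- intros a x Hx e He. pose proof (Cmod_ge_0 a).
  destruct (Hx (e / (Cmod a + 1))) as (g & Hg & Hgd); [apply Rdiv_lt_0_compat; lra|].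
  exists (a • g). split; [now apply HS|].
  replace (a • x ⊖ a • g) with (a • (x ⊖ g)) by vec. rewrite nrm_scal.
  pose proof (norm_pos (x ⊖ g)). apply (Rmult_lt_compat_l (Cmod a + 1)) in Hgd; [|lra].
  replace ((Cmod a + 1) * (e / (Cmod a + 1))) with e in Hgd by (field; lra). nra.
Qed.

Lemma adherent_closed S : seq_closed (adherent S).
Proof.
intros u l Hu Hl e He. destruct (Hl (e / 2)) as [N HN]; [lra|].
destruct (Hu N (e / 2)) as (g & Hg & Hgd); [lra|]. exists g. split; auto.
specialize (HN N (le_n _)). pose proof (dist_triangle (u N) l g). rewrite (minus_sym l (u N)) in H. lra.
Qed.

Lemma adherent_Ran T f : selfadjoint T -> orth (Ker T) f -> adherent (Ran T) f.
Proof.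
intros HT Hf. pose proof (Ran_subspace T (selfadjoint_linear T HT)) as HS.
apply biorth; auto using adherent_subspace, adherent_closed.
intros y Hy. apply Hf. apply orth_Ran_Ker; auto. intros s Hs. apply Hy. now apply adherent_subset.
Qed.

(** A lower bound on [Ran L] passes to [(Ker L)^⊥], the closure of [Ran L]:
    for [f] in [Ran L] the solution of [L x + i e x = f] lies in [Ran L]. *)
Lemma lower_bound_coker L (c : R) : selfadjoint L -> 0 < c ->
  (forall x, dom L x -> dom L (L x) -> c * vnorm (L x) <= vnorm (L (L x))) ->
  forall x, dom L x -> orth (Ker L) x -> c * vnorm x <= vnorm (L x).
Proof.
intros HL Hc HG. pose proof (selfadjoint_linear L HL) as Hlin.
assert (C1 : forall e x, 0 < e -> dom L x -> Ran L (L x ⊕ Rs e (Ci • x)) ->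
   c * vnorm x <= vnorm (L x ⊕ Rs e (Ci • x))).
{ intros e x He Hx HR.
  assert (HRx : Ran L x).
  { replace x with (Cmult (RtoC (- / e)) Ci • ((L x ⊕ Rs e (Ci • x)) ⊖ L x)).
    - apply Ran_subspace; auto. apply subspace_minus; auto using Ran_subspace. now exists x.
    - replace (Cmult (RtoC (- / e)) Ci • ((L x ⊕ Rs e (Ci • x)) ⊖ L x)) with (Rs (/ e * e) (Copp Ci • (Ci • x))) by vec.
      rewrite oppCi_Ci, Rinv_l by lra. vec. }
  destruct HRx as (p & Hp & Hpx). subst x.
  eapply Rle_trans; [now apply HG|]. apply nrm_le. rewrite shift_norm by auto.
  pose proof (norm_pos (L p)). nra. }
assert (C2 : forall e x, 0 < e -> dom L x -> orth (Ker L) (L x ⊕ Rs e (Ci • x)) ->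
   c * vnorm x <= vnorm (L x ⊕ Rs e (Ci • x))).
{ intros e x He Hx Ho. set (f := L x ⊕ Rs e (Ci • x)) in *.
  apply le_epsilon. intros eta Heta.
  (* Replacing [f] by [g] costs ‖f - g‖ on the right and c‖x - x'‖ <= (c/e)‖f - g‖ on the left; [k]
     adds up the two factors. *)
  set (k := 1 + c / e). assert (Hk : 0 < k) by (unfold k; assert (0 < c / e) by (now apply Rdiv_lt_0_compat); lra).
  destruct (adherent_Ran L f HL Ho (eta / k)) as (g & Hg & Hgd); [now apply Rdiv_lt_0_compat|].
  destruct (shift_surjective L e HL ltac:(lra) g) as (x' & Hx' & Hg'). subst g.
  pose proof (C1 e x' He Hx' Hg) as H1. set (g := L x' ⊕ Rs e (Ci • x')) in *.
  destruct (lin_minus L x x' Hlin Hx Hx') as [H2 H3].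
  pose proof (shift_norm L e _ HL H2) as H4.
  replace (L (x ⊖ x') ⊕ Rs e (Ci • (x ⊖ x'))) with (f ⊖ g) in H4 by (rewrite H3; unfold f, g; vec).
  assert (H5 : e * vnorm (x ⊖ x') <= vnorm (f ⊖ g)).
  { apply sq_le; [apply norm_pos|]. rewrite H4. pose proof (norm_pos (L (x ⊖ x'))). nra. }
  pose proof (nrm_le_dist x x') as H6. pose proof (nrm_le_dist g f) as H7. rewrite minus_sym in H7.
  assert (H8 : c * vnorm (x ⊖ x') <= c / e * vnorm (f ⊖ g)).
  { apply (Rmult_le_compat_l (c / e)) in H5; [|assert (0 < c / e) by (now apply Rdiv_lt_0_compat); lra].
    replace (c / e * (e * vnorm (x ⊖ x'))) with (c * vnorm (x ⊖ x')) in H5 by (field; lra). auto. }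
  apply (Rmult_lt_compat_l k) in Hgd; auto. replace (k * (eta / k)) with eta in Hgd by (field; lra).
  apply (Rmult_le_compat_l c) in H6; [|lra]. unfold k in Hgd. lra. }
intros x Hx Ho. apply le_epsilon. intros eta Heta.
set (e := eta / (vnorm x + 1)). pose proof (norm_pos x).
assert (He : 0 < e) by (apply Rdiv_lt_0_compat; lra).
eapply Rle_trans; [apply (C2 e x He Hx)|].
- intros s Hs. rewrite inner_plus_l, !inner_scal_l, (Ho s Hs).
  destruct Hs as [Hs1 Hs2]. rewrite (selfadjoint_sym L), Hs2, inner_zero_r by auto. ring.
- eapply Rle_trans; [apply nrm_triangle|]. apply Rplus_le_compat_l.
  rewrite nrm_rscal, nrm_Ci, Rabs_right by lra.
  assert (e * (vnorm x + 1) = eta) by (unfold e; field; lra). nra.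
Qed.

Lemma coker_split L x : selfadjoint L -> exists k, Ker L k /\ orth (Ker L) (x ⊖ k).
Proof. intro HL. apply projection_exists; auto using Ker_closed. now apply Ker_subspace, selfadjoint_linear. Qed.

Lemma Ran_reduced L y : selfadjoint L -> Ran L y -> exists x, dom L x /\ orth (Ker L) x /\ L x = y.
Proof.
intros HL (x & Hx & <-). destruct (coker_split L x HL) as (k & [Hk1 Hk2] & Ho).
destruct (lin_minus L x k (selfadjoint_linear L HL) Hx Hk1) as [H1 H2].
exists (x ⊖ k). split; [|split]; auto. rewrite H2, Hk2. vec.
Qed.

(** Preimages can be taken orthogonal to the kernel, where the bound makes them converge along with
    their images. So the range is closed, and it equals its double orthogonal complement. *)
Lemma Ran_iff_orth_Ker L (c : R) y : selfadjoint L -> 0 < c ->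
  (forall x, dom L x -> orth (Ker L) x -> c * vnorm x <= vnorm (L x)) ->
  Ran L y <-> orth (Ker L) y.
Proof.
intros HL Hc HB. pose proof (selfadjoint_linear L HL) as Hlin. split.
{ intros Hy s Hs. apply inner_0_sym. now apply (Ker_orth_Ran L). }
intro Hy. apply biorth; [now apply Ran_subspace| |].
- intros u l Hu Hl.
  destruct (choice _ (fun n => Ran_reduced L (u n) HL (Hu n))) as [x Hx].
  destruct (cauchy_cv x) as [p Hp].
  { intros eps He. destruct (Hl (c * eps / 2)) as [N HN]; [nra|].
    exists N. intros n m Hn Hm. pose proof (HN n Hn) as A1. pose proof (HN m Hm) as A2.
    destruct (Hx n) as (B1 & B2 & B3). destruct (Hx m) as (D1 & D2 & D3).
    destruct (lin_minus L _ _ Hlin B1 D1) as [F1 F2].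
    pose proof (HB _ F1 (subspace_minus _ _ _ (orth_subspace _) B2 D2)) as F3.
    rewrite F2, B3, D3 in F3.
    pose proof (dist_triangle l (u n) (u m)). rewrite (minus_sym l) in H. nra. }
  destruct (selfadjoint_closed L x p l HL) as [H1 H2]; auto.
  + intro n. apply Hx.
  + apply (cv_ext u); auto. intro n. symmetry. apply Hx.
  + now exists p.
- intros z Hz. apply Hy. now apply orth_Ran_Ker.
Qed.

End Gap.

(** * Differentiation and energy estimates *)

Section Calculus.
Context {E : HilbertSpace}.
Implicit Types x y z : E.
Implicit Types f g : R -> E.

Definition der f (t : R) (l : E) := forall eps, 0 < eps -> exists d, 0 < d /\
  forall s, Rabs (s - t) < d -> vnorm (f s ⊖ f t ⊖ Rs (s - t) l) <= eps * Rabs (s - t).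

Definition cont f (t : R) := forall eps, 0 < eps -> exists d, 0 < d /\
  forall s, Rabs (s - t) < d -> vnorm (f s ⊖ f t) < eps.

Lemma der_is_derive f t l : is_derive (V := realify E) f t l <-> der f t l.
Proof.
split.
- intros [_ H] eps He. specialize (H t (fun P HP => HP) (mkposreal eps He)).
  destruct H as [d Hd]. exists d. split; [apply cond_pos|]. intros s Hs. exact (Hd s Hs).
- intro H. split; [apply (is_linear_scal_l (V := realify E))|].
  intros s Hs eps.
  assert (s = t) by (symmetry; apply (is_filter_lim_locally_unique (V := R_NormedModule)); exact Hs). subst s.
  destruct (H eps (cond_pos eps)) as (d & Hd & Hd'). exists (mkposreal d Hd).
  intros s Hs'. exact (Hd' s Hs').
Qed.

Lemma continuous_cont f t : continuous (U := E) f t <-> cont f t.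
Proof.
unfold continuous. rewrite (filterlim_locally_ball_norm (U := E)). split.
- intros H eps He. destruct (H (mkposreal eps He)) as [d Hd]. exists d. split; [apply cond_pos|].
  intros s Hs. exact (Hd s Hs).
- intros H eps. destruct (H eps (cond_pos eps)) as (d & Hd & Hd'). exists (mkposreal d Hd).
  intros s Hs. exact (Hd' s Hs).
Qed.

Lemma der_cont f t l : der f t l -> cont f t.
Proof.
intros H eps He. destruct (H 1) as (d & Hd & Hd'); [lra|].
pose proof (norm_pos l). set (k := 1 + vnorm l).
assert (Hek : 0 < eps / k) by (apply Rdiv_lt_0_compat; unfold k; lra).
exists (Rmin d (eps / k)). split; [now apply Rmin_pos|]. intros s Hs.
pose proof (Hd' s ltac:(eapply Rlt_le_trans; [apply Hs|apply Rmin_l])) as H1.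
assert (H2 : Rabs (s - t) < eps / k) by (eapply Rlt_le_trans; [apply Hs|apply Rmin_r]).
replace (f s ⊖ f t) with ((f s ⊖ f t ⊖ Rs (s - t) l) ⊕ Rs (s - t) l) by vec.
eapply Rle_lt_trans; [apply nrm_triangle|]. rewrite nrm_rscal.
apply (Rmult_lt_compat_l k) in H2; [|unfold k; lra].
replace (k * (eps / k)) with eps in H2 by (field; unfold k; lra). unfold k in H2. lra.
Qed.

Lemma der_ext f g t l : (forall s, f s = g s) -> der f t l -> der g t l.
Proof. intros H Hf. intros eps He. destruct (Hf eps He) as (d & Hd & H'). exists d. split; auto. intros. rewrite <- !H. auto. Qed.

Lemma der_const x t : der (fun _ => x) t vzero.
Proof.
intros eps He. exists 1. split; [lra|]. intros s _.
replace (x ⊖ x ⊖ Rs (s - t) vzero) with (vzero : E) by vec. rewrite nrm_zero.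
pose proof (Rabs_pos (s - t)). nra.
Qed.

Lemma der_plus f g t l m : der f t l -> der g t m -> der (fun s => f s ⊕ g s) t (l ⊕ m).
Proof.
intros Hf Hg eps He. destruct (Hf (eps / 2)) as (d1 & Hd1 & H1); [lra|].
destruct (Hg (eps / 2)) as (d2 & Hd2 & H2); [lra|].
exists (Rmin d1 d2). split; [now apply Rmin_pos|]. intros s Hs.
pose proof (H1 s ltac:(eapply Rlt_le_trans; [apply Hs|apply Rmin_l])).
pose proof (H2 s ltac:(eapply Rlt_le_trans; [apply Hs|apply Rmin_r])).
replace (f s ⊕ g s ⊖ (f t ⊕ g t) ⊖ Rs (s - t) (l ⊕ m)) with
  ((f s ⊖ f t ⊖ Rs (s - t) l) ⊕ (g s ⊖ g t ⊖ Rs (s - t) m)) by vec.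
eapply Rle_trans; [apply nrm_triangle|lra].
Qed.

(** Linearity and boundedness are asked for on [S] alone because a unitary group on a subspace has
    unspecified values outside it. *)
Lemma der_bounded (A : E -> E) (S : E -> Prop) (M : R) f t l : subspace S ->
  (forall x y, S x -> S y -> A (x ⊕ y) = A x ⊕ A y) ->
  (forall (a : C) x, S x -> A (a • x) = a • A x) ->
  (forall x, S x -> vnorm (A x) <= M * vnorm x) ->
  (forall s, S (f s)) -> S l -> der f t l -> der (fun s => A (f s)) t (A l).
Proof.
intros HS H1 H2 HM Hf Hl H eps He.
set (k := Rabs M + 1). pose proof (Rabs_pos M). pose proof (Rle_abs M).
destruct (H (eps / k)) as (d & Hd & H'); [apply Rdiv_lt_0_compat; unfold k; lra|].
exists d. split; auto. intros s Hs. specialize (H' s Hs).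
assert (Hm : forall x y, S x -> S y -> A (x ⊖ y) = A x ⊖ A y).
{ intros x y Hx Hy. replace (x ⊖ y) with (x ⊕ Rs (-1) y) by vec.
  rewrite H1, H2; auto; [vec|]. now apply HS. }
assert (S (Rs (s - t) l)) by now apply HS.
assert (S (f s ⊖ f t)) by now apply subspace_minus.
rewrite <- Hm, <- H2, <- Hm by auto.
eapply Rle_trans; [apply HM; now apply subspace_minus|].
set (q := vnorm (f s ⊖ f t ⊖ Rs (s - t) l)) in *. assert (0 <= q) by apply norm_pos.
apply (Rmult_le_compat_l k) in H'; [|unfold k; lra].
replace (k * (eps / k * Rabs (s - t))) with (eps * Rabs (s - t)) in H' by (field; unfold k; lra).
unfold k in H'. nra.
Qed.

Lemma full_subspace : subspace (fun _ : E => True).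
Proof. repeat split. Qed.

Lemma der_linear (A : E -> E) f t l : is_linear A -> der f t l -> der (fun s => A (f s)) t (A l).
Proof.
intros HA. destruct (is_linear_bound A HA) as (M & _ & HM). destruct (is_linear_linmap A HA) as [H1 H2].
apply (der_bounded A (fun _ => True) M); auto. apply full_subspace.
Qed.

Lemma is_linear_scal_C (a : C) : is_linear (fun x : E => a • x).
Proof.
apply (linmap_is_linear _ (Cmod a)).
- split; intros; vec.
- intro x. rewrite nrm_scal. lra.
Qed.

Lemma der_scal (a : C) f t l : der f t l -> der (fun s => a • f s) t (a • l).
Proof. apply (der_linear (fun x => a • x)), is_linear_scal_C. Qed.

Lemma der_minus f g t l m : der f t l -> der g t m -> der (fun s => f s ⊖ g s) t (l ⊖ m).
Proof.
intros Hf Hg. replace (l ⊖ m) with (l ⊕ Rs (-1) m) by vec.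
apply (der_ext (fun s => f s ⊕ Rs (-1) (g s))); [intro; vec|]. apply der_plus; auto. now apply der_scal.
Qed.

Lemma der_rfun (phi : R -> R) (t l : R) x : derivable_pt_lim phi t l -> der (fun s => Rs (phi s) x) t (Rs l x).
Proof.
intros H eps He. pose proof (norm_pos x).
destruct (H (eps / (vnorm x + 1))) as [d Hd]; [apply Rdiv_lt_0_compat; lra|].
exists d. split; [apply cond_pos|]. intros s Hs.
replace (Rs (phi s) x ⊖ Rs (phi t) x ⊖ Rs (s - t) (Rs l x)) with (Rs (phi s - phi t - (s - t) * l) x) by vec.
rewrite nrm_rscal. destruct (Req_dec s t) as [->|Hne].
- replace (phi t - phi t - (t - t) * l) with 0 by ring. replace (t - t) with 0 by ring. rewrite Rabs_R0. lra.
- specialize (Hd (s - t)). replace (t + (s - t)) with s in Hd by ring.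
  specialize (Hd ltac:(lra) Hs).
  replace (phi s - phi t - (s - t) * l) with (((phi s - phi t) / (s - t) - l) * (s - t)) by (field; lra).
  rewrite Rabs_mult. pose proof (Rabs_pos (s - t)).
  apply (Rmult_lt_compat_l (vnorm x + 1)) in Hd; [|lra].
  replace ((vnorm x + 1) * (eps / (vnorm x + 1))) with eps in Hd by (field; lra).
  set (q := Rabs ((phi s - phi t) / (s - t) - l)) in *. assert (0 <= q) by apply Rabs_pos.
  assert (q * vnorm x <= eps) by nra.
  replace (q * Rabs (s - t) * vnorm x) with ((q * vnorm x) * Rabs (s - t)) by ring.
  now apply Rmult_le_compat_r.
Qed.

Lemma der_shift f (t a : R) l : der f (t + a) l -> der (fun s => f (s + a)) t l.
Proof.
intros H eps He. destruct (H eps He) as (d & Hd & H'). exists d. split; auto. intros s Hs.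
specialize (H' (s + a)). replace (s + a - (t + a)) with (s - t) in H' by ring. auto.
Qed.

Lemma der_unique f t l m : der f t l -> der f t m -> l = m.
Proof.
intros Hl Hm. apply dist_small_eq. intros eps He.
destruct (Hl (eps / 2)) as (d1 & Hd1 & H1); [lra|]. destruct (Hm (eps / 2)) as (d2 & Hd2 & H2); [lra|].
set (h := Rmin d1 d2 / 2). assert (0 < Rmin d1 d2) by now apply Rmin_pos.
assert (Hh : 0 < h) by (unfold h; lra).
pose proof (Rmin_l d1 d2). pose proof (Rmin_r d1 d2).
specialize (H1 (t + h)). specialize (H2 (t + h)).
replace (t + h - t) with h in * by ring. rewrite Rabs_right in * by lra.
specialize (H1 ltac:(unfold h; lra)). specialize (H2 ltac:(unfold h; lra)).
apply (Rmult_le_reg_l h); auto.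
replace (h * vnorm (l ⊖ m)) with (vnorm (Rs h (l ⊖ m))) by (rewrite nrm_rscal, Rabs_right by lra; auto).
replace (Rs h (l ⊖ m)) with ((f (t + h) ⊖ f t ⊖ Rs h m) ⊖ (f (t + h) ⊖ f t ⊖ Rs h l)) by vec.
eapply Rle_trans; [apply nrm_triangle_m|lra].
Qed.

Lemma der_rip f t l y : der f t l -> derivable_pt_lim (fun s => rip (f s) y) t (rip l y).
Proof.
intros H eps He. pose proof (norm_pos y).
destruct (H (eps / (vnorm y + 1))) as (d & Hd & H'); [apply Rdiv_lt_0_compat; lra|].
exists (mkposreal d Hd). intros h Hh Hhd. simpl in Hhd.
specialize (H' (t + h)). replace (t + h - t) with h in H' by ring. specialize (H' Hhd).
replace ((rip (f (t + h)) y - rip (f t) y) / h - rip l y) with (/ h * rip (f (t + h) ⊖ f t ⊖ Rs h l) y).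
2: { ripexp. field. auto. }
rewrite Rabs_mult, Rabs_inv.
pose proof (cauchy_schwarz (f (t + h) ⊖ f t ⊖ Rs h l) y) as H1.
set (q := vnorm (f (t + h) ⊖ f t ⊖ Rs h l)) in *.
assert (Hp : 0 < Rabs h) by now apply Rabs_pos_lt.
apply (Rmult_lt_reg_l (Rabs h)); auto. rewrite <- Rmult_assoc, Rinv_r, Rmult_1_l by lra.
eapply Rle_lt_trans; [apply H1|].
assert (Hq : 0 <= q) by apply norm_pos.
assert (Hy : 0 < vnorm y + 1) by lra.
apply Rle_lt_trans with (eps / (vnorm y + 1) * Rabs h * vnorm y); [now apply Rmult_le_compat_r|].
replace (Rabs h * eps) with (eps / (vnorm y + 1) * Rabs h * (vnorm y + 1)) by (field; lra).
apply Rmult_lt_compat_l; [|lra]. apply Rmult_lt_0_compat; auto. now apply Rdiv_lt_0_compat.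
Qed.

Lemma der_sq f t l : der f t l -> derivable_pt_lim (fun s => vnorm (f s) * vnorm (f s)) t (2 * rip l (f t)).
Proof.
intros H.
(* In ‖f s‖² = 2<f s, f t> + ‖f s - f t‖² - ‖f t‖² the middle term is quadratic in the increment, so
   only the pairing contributes to the derivative. *)
assert (Hq : derivable_pt_lim (fun s => vnorm (f s ⊖ f t) * vnorm (f s ⊖ f t)) t 0).
{ intros eps He. destruct (H 1) as (d & Hd & H'); [lra|].
  set (k := vnorm l + 1). pose proof (norm_pos l).
  assert (Hk : 0 < k * k) by (unfold k; nra).
  assert (Hm : 0 < Rmin d (eps / (k * k))) by (apply Rmin_pos; auto; now apply Rdiv_lt_0_compat).
  exists (mkposreal _ Hm). intros h Hh Hhd. simpl in Hhd.
  specialize (H' (t + h)). replace (t + h - t) with h in H' by ring.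
  specialize (H' ltac:(eapply Rlt_le_trans; [apply Hhd|apply Rmin_l])).
  assert (H2 : Rabs h < eps / (k * k)) by (eapply Rlt_le_trans; [apply Hhd|apply Rmin_r]).
  replace (f t ⊖ f t) with (vzero : E) by vec. rewrite nrm_zero.
  set (q := vnorm (f (t + h) ⊖ f t)).
  assert (Hqk : q <= k * Rabs h).
  { unfold q. replace (f (t + h) ⊖ f t) with ((f (t + h) ⊖ f t ⊖ Rs h l) ⊕ Rs h l) by vec.
    eapply Rle_trans; [apply nrm_triangle|]. rewrite nrm_rscal. unfold k. lra. }
  assert (Hq0 : 0 <= q) by apply norm_pos. assert (Hp : 0 < Rabs h) by now apply Rabs_pos_lt.
  replace ((q * q - 0 * 0) / h - 0) with (q * q / h) by (field; auto).
  unfold Rdiv. rewrite Rabs_mult, Rabs_inv, (Rabs_right (q * q)) by nra.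
  apply (Rmult_lt_reg_r (Rabs h)); auto. rewrite Rmult_assoc, Rinv_l, Rmult_1_r by lra.
  apply Rle_lt_trans with ((k * Rabs h) * (k * Rabs h)); [apply Rmult_le_compat; auto|].
  apply (Rmult_lt_compat_l (k * k)) in H2; auto. replace (k * k * (eps / (k * k))) with eps in H2 by (field; intro; subst; nra).
  nra. }
pose proof (der_rip f t l (f t) H) as Hr.
pose proof (derivable_pt_lim_plus _ _ t _ _ (derivable_pt_lim_scal _ 2 t _ Hr) Hq) as HH.
rewrite Rplus_0_r in HH.
assert (Hext : forall s, vnorm (f s) * vnorm (f s) =
  (2 * rip (f s) (f t) + vnorm (f s ⊖ f t) * vnorm (f s ⊖ f t)) - vnorm (f t) * vnorm (f t)).
{ intro s. rewrite <- !rip_self. ripexp. rewrite (rip_sym (f t) (f s)). ring. }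
intros eps He. destruct (HH eps He) as [d Hd]. exists d. intros h Hh Hhd. specialize (Hd h Hh Hhd).
unfold plus_fct, mult_real_fct in Hd. cbv beta in Hd |- *. rewrite (Hext (t + h)).
replace (f t ⊖ f t) with (vzero : E) in Hd by vec. rewrite rip_self, nrm_zero in Hd.
match goal with |- Rabs ?a < _ => match type of Hd with Rabs ?b < _ => replace a with b; [auto|] end end.
f_equal. f_equal. ring.
Qed.

Lemma real_mvt (phi dphi : R -> R) (a b M : R) :
  (forall s, derivable_pt_lim phi s (dphi s)) ->
  (forall s, Rmin a b <= s <= Rmax a b -> Rabs (dphi s) <= M) ->
  Rabs (phi b - phi a) <= M * Rabs (b - a).
Proof.
intros H HM.
assert (Hlt : forall p q, p < q -> (forall s, p <= s <= q -> Rabs (dphi s) <= M) -> Rabs (phi q - phi p) <= M * (q - p)).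
{ intros p q Hpq Hb. destruct (MVT_cor2 phi dphi p q Hpq) as (c & Hc & Hc'); auto.
  rewrite Hc, Rabs_mult, (Rabs_right (q - p)) by lra.
  apply Rmult_le_compat_r; [lra|]. apply Hb. lra. }
destruct (Rtotal_order a b) as [Hab|[->|Hab]].
- rewrite (Rabs_right (b - a)) by lra. apply Hlt; auto. intros s Hs. apply HM.
  rewrite Rmin_left, Rmax_right; lra.
- rewrite !Rminus_diag, Rabs_R0. lra.
- rewrite (Rabs_minus_sym b a), Rabs_minus_sym, (Rabs_right (a - b)) by lra. apply Hlt; auto. intros s Hs. apply HM.
  rewrite Rmin_right, Rmax_left; lra.
Qed.

(** Pairing with v = f b - f a reduces this to a real function, whose increment is ‖v‖²; one factor
    ‖v‖ is then cancelled. *)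
Lemma mean_value_le f g (a b M : R) : (forall s, der f s (g s)) ->
  (forall s, Rmin a b <= s <= Rmax a b -> vnorm (g s) <= M) ->
  vnorm (f b ⊖ f a) <= M * Rabs (b - a).
Proof.
intros H HM. set (v := f b ⊖ f a).
pose proof (real_mvt (fun s => rip (f s) v) (fun s => rip (g s) v) a b (M * vnorm v)) as H1.
specialize (H1 (fun s => der_rip f s _ v (H s))). pose proof (norm_pos v) as Hv.
assert (H2 : Rabs (rip (f b) v - rip (f a) v) <= M * vnorm v * Rabs (b - a)).
{ apply H1. intros s Hs. eapply Rle_trans; [apply cauchy_schwarz|]. apply Rmult_le_compat_r; auto. }
rewrite <- rip_minus_l in H2. fold v in H2. rewrite rip_self, Rabs_right in H2 by nra.
destruct Hv as [Hv|Hv]; [nra|]. rewrite <- Hv.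
assert (0 <= M).
{ apply Rle_trans with (vnorm (g a)); [apply norm_pos|apply HM]. split; [apply Rmin_l|apply Rmax_l]. }
apply Rmult_le_pos; auto. apply Rabs_pos.
Qed.

Lemma energy_const f g : (forall t, der f t (g t)) -> (forall t, rip (g t) (f t) = 0) ->
  forall t, vnorm (f t) = vnorm (f 0).
Proof.
intros H H0 t.
pose proof (real_mvt (fun s => vnorm (f s) * vnorm (f s)) (fun s => 2 * rip (g s) (f s)) 0 t 0
  (fun s => der_sq f s _ (H s))) as H1.
assert (Rabs (vnorm (f t) * vnorm (f t) - vnorm (f 0) * vnorm (f 0)) <= 0 * Rabs (t - 0)).
{ apply H1. intros s _. rewrite H0, Rmult_0_r, Rabs_R0. lra. }
rewrite Rmult_0_l in H2. pose proof (Rabs_pos (vnorm (f t) * vnorm (f t) - vnorm (f 0) * vnorm (f 0))).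
assert (Heq : vnorm (f t) * vnorm (f t) = vnorm (f 0) * vnorm (f 0)).
{ apply Rminus_diag_uniq. apply Rabs_eq_0. lra. }
apply Rle_antisym; apply nrm_le; lra.
Qed.

Lemma energy_growth f g (K : R) : (forall t, der f t (g t)) -> (forall t, Rabs (rip (g t) (f t)) <= K) ->
  f 0 = vzero -> forall t, vnorm (f t) * vnorm (f t) <= 2 * K * Rabs t.
Proof.
intros H HK H0 t.
pose proof (real_mvt (fun s => vnorm (f s) * vnorm (f s)) (fun s => 2 * rip (g s) (f s)) 0 t (2 * K)
  (fun s => der_sq f s _ (H s))) as H1.
simpl in H1. rewrite H0, nrm_zero in H1. rewrite !Rminus_0_r, Rmult_0_l, Rminus_0_r in H1.
eapply Rle_trans; [apply Rle_abs|]. apply H1. intros s _.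
rewrite Rabs_mult, (Rabs_right 2) by lra. specialize (HK s). lra.
Qed.

Lemma skew_isometric (A : operator E) f : (forall x, dom A x -> rip (A x) x = 0) ->
  (forall t, dom A (f t) /\ der f t (A (f t))) -> forall t, vnorm (f t) = vnorm (f 0).
Proof. intros HA Hf. apply (energy_const f (fun t => A (f t))); [apply Hf|]. intro t. apply HA, Hf. Qed.

(** The difference of two solutions is a solution, so its norm is conserved. *)
Lemma skew_unique (A : operator E) f g : linear_operator A -> (forall x, dom A x -> rip (A x) x = 0) ->
  (forall t, dom A (f t) /\ der f t (A (f t))) ->
  (forall t, dom A (g t) /\ der g t (A (g t))) -> f 0 = g 0 -> forall t, f t = g t.
Proof.
intros HL HA Hf Hg H0 t. apply nrm_dist_0.
rewrite (skew_isometric A (fun t => f t ⊖ g t) HA).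
- rewrite H0. replace (g 0 ⊖ g 0) with (vzero : E) by vec. apply nrm_zero.
- intro s. destruct (Hf s) as [F1 F2]. destruct (Hg s) as [G1 G2].
  destruct (lin_minus A _ _ HL F1 G1) as [D1 D2]. split; auto. rewrite D2. now apply der_minus.
Qed.

(** Joint convergence as n grows and s tends to t, towards one vector: uniform convergence near t
    and continuity of the limit at t in a single condition. *)
Definition locally_uniform (u : nat -> R -> E) (t : R) (l : E) :=
  forall eps, 0 < eps -> exists (d : R) (N : nat), 0 < d /\
    forall n s, (N <= n)%nat -> Rabs (s - t) < d -> vnorm (u n s ⊖ l) <= eps.

Lemma locally_uniform_intro (u : nat -> R -> E) (t : R) (l : E) :
  (forall eps, 0 < eps -> exists N : nat, forall n s, (N <= n)%nat -> Rabs (s - t) < 1 -> vnorm (u n s ⊖ u N s) <= eps) ->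
  (forall n, cont (u n) t) -> cv (fun n => u n t) l -> locally_uniform u t l.
Proof.
intros HU HC Hl eps He.
destruct (HU (eps / 4)) as [N HN]; [lra|].
assert (Hl4 : vnorm (u N t ⊖ l) <= eps / 2).
{ destruct (Hl (eps / 4)) as [N2 HN2]; [lra|]. specialize (HN2 (max N N2) ltac:(lia)).
  specialize (HN (max N N2) t ltac:(lia)). rewrite Rminus_diag, Rabs_R0 in HN. specialize (HN ltac:(lra)).
  pose proof (dist_triangle (u (max N N2) t) (u N t) l). rewrite (minus_sym (u N t) (u (max N N2) t)) in H. lra. }
destruct (HC N (eps / 4)) as (d & Hd & H'); [lra|].
exists (Rmin d 1), N. split; [apply Rmin_pos; lra|]. intros n s Hn Hs.
pose proof (HN n s Hn ltac:(eapply Rlt_le_trans; [apply Hs|apply Rmin_r])).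
pose proof (H' s ltac:(eapply Rlt_le_trans; [apply Hs|apply Rmin_l])).
pose proof (dist_triangle (u N s) (u n s) l). pose proof (dist_triangle (u N t) (u N s) l). lra.
Qed.

(** The mean value inequality, applied to r ↦ u_n(r) - (r - t) l, bounds the difference quotients
    uniformly in n, and the bound survives the limit. *)
Lemma der_limit (u v : nat -> R -> E) (U : R -> E) (t : R) (l : E) :
  (forall n s, der (u n) s (v n s)) -> (forall s, cv (fun n => u n s) (U s)) ->
  locally_uniform v t l -> der U t l.
Proof.
intros Hu HU Hv eps He. destruct (Hv eps He) as (d & N & Hd & HN).
exists d. split; auto. intros s Hs.
apply (cv_norm_le (fun n => u (n + N)%nat s ⊖ u (n + N)%nat t ⊖ Rs (s - t) l)).
- assert (Hsh : forall r, cv (fun n => u (n + N)%nat r) (U r)).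
  { intros r e He'. destruct (HU r e He') as [N' HN']. exists N'. intros n Hn. apply HN'. lia. }
  apply cv_minus; [|apply cv_const]. apply cv_minus; apply Hsh.
- intro n.
  pose proof (mean_value_le (fun r => u (n + N)%nat r ⊖ Rs (r - t) l) (fun r => v (n + N)%nat r ⊖ l) t s eps) as HM.
  cbv beta in HM.
  replace (u (n + N)%nat s ⊖ Rs (s - t) l ⊖ (u (n + N)%nat t ⊖ Rs (t - t) l)) with
    (u (n + N)%nat s ⊖ u (n + N)%nat t ⊖ Rs (s - t) l) in HM by vec.
  apply HM.
  + intro r. apply der_minus; auto.
    assert (Hid : derivable_pt_lim (fun r => r - t) r (1 - 0)).
    { apply derivable_pt_lim_minus; [apply derivable_pt_lim_id|apply derivable_pt_lim_const]. }
    apply (der_rfun _ r _ l) in Hid. replace (Rs (1 - 0) l) with l in Hid by vec. exact Hid.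
  + intros r Hr. apply HN; [lia|]. eapply Rle_lt_trans; [|apply Hs].
    unfold Rmin, Rmax in Hr. destruct (Rle_dec t s); unfold Rabs; repeat destruct Rcase_abs; lra.
Qed.

End Calculus.

(** * Stone's theorem *)

Section BoundedGroup.
Context {E : HilbertSpace}.
Variable A : E -> E.
Hypothesis A_bounded : is_linear A.
Hypothesis A_skew : forall x : E, rip (A x) x = 0.

Fixpoint iter_op (k : nat) (x : E) : E :=
  match k with O => x | S k => A (iter_op k x) end.

Fixpoint exp_partial (n : nat) (t : R) (x : E) : E :=
  match n with
  | O => x
  | S n => exp_partial n t x ⊕ Rs (/ INR (fact (S n)) * t ^ S n) (iter_op (S n) x)
  end.

Lemma derivable_exp_term (n : nat) (t : R) :
  derivable_pt_lim (fun s => / INR (fact (S n)) * s ^ S n) t (/ INR (fact n) * t ^ n).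
Proof.
replace (/ INR (fact n) * t ^ n) with (/ INR (fact (S n)) * (INR (S n) * t ^ n)).
- apply (derivable_pt_lim_scal (fun s => s ^ S n)). apply derivable_pt_lim_pow.
- rewrite fact_simpl, mult_INR. field. split; [apply INR_fact_neq_0|now apply not_0_INR].
Qed.

Lemma der_exp_partial (n : nat) (t : R) (x : E) :
  der (fun s => exp_partial (S n) s x) t (A (exp_partial n t x)).
Proof.
destruct (is_linear_linmap A A_bounded) as [A1 A2].
induction n as [|n IH].
- replace (A (exp_partial 0 t x)) with (vzero ⊕ Rs (/ INR (fact 0) * t ^ 0) (iter_op 1 x)).
  + apply (der_plus (fun _ => x) (fun s => Rs (/ INR (fact 1) * s ^ 1) (iter_op 1 x))); [apply der_const|].
    apply (der_rfun (fun s => / INR (fact 1) * s ^ 1)), derivable_exp_term.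
  + simpl. rewrite Rinv_1, Rmult_1_l. vec.
- replace (A (exp_partial (S n) t x)) with
    (A (exp_partial n t x) ⊕ Rs (/ INR (fact (S n)) * t ^ S n) (iter_op (S (S n)) x)).
  + apply (der_plus (fun s => exp_partial (S n) s x)
      (fun s => Rs (/ INR (fact (S (S n))) * s ^ S (S n)) (iter_op (S (S n)) x))); auto.
    apply (der_rfun (fun s => / INR (fact (S (S n))) * s ^ S (S n))), derivable_exp_term.
  + change (exp_partial (S n) t x) with (exp_partial n t x ⊕ Rs (/ INR (fact (S n)) * t ^ S n) (iter_op (S n) x)).
    now rewrite A1, A2.
Qed.

Lemma exp_partial_diff (M T : R) : 0 < M -> 0 <= T -> (forall x, vnorm (A x) <= M * vnorm x) ->
  forall (t : R) (x : E) (n m : nat), Rabs t <= T -> (n <= m)%nat ->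
  vnorm (exp_partial m t x ⊖ exp_partial n t x) <=
  vnorm x * (sum_f_R0 (fun k => / INR (fact k) * (T * M) ^ k) m - sum_f_R0 (fun k => / INR (fact k) * (T * M) ^ k) n).
Proof.
intros HM HT HA t x n m Ht.
assert (Hit : forall k, vnorm (iter_op k x) <= M ^ k * vnorm x).
{ induction k; simpl; [lra|]. eapply Rle_trans; [apply HA|]. rewrite Rmult_assoc. apply Rmult_le_compat_l; lra. }
induction 1 as [|m Hm IH].
- replace (exp_partial n t x ⊖ exp_partial n t x) with (vzero : E) by vec. rewrite nrm_zero. lra.
- rewrite tech5.
  eapply Rle_trans; [apply (dist_triangle (exp_partial m t x))|].
  assert (H : vnorm (exp_partial (S m) t x ⊖ exp_partial m t x) <= / INR (fact (S m)) * (T * M) ^ S m * vnorm x); [|lra].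
  change (exp_partial (S m) t x) with (exp_partial m t x ⊕ Rs (/ INR (fact (S m)) * t ^ S m) (iter_op (S m) x)).
  replace (exp_partial m t x ⊕ Rs (/ INR (fact (S m)) * t ^ S m) (iter_op (S m) x) ⊖ exp_partial m t x)
    with (Rs (/ INR (fact (S m)) * t ^ S m) (iter_op (S m) x)) by vec.
  rewrite nrm_rscal, Rabs_mult, Rpow_mult_distr, <- RPow_abs.
  assert (Hf : 0 < / INR (fact (S m))) by apply Rinv_0_lt_compat, INR_fact_lt_0.
  rewrite (Rabs_right (/ INR (fact (S m)))) by lra.
  rewrite !Rmult_assoc. apply Rmult_le_compat_l; [lra|].
  apply Rmult_le_compat; auto using norm_pos.
  + apply pow_le, Rabs_pos.
  + apply pow_incr. split; [apply Rabs_pos|auto].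
Qed.

(** The exponential series, dominated on |t| <= T by the real series of exp(T M); its termwise
    derivatives are its own shifted partial sums, so [der_limit] applies. *)
Lemma bounded_group_exists : exists G : R -> E -> E,
  (forall x, G 0 x = x) /\ forall x t, der (fun s => G s x) t (A (G t x)).
Proof.
destruct (is_linear_bound A A_bounded) as (M & HM & HA).
assert (HU : forall x T, 0 <= T -> forall eps, 0 < eps -> exists N : nat, forall n t, (N <= n)%nat -> Rabs t <= T ->
  vnorm (exp_partial n t x ⊖ exp_partial N t x) <= eps).
{ intros x T HT eps He. pose proof (norm_pos x).
  destruct (proj2_sig (exist_exp (T * M)) (eps / (2 * (vnorm x + 1)))) as [N HN].
  { apply Rdiv_lt_0_compat; lra. }
  exists N. intros n t Hn Ht.
  eapply Rle_trans; [apply (exp_partial_diff M T); auto|].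
  pose proof (HN n ltac:(lia)) as H1. pose proof (HN N ltac:(lia)) as H2. unfold Rdist in *.
  set (l := proj1_sig (exist_exp (T * M))) in *.
  match goal with |- _ * (?p - ?q) <= _ => set (p' := p) in *; set (q' := q) in * end.
  assert (Hpq : p' - q' <= eps / (vnorm x + 1)).
  { apply Rabs_def2 in H1. apply Rabs_def2 in H2.
    replace (eps / (vnorm x + 1)) with (eps / (2 * (vnorm x + 1)) + eps / (2 * (vnorm x + 1))) by (field; lra). lra. }
  apply (Rmult_le_compat_l (vnorm x)) in Hpq; auto. eapply Rle_trans; [apply Hpq|].
  replace eps with ((vnorm x + 1) * (eps / (vnorm x + 1))) at 2 by (field; lra).
  apply Rmult_le_compat_r; [|lra]. left. apply Rdiv_lt_0_compat; lra. }
assert (Hex : forall tx : R * E, exists l, cv (fun n => exp_partial n (fst tx) (snd tx)) l).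
{ intros [t x]. simpl. apply cauchy_cv. intros eps He.
  destruct (HU x (Rabs t) (Rabs_pos t) (eps / 3)) as [N HN]; [lra|].
  exists N. intros n m Hn Hm. pose proof (HN n t Hn (Rle_refl _)). pose proof (HN m t Hm (Rle_refl _)).
  pose proof (dist_triangle (exp_partial N t x) (exp_partial n t x) (exp_partial m t x)).
  rewrite (minus_sym (exp_partial N t x)) in H1. lra. }
destruct (choice _ Hex) as [G0 HG0].
assert (HG : forall t x, cv (fun n => exp_partial n t x) (G0 (t, x))) by (intros t x; apply (HG0 (t, x))).
exists (fun t x => G0 (t, x)). split.
- intro x. apply (cv_unique (fun n => exp_partial n 0 x)); auto.
  apply (cv_ext (fun _ => x)); [|apply cv_const]. induction n; [easy|].
  change (exp_partial (S n) 0 x) with (exp_partial n 0 x ⊕ Rs (/ INR (fact (S n)) * 0 ^ S n) (iter_op (S n) x)).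
  rewrite <- IHn. replace (0 ^ S n) with 0 by (simpl; ring). rewrite Rmult_0_r. vec.
- intros x t.
  apply (der_limit (fun n s => exp_partial (S n) s x) (fun n s => A (exp_partial n s x))).
  + intros n s. apply der_exp_partial.
  + intro s. apply (cv_shift (fun n => exp_partial n s x)); auto.
  + assert (HL : locally_uniform (fun n s => exp_partial n s x) t (G0 (t, x))).
    { apply locally_uniform_intro; auto.
      - intros eps He. destruct (HU x (Rabs t + 1) ltac:(pose proof (Rabs_pos t); lra) eps He) as [N HN].
        exists N. intros n s Hn Hs. apply HN; auto.
        replace s with ((s - t) + t) by ring. eapply Rle_trans; [apply Rabs_triang|lra].
      - intros [|n]; [exact (der_cont (fun _ => x) t vzero (der_const x t))|].
        exact (der_cont _ _ _ (der_exp_partial n t x)). }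
    intros eps He. destruct (HL (eps / M)) as (d & N & Hd & HN); [now apply Rdiv_lt_0_compat|].
    exists d, N. split; auto. intros n s Hn Hs. specialize (HN n s Hn Hs).
    rewrite <- linmap_minus by now apply is_linear_linmap.
    eapply Rle_trans; [apply HA|]. apply (Rmult_le_compat_l M) in HN; [|lra].
    replace (M * (eps / M)) with eps in HN by (field; lra). auto.
Qed.

Variable G : R -> E -> E.
Hypothesis G_0 : forall x, G 0 x = x.
Hypothesis G_der : forall x t, der (fun s => G s x) t (A (G t x)).

Lemma bounded_group_unique (f : R -> E) : (forall t, der f t (A (f t))) -> forall t, f t = G t (f 0).
Proof.
intros Hf. apply (skew_unique (everywhere A)).
- destruct (is_linear_linmap A A_bounded) as [H1 H2]. split; [|split]; simpl; auto.
- intros x _. apply A_skew.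
- intro t. split; [exact I|apply Hf].
- intro t. split; [exact I|apply G_der].
- now rewrite G_0.
Qed.

Lemma bounded_group_norm t x : vnorm (G t x) = vnorm x.
Proof.
rewrite (skew_isometric (everywhere A) (fun t => G t x)).
- now rewrite G_0.
- intros y _. apply A_skew.
- intro s. split; [exact I|apply G_der].
Qed.

(** Both sides solve the equation of the group with initial value [D x]. *)
Lemma bounded_group_comm (D : E -> E) : is_linear D -> (forall x, D (A x) = A (D x)) ->
  forall t x, D (G t x) = G t (D x).
Proof.
intros HD HC t x. rewrite (bounded_group_unique (fun t => D (G t x))).
- now rewrite G_0.
- intro s. rewrite <- HC. now apply der_linear.
Qed.

Lemma bounded_group_plus t x y : G t (x ⊕ y) = G t x ⊕ G t y.
Proof.
symmetry. rewrite (bounded_group_unique (fun t => G t x ⊕ G t y)); [now rewrite !G_0|].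
intro s. destruct (is_linear_linmap A A_bounded) as [H1 H2]. rewrite H1. now apply der_plus.
Qed.

Lemma bounded_group_scal t (a : C) x : G t (a • x) = a • G t x.
Proof.
symmetry. rewrite (bounded_group_unique (fun t => a • G t x)); [now rewrite !G_0|].
intro s. destruct (is_linear_linmap A A_bounded) as [H1 H2]. rewrite H2. now apply der_scal.
Qed.

Lemma bounded_group_lin t : linmap (G t).
Proof. split; [apply bounded_group_plus|apply bounded_group_scal]. Qed.

Lemma bounded_group_add s t x : G (s + t) x = G s (G t x).
Proof.
rewrite (bounded_group_unique (fun s => G (s + t) x)); [now rewrite Rplus_0_l|].
intro r. apply (der_shift (fun s => G s x)). apply G_der.
Qed.

End BoundedGroup.

(** * Yosida approximation of a selfadjoint operator and its limit group *)

Section Stone.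
Context {E : HilbertSpace}.
Variable T : operator E.
Hypothesis T_sa : selfadjoint T.

Let T_lin := selfadjoint_linear T T_sa.

(** From the factorisation a² + T² = (T + ia)(T - ia): two shifted equations are solved in turn. *)
Lemma yosida_exists (a : R) : 0 < a -> forall y, exists u,
  dom T u /\ dom T (T u) /\ Rs (a * a) u ⊕ T (T u) = Rs (a * a) y.
Proof.
intros Ha y.
destruct (shift_surjective T a T_sa ltac:(lra) (Rs (a * a) y)) as (v & Hv & Hvy).
destruct (shift_surjective T (- a) T_sa ltac:(lra) v) as (u & Hu & Huv).
assert (HTu : T u = v ⊕ Rs a (Ci • u)) by (rewrite <- Huv; vec).
destruct (lin_scal T Ci u T_lin Hu) as [H1 H2]. destruct (lin_scal T (RtoC a) _ T_lin H1) as [H3 H4].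
destruct (lin_plus T _ _ T_lin Hv H3) as [H5 H6]. rewrite <- HTu in H5, H6.
exists u. split; [|split]; auto.
rewrite H6, H4, H2, HTu, <- Hvy. vec.
transitivity (Cplus (Cplus (inner (T v) v0) (Cmult (RtoC a) (Cmult Ci (inner v v0))))
  (Cmult (Cmult (RtoC a) (RtoC a)) (Cmult (Cplus (RtoC 1) (Cmult Ci Ci)) (inner u v0)))); [ring|].
replace (Cplus (RtoC 1) (Cmult Ci Ci)) with (RtoC 0); [ring|].
unfold Ci, Cmult, Cplus, RtoC; simpl. f_equal; ring.
Qed.

(** Squaring the equation gives a⁴‖y‖² = a⁴‖u‖² + 2a²‖Tu‖² + ‖T²u‖², all terms being nonnegative. *)
Lemma yosida_bound (a : R) u y : 0 < a -> dom T u -> dom T (T u) ->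
  Rs (a * a) u ⊕ T (T u) = Rs (a * a) y -> vnorm u <= vnorm y /\ vnorm (T u) <= a * vnorm y.
Proof.
intros Ha Hu HTu H.
assert (Hn : (a * a) * (a * a) * (vnorm y * vnorm y) =
  (a * a) * (a * a) * (vnorm u * vnorm u) + 2 * (a * a) * (vnorm (T u) * vnorm (T u)) + vnorm (T (T u)) * vnorm (T (T u))).
{ transitivity (rip (Rs (a * a) y) (Rs (a * a) y)).
  - rewrite rip_scal_l, rip_scal_r, rip_self. ring.
  - rewrite <- H. ripexp. rewrite (selfadjoint_rip T (T u) u), (rip_sym u (T (T u))), (selfadjoint_rip T (T u) u), !rip_self by auto. ring. }
assert (Haa : 0 < a * a) by nra.
pose proof (norm_pos u). pose proof (norm_pos y). pose proof (norm_pos (T u)). pose proof (norm_pos (T (T u))).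
split.
- apply nrm_le. apply (Rmult_le_reg_l ((a * a) * (a * a))); nra.
- apply sq_le; [nra|]. apply (Rmult_le_reg_l (a * a)); nra.
Qed.

Lemma yosida_unique (a : R) u u' y : 0 < a -> dom T u -> dom T (T u) -> dom T u' -> dom T (T u') ->
  Rs (a * a) u ⊕ T (T u) = Rs (a * a) y -> Rs (a * a) u' ⊕ T (T u') = Rs (a * a) y -> u = u'.
Proof.
intros Ha H1 H2 H3 H4 H5 H6.
destruct (lin_minus T _ _ T_lin H1 H3) as [D1 D2]. destruct (lin_minus T _ _ T_lin H2 H4) as [D3 D4].
rewrite <- D2 in D3, D4.
destruct (yosida_bound a (u ⊖ u') vzero Ha D1 D3) as [H _].
- rewrite D4. replace (Rs (a * a) (u ⊖ u') ⊕ (T (T u) ⊖ T (T u'))) with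
    ((Rs (a * a) u ⊕ T (T u)) ⊖ (Rs (a * a) u' ⊕ T (T u'))) by vec. rewrite H5, H6. vec.
- rewrite nrm_zero in H. apply nrm_dist_0. pose proof (norm_pos (u ⊖ u')). lra.
Qed.

Section Yosida.
(* [K a] is [a^2 (a^2 + T^2)^-1] *)
Variable K : R -> E -> E.
Hypothesis K_spec : forall a y, 0 < a ->
  dom T (K a y) /\ dom T (T (K a y)) /\ Rs (a * a) (K a y) ⊕ T (T (K a y)) = Rs (a * a) y.

Lemma yosida_eq (a : R) u y : 0 < a -> dom T u -> dom T (T u) ->
  Rs (a * a) u ⊕ T (T u) = Rs (a * a) y -> K a y = u.
Proof. intros Ha H1 H2 H3. destruct (K_spec a y Ha) as (K1 & K2 & K3). now apply (yosida_unique a _ _ y). Qed.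

Lemma yosida_lin (a : R) : 0 < a -> linmap (K a).
Proof.
intro Ha. split.
- intros x y. destruct (K_spec a x Ha) as (X1 & X2 & X3). destruct (K_spec a y Ha) as (Y1 & Y2 & Y3).
  destruct (lin_plus T _ _ T_lin X1 Y1) as [D1 D2]. destruct (lin_plus T _ _ T_lin X2 Y2) as [D3 D4].
  apply yosida_eq; auto; rewrite D2; auto. rewrite D4.
  transitivity ((Rs (a * a) (K a x) ⊕ T (T (K a x))) ⊕ (Rs (a * a) (K a y) ⊕ T (T (K a y)))); [vec|].
  rewrite X3, Y3. vec.
- intros b x. destruct (K_spec a x Ha) as (X1 & X2 & X3).
  destruct (lin_scal T b _ T_lin X1) as [D1 D2]. destruct (lin_scal T b _ T_lin X2) as [D3 D4].
  apply yosida_eq; auto; rewrite D2; auto. rewrite D4.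
  transitivity (b • (Rs (a * a) (K a x) ⊕ T (T (K a x)))); [vec|].
  rewrite X3. vec.
Qed.

Lemma yosida_contraction (a : R) : 0 < a -> contraction (K a).
Proof. intros Ha x. destruct (K_spec a x Ha) as (X1 & X2 & X3). now apply (yosida_bound a). Qed.

(** For [y] in the domain, T²(K a y) = a²(y - K a y) lies in the domain too, so T(K a y) solves the
    equation with right side T y. *)
Lemma yosida_comm_T (a : R) y : 0 < a -> dom T y -> K a (T y) = T (K a y).
Proof.
intros Ha Hy. destruct (K_spec a y Ha) as (X1 & X2 & X3).
assert (HTT : T (T (K a y)) = Rs (a * a) y ⊖ Rs (a * a) (K a y)) by (rewrite <- X3; vec).
destruct (lin_scal T (RtoC (a * a)) _ T_lin Hy) as [D1 D2]. destruct (lin_scal T (RtoC (a * a)) _ T_lin X1) as [D3 D4].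
destruct (lin_minus T _ _ T_lin D1 D3) as [D5 D6]. rewrite <- HTT in D5, D6.
apply yosida_eq; auto. rewrite D6, D2, D4. vec.
Qed.

Lemma yosida_comm (a b : R) y : 0 < a -> 0 < b -> K a (K b y) = K b (K a y).
Proof.
intros Ha Hb. destruct (K_spec b y Hb) as (X1 & X2 & X3).
symmetry. destruct (K_spec a (K b y) Ha) as (Z1 & Z2 & _). destruct (K_spec a (T (K b y)) Ha) as (W1 & W2 & _).
apply yosida_eq; auto.
rewrite <- !yosida_comm_T by auto.
destruct (yosida_lin a Ha) as [L1 L2]. now rewrite <- !L2, <- L1, X3.
Qed.

(* bounded skew approximation of [- i T] *)
Definition yosida_gen (a : R) (y : E) : E := Copp Ci • T (K a y).

Lemma yosida_gen_bounded (a : R) : 0 < a -> is_linear (yosida_gen a).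
Proof.
intro Ha. apply (linmap_is_linear _ a).
- destruct (yosida_lin a Ha) as [L1 L2]. split; unfold yosida_gen.
  + intros x y. destruct (K_spec a x Ha) as (X1 & _). destruct (K_spec a y Ha) as (Y1 & _).
    destruct (lin_plus T _ _ T_lin X1 Y1) as [_ D]. rewrite L1, D. vec.
  + intros b x. destruct (K_spec a x Ha) as (X1 & _).
    destruct (lin_scal T b _ T_lin X1) as [_ D]. rewrite L2, D. vec.
- intro x. destruct (K_spec a x Ha) as (X1 & X2 & X3). unfold yosida_gen.
  rewrite nrm_scal, Cmod_opp. rewrite <- nrm_scal, nrm_Ci. now apply (yosida_bound a _ x).
Qed.

Lemma rip_oppCi (x y : E) : rip (Copp Ci • x) y = - rip x (⊖ (Ci • y)).
Proof.
replace (Copp Ci • x) with (⊖ (Ci • x)) by vec. ripexp. rewrite rip_Ci_r. ring.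
Qed.

Lemma skew_gen x : dom T x -> rip (Copp Ci • T x) x = 0.
Proof. intro Hx. rewrite rip_oppCi. ripexp. rewrite selfadjoint_rip_Ci by auto. ring. Qed.

(** With u = K a y, substitute a² y = a² u + T(Tu): the pairing of -iTu with each summand vanishes,
    since <Tu, u> and <Tu, T(Tu)> are real. *)
Lemma yosida_gen_skew (a : R) y : 0 < a -> rip (yosida_gen a y) y = 0.
Proof.
intro Ha. destruct (K_spec a y Ha) as (X1 & X2 & X3). unfold yosida_gen. set (u := K a y) in *.
assert (H : a * a * rip (Copp Ci • T u) y = 0).
{ rewrite <- rip_scal_r, <- X3. ripexp. rewrite skew_gen by auto.
  rewrite rip_oppCi. ripexp. rewrite rip_Ci_r, rip_sym, selfadjoint_rip_Ci by auto. ring. }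
assert (0 < a * a) by nra. nra.
Qed.

Lemma yosida_gen_comm (a b : R) y : 0 < a -> 0 < b ->
  yosida_gen a (yosida_gen b y) = yosida_gen b (yosida_gen a y).
Proof.
intros Ha Hb. unfold yosida_gen.
destruct (K_spec a y Ha) as (X1 & X2 & _). destruct (K_spec b y Hb) as (Y1 & Y2 & _).
destruct (yosida_lin a Ha) as [_ LA]. destruct (yosida_lin b Hb) as [_ LB].
rewrite LA, LB, !yosida_comm_T, yosida_comm; auto.
Qed.

(** a²(y - K a y) = T²(K a y) = T K a (T y), and T K a has norm at most a. *)
Lemma yosida_approx (a : R) y : 0 < a -> dom T y -> vnorm (K a y ⊖ y) <= / a * vnorm (T y).
Proof.
intros Ha Hy. destruct (K_spec a y Ha) as (X1 & X2 & X3). destruct (K_spec a (T y) Ha) as (Y1 & Y2 & Y3).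
destruct (yosida_bound a _ _ Ha Y1 Y2 Y3) as [_ HB]. rewrite yosida_comm_T in HB by auto.
apply (Rmult_le_reg_l (a * a)); [nra|].
replace (a * a * vnorm (K a y ⊖ y)) with (vnorm (T (T (K a y)))).
- replace (a * a * (/ a * vnorm (T y))) with (a * vnorm (T y)) by (field; lra). auto.
- rewrite <- (Rabs_right (a * a)) by nra. rewrite <- nrm_rscal, <- nrm_opp. f_equal.
  transitivity (Rs (a * a) (K a y) ⊖ (Rs (a * a) (K a y) ⊕ T (T (K a y)))); [vec|]. rewrite X3. vec.
Qed.

Lemma yosida_index (n : nat) : 0 < INR n + 1.
Proof. pose proof (pos_INR n). lra. Qed.

Lemma yosida_cv y : cv (fun n => K (INR n + 1) y) y.
Proof.
intros eps He. destruct (selfadjoint_dense T T_sa y (eps / 4)) as (x & Hx & Hd); [lra|].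
change (vnorm (y ⊖ x) < eps / 4) in Hd. pose proof (norm_pos (T x)).
destruct (archimed_cor1 (eps / (4 * (vnorm (T x) + 1)))) as (N & HN & HN0); [apply Rdiv_lt_0_compat; lra|].
exists N. intros n Hn. pose proof (yosida_index n) as Hp.
pose proof (yosida_approx _ x Hp Hx) as H1.
pose proof (yosida_contraction _ Hp (y ⊖ x)) as H2. rewrite linmap_minus in H2 by now apply yosida_lin.
pose proof (dist_triangle (K (INR n + 1) x) (K (INR n + 1) y) y) as H3.
pose proof (dist_triangle x (K (INR n + 1) x) y) as H4. rewrite (minus_sym x y) in H4.
assert (H5 : / (INR n + 1) * vnorm (T x) <= eps / 4).
{ assert (/ (INR n + 1) <= / INR N).
  { apply Rinv_le_contravar; [now apply lt_0_INR|]. apply le_INR in Hn. lra. }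
  apply Rle_trans with (eps / (4 * (vnorm (T x) + 1)) * vnorm (T x)); [apply Rmult_le_compat_r; lra|].
  replace (eps / 4) with (eps / (4 * (vnorm (T x) + 1)) * (vnorm (T x) + 1)) by (field; lra).
  apply Rmult_le_compat_l; [|lra]. left. apply Rdiv_lt_0_compat; lra. }
lra.
Qed.

Lemma yosida_gen_cv x : dom T x -> cv (fun n => yosida_gen (INR n + 1) x) (Copp Ci • T x).
Proof.
intro Hx. apply (cv_ext (fun n => Copp Ci • K (INR n + 1) (T x))).
- intro n. unfold yosida_gen. rewrite yosida_comm_T; auto using yosida_index.
- apply cv_scal, yosida_cv.
Qed.

Variable G : nat -> R -> E -> E.
Hypothesis G_0 : forall n x, G n 0 x = x.
Hypothesis G_der : forall n x t, der (fun s => G n s x) t (yosida_gen (INR n + 1) (G n t x)).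

Let A n := yosida_gen (INR n + 1).
Let A_bd n : is_linear (A n) := yosida_gen_bounded _ (yosida_index n).
Let A_skew n x : rip (A n x) x = 0 := yosida_gen_skew _ x (yosida_index n).
Let G_norm n : forall t x, vnorm (G n t x) = vnorm x :=
  bounded_group_norm (A n) (A_skew n) (G n) (G_0 n) (G_der n).
Let G_lin n : forall t, linmap (G n t) :=
  bounded_group_lin (A n) (A_bd n) (A_skew n) (G n) (G_0 n) (G_der n).

(** The derivative of G_n x - G_m x is A_n(G_n x - G_m x) + G_m (A_n - A_m) x. The first term is
    skew and drops out of the energy; the second keeps the norm ‖(A_n - A_m)x‖ because the
    approximations commute and G_m is isometric. The factor 4 is the 2 of the differentiated square
    times ‖G_n x - G_m x‖ <= 2‖x‖. *)
Lemma yosida_group_diff n m x t :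
  vnorm (G n t x ⊖ G m t x) * vnorm (G n t x ⊖ G m t x) <= 4 * vnorm x * vnorm (A n x ⊖ A m x) * Rabs t.
Proof.
set (D := fun y => A n y ⊖ A m y).
assert (Hlin : forall k, linmap (A k)) by (intro k; apply is_linear_linmap, A_bd).
assert (HD : is_linear D).
{ destruct (is_linear_bound _ (A_bd n)) as (M1 & _ & HM1). destruct (is_linear_bound _ (A_bd m)) as (M2 & _ & HM2).
  apply (linmap_is_linear D (M1 + M2)).
  - destruct (Hlin n) as [N1 N2]. destruct (Hlin m) as [N3 N4]. unfold D.
    split; intros; [rewrite N1, N3|rewrite N2, N4]; vec.
  - intro y. unfold D. eapply Rle_trans; [apply nrm_triangle_m|]. specialize (HM1 y). specialize (HM2 y). lra. }
assert (HDA : forall y, D (A m y) = A m (D y)).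
{ intro y. unfold D. rewrite linmap_minus by auto. f_equal. apply yosida_gen_comm; apply yosida_index. }
pose proof (bounded_group_comm (A m) (A_bd m) (A_skew m) (G m) (G_0 m) (G_der m) D HD HDA) as HDG.
pose proof (energy_growth (fun t => G n t x ⊖ G m t x) (fun t => A n (G n t x) ⊖ A m (G m t x))
  (2 * vnorm x * vnorm (D x))) as H.
replace (4 * vnorm x * vnorm (A n x ⊖ A m x)) with (2 * (2 * vnorm x * vnorm (D x))) by (unfold D; ring).
apply H.
- intro s. now apply der_minus; apply G_der.
- intro s. replace (A n (G n s x) ⊖ A m (G m s x)) with (A n (G n s x ⊖ G m s x) ⊕ G m s (D x)).
  + rewrite rip_plus_l, A_skew, Rplus_0_l. eapply Rle_trans; [apply cauchy_schwarz|].
    rewrite G_norm. pose proof (nrm_triangle_m (G n s x) (G m s x)) as H1. rewrite !G_norm in H1.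
    pose proof (norm_pos (D x)). nra.
  + rewrite <- HDG. unfold D. rewrite (linmap_minus (A n)) by auto. vec.
- rewrite !G_0. vec.
Qed.

Lemma yosida_group_cauchy y t eps : 0 < eps -> exists N : nat, forall n s, (N <= n)%nat -> Rabs (s - t) < 1 ->
  vnorm (G n s y ⊖ G N s y) <= eps.
Proof.
intro He. destruct (selfadjoint_dense T T_sa y (eps / 4)) as (x & Hx & Hd); [lra|].
change (vnorm (y ⊖ x) < eps / 4) in Hd. pose proof (norm_pos x) as Px. pose proof (Rabs_pos t) as Pt.
(* [k] dominates the coefficient 4‖x‖|s| of the energy estimate for |s - t| < 1, and [e] is tuned so
   that k e = (eps / 2)². *)
set (k := 4 * vnorm x * (Rabs t + 1) + 1). assert (Hk : 0 < k) by (unfold k; nra).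
set (e := eps * eps / 4 / k). assert (0 < e) by (apply Rdiv_lt_0_compat; auto; nra).
destruct (yosida_gen_cv x Hx (e / 2)) as [N HN]; [lra|].
exists N. intros n s Hn Hs.
assert (HA : vnorm (A n x ⊖ A N x) <= e).
{ pose proof (HN n Hn) as H1. pose proof (HN N (le_n _)) as H2. fold (A n) in H1. fold (A N) in H2.
  pose proof (dist_triangle (Copp Ci • T x) (A n x) (A N x)) as H3.
  rewrite (minus_sym (Copp Ci • T x)) in H3. lra. }
assert (Hs' : Rabs s <= Rabs t + 1).
{ replace s with ((s - t) + t) by ring. eapply Rle_trans; [apply Rabs_triang|lra]. }
assert (H1 : vnorm (G n s x ⊖ G N s x) <= eps / 2).
{ apply sq_le; [lra|]. eapply Rle_trans; [apply yosida_group_diff|].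
  pose proof (norm_pos (A n x ⊖ A N x)). pose proof (Rabs_pos s).
  apply Rle_trans with (k * e); [|unfold e; right; field; lra].
  apply Rle_trans with (4 * vnorm x * (Rabs t + 1) * e); [|unfold k; nra].
  replace (4 * vnorm x * vnorm (A n x ⊖ A N x) * Rabs s) with ((4 * vnorm x) * (vnorm (A n x ⊖ A N x) * Rabs s)) by ring.
  rewrite (Rmult_assoc (4 * vnorm x)). apply Rmult_le_compat_l; [lra|]. rewrite (Rmult_comm _ e).
  apply Rmult_le_compat; auto. }
assert (H2 : forall j, vnorm (G j s y ⊖ G j s x) <= eps / 4).
{ intro j. rewrite <- linmap_minus, G_norm by auto. lra. }
pose proof (H2 n) as H3. pose proof (H2 N) as H4.
pose proof (dist_triangle (G n s x) (G n s y) (G N s y)) as H5.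
pose proof (dist_triangle (G N s x) (G n s x) (G N s y)) as H6. rewrite (minus_sym (G N s x) (G N s y)) in H6. lra.
Qed.

Variable U : R -> E -> E.
Hypothesis U_lim : forall t y, cv (fun n => G n t y) (U t y).

Lemma yosida_group_uniform t y : locally_uniform (fun n s => G n s y) t (U t y).
Proof.
apply locally_uniform_intro; auto.
- intros eps He. now apply yosida_group_cauchy.
- intro n. apply (der_cont _ _ _ (G_der n y t)).
Qed.

Lemma limit_norm t x : vnorm (U t x) = vnorm x.
Proof.
apply Rle_antisym.
- apply (cv_norm_le (fun n => G n t x)); auto. intro n. rewrite G_norm. lra.
- apply le_epsilon. intros eps He. destruct (U_lim t x eps He) as [N HN]. specialize (HN N (le_n _)).
  rewrite <- (G_norm N t x). pose proof (nrm_le_dist (G N t x) (U t x)). lra.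
Qed.

Lemma limit_lin t : linmap (U t).
Proof.
split.
- intros x y. apply (cv_unique (fun n => G n t (x ⊕ y))); auto.
  apply (cv_ext (fun n => G n t x ⊕ G n t y)); [|now apply cv_plus].
  intro n. symmetry. apply G_lin.
- intros a x. apply (cv_unique (fun n => G n t (a • x))); auto.
  apply (cv_ext (fun n => a • G n t x)); [|now apply cv_scal].
  intro n. symmetry. apply G_lin.
Qed.

Lemma limit_0 x : U 0 x = x.
Proof.
apply (cv_unique (fun n => G n 0 x)); auto. apply (cv_ext (fun _ => x)); [|apply cv_const].
intro n. now rewrite G_0.
Qed.

Lemma limit_add s t x : U (s + t) x = U s (U t x).
Proof.
apply (cv_unique (fun n => G n (s + t) x)); auto.
intros eps He. destruct (U_lim t x (eps / 2)) as [N1 H1]; [lra|]. destruct (U_lim s (U t x) (eps / 2)) as [N2 H2]; [lra|].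
exists (max N1 N2). intros n Hn. specialize (H1 n ltac:(lia)). specialize (H2 n ltac:(lia)).
rewrite (bounded_group_add (A n) (A_bd n) (A_skew n) (G n) (G_0 n) (G_der n)).
pose proof (dist_triangle (G n s (U t x)) (G n s (G n t x)) (U s (U t x))) as H3.
rewrite <- linmap_minus, G_norm in H3 by auto. lra.
Qed.

Lemma limit_cont t x : cont (fun s => U s x) t.
Proof.
intros eps He. destruct (yosida_group_uniform t x (eps / 2)) as (d & N & Hd & HN); [lra|].
exists d. split; auto. intros s Hs. apply Rle_lt_trans with (eps / 2); [|lra].
apply (cv_norm_le (fun n => G (n + N)%nat s x ⊖ U t x)).
- apply cv_minus; [|apply cv_const]. intros e He'. destruct (U_lim s x e He') as [N' HN'].
  exists N'. intros n Hn. apply HN'. lia.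
- intro n. apply HN; auto. lia.
Qed.

(** A_n commutes with G_n, so the derivative of G_n x at s is G_n(s) A_n x, which converges locally
    uniformly by isometry. *)
Lemma limit_der t x : dom T x -> der (fun s => U s x) t (U t (Copp Ci • T x)).
Proof.
intro Hx.
apply (der_limit (fun n s => G n s x) (fun n s => A n (G n s x))); auto.
intros eps He. destruct (yosida_group_uniform t (Copp Ci • T x) (eps / 2)) as (d & N1 & Hd & HN1); [lra|].
destruct (yosida_gen_cv x Hx (eps / 2)) as [N2 HN2]; [lra|].
exists d, (max N1 N2). split; auto. intros n s Hn Hs.
specialize (HN1 n s ltac:(lia) Hs). specialize (HN2 n ltac:(lia)). fold (A n) in HN2.
rewrite (bounded_group_comm (A n) (A_bd n) (A_skew n) (G n) (G_0 n) (G_der n) (A n) (A_bd n)) by auto.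
pose proof (dist_triangle (G n s (Copp Ci • T x)) (G n s (A n x)) (U t (Copp Ci • T x))) as H.
rewrite <- linmap_minus, G_norm in H by auto. lra.
Qed.

Lemma limit_rip t x y : rip (U t x) (U t y) = rip x y.
Proof.
pose proof (limit_norm t (x ⊕ y)) as H. destruct (limit_lin t) as [H1 _]. rewrite H1 in H.
apply (f_equal (fun r => r * r)) in H. rewrite <- !rip_self in H. ripexp_in H.
rewrite !rip_self, !limit_norm, (rip_sym y x), (rip_sym (U t y)) in H. lra.
Qed.

(** For z in the domain, differentiate <U(s)z, x> = <z, U(-s)x> at 0: this exhibits i y as an
    adjoint value of [T] at [x], and selfadjointness puts [x] in the domain. *)
Lemma limit_generator x y : der (fun s => U s x) 0 y -> dom T x.
Proof.
intro Hd. apply (selfadjoint_max T x (Ci • y) T_sa). apply adjoint_at_rip; [exact T_lin|].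
assert (H : forall z, dom T z -> rip (Copp Ci • T z) x = - rip y z).
{ intros z Hz.
  apply (uniqueness_limite (fun s => rip (U s z) x) 0).
  - replace (Copp Ci • T z) with (U 0 (Copp Ci • T z)) by apply limit_0.
    apply (der_rip (fun s => U s z)). now apply limit_der.
  - assert (Hneg : der (fun s => U (- s) x) 0 (⊖ y)).
    { intros eps He. destruct (Hd eps He) as (d & Hd0 & Hd1). exists d. split; auto. intros s Hs.
      specialize (Hd1 (- s)). replace (- s - 0) with (- (s - 0)) in Hd1 by ring.
      rewrite Rabs_Ropp in Hd1. specialize (Hd1 Hs). rewrite Ropp_0.
      replace (U (- s) x ⊖ U 0 x ⊖ Rs (s - 0) (⊖ y)) with (U (- s) x ⊖ U 0 x ⊖ Rs (- (s - 0)) y) by vec. auto. }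
    apply (der_rip _ _ _ z) in Hneg. rewrite rip_opp_l in Hneg.
    intros eps He. destruct (Hneg eps He) as [d Hd']. exists d. intros h Hh Hhd. specialize (Hd' h Hh Hhd).
    assert (Hr : forall r, rip (U r z) x = rip (U (- r) x) z).
    { intro r. rewrite <- (limit_rip (- r) (U r z) x), <- limit_add.
      replace (- r + r) with 0 by ring. now rewrite limit_0, rip_sym. }
    now rewrite !Hr. }
intros z Hz. destruct (lin_scal T Ci z T_lin Hz) as [H1 H2].
specialize (H _ H1). rewrite H2, rip_Ci_r in H.
rewrite oppCi_Ci in H. rewrite H, (rip_sym z). ring.
Qed.

End Yosida.

Theorem stone : exists U, is_unitary_group (fun _ => True) T U.
Proof.
assert (HK : forall ay : R * E, exists u, 0 < fst ay ->
  dom T u /\ dom T (T u) /\ Rs (fst ay * fst ay) u ⊕ T (T u) = Rs (fst ay * fst ay) (snd ay)).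
{ intros [a y]. simpl. destruct (Rlt_dec 0 a) as [Ha|Ha].
  - destruct (yosida_exists a Ha y) as [u Hu]. now exists u.
  - exists y. now intro. }
destruct (choice _ HK) as [K0 HK0].
set (K := fun a y => K0 (a, y)).
assert (K_spec : forall a y, 0 < a -> dom T (K a y) /\ dom T (T (K a y)) /\ Rs (a * a) (K a y) ⊕ T (T (K a y)) = Rs (a * a) y).
{ intros a y. apply (HK0 (a, y)). }
assert (HG : forall n : nat, exists G : R -> E -> E, (forall x, G 0 x = x) /\
  forall x t, der (fun s => G s x) t (yosida_gen K (INR n + 1) (G t x))).
{ intro n. apply bounded_group_exists. apply yosida_gen_bounded; auto. apply yosida_index. }
destruct (choice _ HG) as [G HG'].
assert (G_0 : forall n x, G n 0 x = x) by (intro n; apply HG').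
assert (G_der : forall n x t, der (fun s => G n s x) t (yosida_gen K (INR n + 1) (G n t x))) by (intro n; apply HG').
assert (HU : forall ty : R * E, exists l, cv (fun n => G n (fst ty) (snd ty)) l).
{ intros [t y]. simpl. apply cauchy_cv. intros eps He.
  destruct (yosida_group_cauchy K K_spec G G_0 G_der y t (eps / 3)) as [N HN]; [lra|].
  assert (Ht : Rabs (t - t) < 1) by (rewrite Rminus_diag, Rabs_R0; lra).
  exists N. intros n m Hn Hm. pose proof (HN n t Hn Ht). pose proof (HN m t Hm Ht).
  pose proof (dist_triangle (G N t y) (G n t y) (G m t y)). rewrite (minus_sym (G N t y)) in H1. lra. }
destruct (choice _ HU) as [U0 HU0].
set (U := fun t y => U0 (t, y)).
assert (U_lim : forall t y, cv (fun n => G n t y) (U t y)) by (intros t y; apply (HU0 (t, y))).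
exists U.
split; [easy|]. split; [intros; eapply limit_lin; eauto|]. split; [intros; eapply limit_lin; eauto|].
split; [intros; eapply limit_norm; eauto|]. split; [intros; eapply limit_0; eauto|].
split; [intros; eapply limit_add; eauto|].
split; [intros; apply continuous_cont; eapply limit_cont; eauto|].
split.
- intros x Hx. split; [easy|]. apply der_is_derive. change (der (fun t => U t x) 0 (⊖ (Ci • T x))).
  replace (⊖ (Ci • T x)) with (U 0 (Copp Ci • T x)).
  + eapply limit_der; eauto.
  + replace (U 0 (Copp Ci • T x)) with (Copp Ci • T x); [vec|]. symmetry. eapply limit_0; eauto.
- intros x y _ Hd. apply der_is_derive in Hd. eapply limit_generator; eauto.
Qed.

End Stone.

(** * Orbits of unitary groups and uniqueness for the Schrödinger equation *)

Section UnitaryGroups.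
Context {E : HilbertSpace}.

(** The group law carries the derivative at 0 to time t. The orbit of [U t x] is therefore
    differentiable at 0, so the last clause of [is_unitary_group] puts [U t x] in the domain;
    computing that derivative in two ways gives the commutation. *)
Lemma unitary_evolution (S : E -> Prop) (T : operator E) (U : R -> E -> E) :
  subspace S -> linear_operator T -> (forall x, dom T x -> S (T x)) -> is_unitary_group S T U ->
  forall x, dom T x -> forall t,
  dom T (U t x) /\ T (U t x) = U t (T x) /\ der (fun s => U s x) t (Copp Ci • T (U t x)).
Proof.
intros HS HT HST (U1 & U2 & U3 & U4 & U5 & U6 & U7 & U8 & U9) x Hx t.
assert (HD : forall z, dom T z -> S z /\ der (fun s => U s z) 0 (Copp Ci • T z)).
{ intros z Hz. destruct (U8 z Hz) as [H1 H2]. split; auto. apply der_is_derive in H2.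
  replace (Copp Ci • T z) with (⊖ (Ci • T z)) by vec. exact H2. }
destruct (HD x Hx) as [HSx HDx].
assert (HSy : S (Copp Ci • T x)) by (apply HS; auto).
assert (H : der (fun s => U s x) t (U t (Copp Ci • T x))).
{ apply (der_ext (fun s => U t (U (s - t) x))).
  - intro s. rewrite <- U6 by auto. f_equal. ring.
  - apply (der_bounded (U t) S 1); auto.
    + intros z Hz. rewrite U4 by auto. lra.
    + apply (der_shift (fun s => U s x) t (- t)). now replace (t + - t) with 0 by ring. }
assert (H0 : der (fun s => U s (U t x)) 0 (U t (Copp Ci • T x))).
{ apply (der_ext (fun s => U (s + t) x)); [intro s; now apply U6|].
  apply (der_shift (fun s => U s x) 0 t). now rewrite Rplus_0_l. }
assert (Hd : dom T (U t x)).
{ apply (U9 _ (U t (Copp Ci • T x))); auto. now apply der_is_derive. }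
assert (Heq : U t (Copp Ci • T x) = Copp Ci • T (U t x)).
{ apply (der_unique (fun s => U s (U t x)) 0); auto. now apply HD. }
rewrite Heq in H. split; [|split]; auto.
rewrite U3 in Heq by auto.
rewrite <- (Ci_oppCi (T (U t x))), <- Heq. apply Ci_oppCi.
Qed.

(** A witness that a group on the range exists. It makes the choice of [expHR] meaningful, without
    saying which group is chosen. *)
Lemma unitary_group_Ran (T : operator E) (U : R -> E -> E) : linear_operator T ->
  is_unitary_group (fun _ => True) T U -> is_unitary_group (Ran T) (restrict T (Ran T)) U.
Proof.
intros HT HU. pose proof HU as (U1 & U2 & U3 & U4 & U5 & U6 & U7 & U8 & U9).
split.
{ intros t x (z & Hz & <-).
  destruct (unitary_evolution _ T U full_subspace HT (fun _ _ => I) HU z Hz t) as (H1 & H2 & _).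
  exists (U t z). now split. }
repeat match goal with |- _ /\ _ => split end; auto.
- intros x [H1 H2]. split; auto. now apply U8.
- intros x y H1 H2. split; auto. now apply (U9 x y).
Qed.

Lemma schrodinger_unique (T : operator E) (f g : R -> E) : selfadjoint T ->
  (forall t, dom T (f t) /\ der f t (Copp Ci • T (f t))) ->
  (forall t, dom T (g t) /\ der g t (Copp Ci • T (g t))) -> f 0 = g 0 -> forall t, f t = g t.
Proof.
intros HT. pose proof (selfadjoint_linear T HT) as HL.
apply (skew_unique (mk_op (dom T) (fun x => Copp Ci • T x))).
- split; [|split]; simpl.
  + apply HL.
  + intros x y Hx Hy. destruct (lin_plus T x y HL Hx Hy) as [H1 H2]. split; auto. rewrite H2. vec.
  + intros a x Hx. destruct (lin_scal T a x HL Hx) as [H1 H2]. split; auto. rewrite H2. vec.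
- intros x Hx. now apply skew_gen.
Qed.

End UnitaryGroups.

(** * Finite-dimensional subspaces *)

Section FiniteRank.
Context {E : HilbertSpace}.

(** For orthonormal [l] and [phi] the identity this is the orthogonal projection onto the span of
    [l]; a general [phi] also covers the bounded extension of [proj K J L]. *)
Fixpoint finite_rank (phi : E -> E) (l : list E) (x : E) : E :=
  match l with
  | nil => vzero
  | cons u l => inner x (phi u) • u ⊕ finite_rank phi l x
  end.

Fixpoint orthonormal (l : list E) : Prop :=
  match l with
  | nil => True
  | cons u l => vnorm u = 1 /\ (forall w, List.In w l -> inner w u = RtoC 0) /\ orthonormal l
  end.

Lemma Cmod_inner_le (x y : E) : Cmod (inner x y) <= 2 * vnorm x * vnorm y.
Proof.
rewrite inner_rip. set (a := rip x y). set (b := rip x (Ci • y)).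
pose proof (cauchy_schwarz x y) as Ha. fold a in Ha.
pose proof (cauchy_schwarz x (Ci • y)) as Hb. fold b in Hb. rewrite nrm_Ci in Hb.
replace ((a, b) : C) with (Cplus (RtoC a) (Cmult (RtoC b) Ci)).
- eapply Rle_trans; [apply Cmod_triangle|]. rewrite Cmod_mult, !Cmod_R.
  replace (Cmod Ci) with 1; [lra|].
  unfold Cmod; simpl. replace (0 * (0 * 1) + 1 * (1 * 1)) with 1 by ring. now rewrite sqrt_1.
- unfold Cplus, Cmult, RtoC, Ci; simpl. f_equal; ring.
Qed.

Lemma finite_rank_linmap phi l : linmap (finite_rank phi l).
Proof.
split; induction l as [|u l IH]; simpl; intros.
- vec.
- rewrite IH, inner_plus_l. vec.
- vec.
- rewrite IH, inner_scal_l. vec.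
Qed.

Lemma finite_rank_is_linear phi l : is_linear (finite_rank phi l).
Proof.
assert (H : exists M, forall x, vnorm (finite_rank phi l x) <= M * vnorm x).
{ induction l as [|u l [M HM]]; simpl.
  - exists 0. intro x. rewrite nrm_zero. lra.
  - exists (2 * vnorm (phi u) * vnorm u + M). intro x.
    eapply Rle_trans; [apply nrm_triangle|]. rewrite nrm_scal. specialize (HM x).
    pose proof (Cmod_inner_le x (phi u)) as H. pose proof (norm_pos u).
    apply (Rmult_le_compat_r (vnorm u)) in H; auto. lra. }
destruct H as [M HM]. apply (linmap_is_linear _ M); auto using finite_rank_linmap.
Qed.

Lemma finite_rank_in (S : E -> Prop) phi l x : subspace S -> (forall u, List.In u l -> S u) -> S (finite_rank phi l x).
Proof.
intros HS. induction l as [|u l IH]; simpl; intro H; apply HS; auto. apply HS. auto.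
Qed.

Lemma finite_rank_orth phi l x v : (forall u, List.In u l -> inner u v = RtoC 0) -> inner (finite_rank phi l x) v = RtoC 0.
Proof.
induction l as [|u l IH]; simpl; intro H.
- apply inner_zero_l.
- rewrite inner_plus_l, inner_scal_l, H, IH by auto. ring.
Qed.

Lemma finite_rank_coord phi l x u : orthonormal l -> List.In u l -> inner (finite_rank phi l x) u = inner x (phi u).
Proof.
induction l as [|w l IH]; simpl; [easy|]. intros (H1 & H2 & H3) [->|Hu]; rewrite inner_plus_l, inner_scal_l.
- rewrite inner_norm, H1, finite_rank_orth by auto. rewrite Rmult_1_l. ring.
- rewrite IH by auto. rewrite (inner_0_sym u w) by auto. ring.
Qed.

(** The vectors [e k] may be dependent: a vanishing residual leaves the list unchanged. Lying in the
    span of [l] is expressed as being fixed by the projection. *)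
Lemma gram_schmidt (S : E -> Prop) (e : nat -> E) (n : nat) : subspace S -> (forall k, S (e k)) ->
  exists l, orthonormal l /\ (forall u, List.In u l -> S u) /\
    forall k, (k <= n)%nat -> finite_rank (fun u => u) l (e k) = e k.
Proof.
intros HS He.
assert (Hstep : forall l x, S x -> orthonormal l -> (forall u, List.In u l -> S u) ->
  exists l', orthonormal l' /\ (forall u, List.In u l' -> S u) /\ finite_rank (fun u => u) l' x = x /\
    forall y, finite_rank (fun u => u) l y = y -> finite_rank (fun u => u) l' y = y).
{ intros l x Hx Hl HlS. set (r := x ⊖ finite_rank (fun u => u) l x).
  destruct (classic (r = vzero)) as [Hr|Hr].
  - exists l. repeat split; auto. symmetry. now apply minus_eq_zero.
  - assert (Hn : 0 < vnorm r).
    { destruct (norm_pos r); auto. exfalso. apply Hr. now apply norm_eq_0. }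
    set (u := Rs (/ vnorm r) r).
    assert (Horth : forall w, List.In w l -> inner w u = RtoC 0).
    { intros w Hw. apply inner_0_sym. unfold u, r. rewrite inner_scal_l, inner_minus_l, finite_rank_coord by auto. ring. }
    exists (cons u l). split; [|split; [|split]].
    + split; [|split]; auto. unfold u. rewrite nrm_rscal, Rabs_right.
      * field. lra.
      * left. now apply Rinv_0_lt_compat.
    + intros w [<-|Hw]; auto. unfold u. apply HS. apply subspace_minus; auto. now apply finite_rank_in.
    + simpl. assert (H : inner x u = RtoC (vnorm r)).
      { assert (Hxr : x = r ⊕ finite_rank (fun u => u) l x) by (unfold r; vec).
        rewrite Hxr, inner_plus_l, finite_rank_orth by auto. unfold u. rewrite inner_scal_r, inner_norm.
        unfold Cconj, RtoC, Cmult, Cplus; simpl. f_equal; field; lra. }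
      rewrite H. unfold u.
      replace (Rs (vnorm r) (Rs (/ vnorm r) r)) with r; [unfold r; vec|].
      vec. rewrite RtoC_inv by lra. field. intro HH. apply RtoC_inj in HH. lra.
    + intros y Hy. simpl. replace (inner y u) with (RtoC 0); [rewrite Hy; vec|].
      rewrite <- Hy. symmetry. now apply finite_rank_orth. }
induction n as [|n (l & H1 & H2 & H3)].
- destruct (Hstep nil (e 0%nat)) as (l & H1 & H2 & H3 & _); simpl; auto; [easy|].
  exists l. split; [|split]; auto. intros k Hk. replace k with 0%nat by lia. auto.
- destruct (Hstep l (e (Datatypes.S n))) as (l' & H4 & H5 & H6 & H7); auto.
  exists l'. split; [|split]; auto. intros k Hk. destruct (Nat.eq_dec k (Datatypes.S n)) as [->|]; auto.
  apply H7, H3. lia.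
Qed.

Lemma finite_dim_orthonormal (S : E -> Prop) : subspace S -> finite_dimensional S ->
  exists l, orthonormal l /\ (forall u, List.In u l -> S u) /\
    forall x, S x -> finite_rank (fun u => u) l x = x.
Proof.
intros HS (n & e & He & Hspan).
destruct (gram_schmidt S e n HS He) as (l & H1 & H2 & H3). exists l. split; [|split]; auto.
intros x Hx. destruct (Hspan x Hx) as [c ->]. clear Hx Hspan.
destruct (finite_rank_linmap (fun u => u) l) as [L1 L2].
induction n as [|n IH].
- rewrite sum_O, L2, H3 by lia. easy.
- rewrite sum_Sn.
  change (finite_rank (fun u => u) l (sum_n (fun k => c k • e k) n ⊕ c (Datatypes.S n) • e (Datatypes.S n)) =
    sum_n (fun k => c k • e k) n ⊕ c (Datatypes.S n) • e (Datatypes.S n)).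
  rewrite L1, L2, H3 by lia. f_equal. apply IH. intros k Hk. apply H3. lia.
Qed.

(** The subspace is the fixed-point set of a bounded operator, the projection onto an orthonormal
    basis of it. *)
Lemma finite_dim_closed (S : E -> Prop) : subspace S -> finite_dimensional S -> seq_closed S.
Proof.
intros HS HF u m Hu Hm. destruct (finite_dim_orthonormal S HS HF) as (l & H1 & H2 & H3).
replace m with (finite_rank (fun u => u) l m); [now apply finite_rank_in|].
apply (cv_unique u); auto.
apply (cv_ext (fun n => finite_rank (fun u => u) l (u n))); [intro n; auto|].
apply is_linear_cv; auto. apply finite_rank_is_linear.
Qed.

End FiniteRank.

(** * The Hamiltonian system *)

Section Hamiltonian.
Context (E : HilbertSpace) (J : E -> E) (B : operator E).
Hypothesis J_bounded : is_linear J.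
Hypothesis J_skew : op_eq (adjoint (everywhere J)) (everywhere (fun x => opp (J x))).
Hypothesis J_square : forall x, J (J x) = opp x.
Hypothesis B_selfadjoint : selfadjoint B.
Hypothesis B_nonneg : nonnegative B.
Hypothesis hI : exists delta : R, 0 < delta /\
     forall z : C, in_spectrum B z ->
       z = RtoC 0 \/ exists s : R, delta <= s /\ z = RtoC s.
Hypothesis hII : finite_dimensional (Ker B).
Hypothesis hIII : forall x, spK B x -> spV B (J x).
Hypothesis hIV : selfadjoint (opH J B).

Let L := Lam B.
Let K := spK B.

Lemma J_linmap : linmap J.
Proof. now apply is_linear_linmap. Qed.

Lemma J_adjoint x y : inner (J x) y = inner x (⊖ J y).
Proof.
destruct J_skew as [H1 H2].
assert (Hd : dom (adjoint (everywhere J)) y) by now apply H1.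
specialize (H2 y Hd). change (adjoint (everywhere J) y = ⊖ J y) in H2. rewrite <- H2.
apply (epsilon_spec (inhabits (vzero : E)) (adjoint_at (everywhere J) y)); simpl; auto.
Qed.

Lemma Lam_spec : selfadjoint L /\ nonnegative L /\ op_eq (Defs.comp L L) B.
Proof.
exact (epsilon_spec (inhabits (everywhere (fun x : E => x))) _ (op_sqrt_exists B B_selfadjoint B_nonneg)).
Qed.

Lemma L_sa : selfadjoint L.
Proof. apply Lam_spec. Qed.

Lemma L_lin : linear_operator L.
Proof. apply selfadjoint_linear, L_sa. Qed.

Lemma dom_B x : dom B x <-> dom L x /\ dom L (L x).
Proof. destruct Lam_spec as (_ & _ & H & _). symmetry. apply H. Qed.

Lemma B_eq x : dom L x -> dom L (L x) -> B x = L (L x).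
Proof. destruct Lam_spec as (_ & _ & _ & H). intros H1 H2. symmetry. apply H. now split. Qed.

Lemma Ker_B_iff x : Ker B x <-> K x.
Proof.
split.
- intros [H1 H2]. apply dom_B in H1. destruct H1 as [H1 H3]. split; auto.
  rewrite B_eq in H2 by auto. apply norm_eq_0.
  pose proof (selfadjoint_rip L (L x) x L_sa H3 H1) as H. rewrite H2, rip_zero_l, rip_self in H.
  pose proof (norm_pos (L x)). change (vnorm (L x) = 0). nra.
- intros [H1 H2]. change (L x = vzero) in H2. destruct (lin_zero L L_lin) as [H3 H4].
  assert (H5 : dom L (L x)) by now rewrite H2.
  split; [now apply dom_B|]. rewrite B_eq, H2; auto.
Qed.

Lemma K_subspace : subspace K.
Proof. apply Ker_subspace, L_lin. Qed.

Lemma K_finite_dim : finite_dimensional K.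
Proof.
destruct hII as (n & e & H1 & H2). exists n, e. split.
- intro k. now apply Ker_B_iff.
- intros x Hx. apply H2. now apply Ker_B_iff.
Qed.

Lemma K_basis : exists l, orthonormal l /\ (forall u, List.In u l -> K u) /\
  forall x, K x -> finite_rank (fun u => u) l x = x.
Proof. apply finite_dim_orthonormal; [apply K_subspace|apply K_finite_dim]. Qed.

(** As <Bx, x> = ‖Lx‖² and Bx = L(Lx), [gap_quadratic] bounds [L] from below by sqrt delta on
    vectors [L x]; [lower_bound_coker] moves the bound to the complement of the kernel. *)
Lemma L_lower_bound : exists c : R, 0 < c /\ forall x, dom L x -> orth K x -> c * vnorm x <= vnorm (L x).
Proof.
destruct hI as (delta & Hd & Hs).
assert (Hq := gap_quadratic B delta B_selfadjoint Hd).
assert (HR : forall lam : R, 0 < lam < delta -> in_resolvent_set B (RtoC lam)).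
{ intros lam Hl. apply NNPP. intro Hn. destruct (Hs (RtoC lam) Hn) as [H|(s & H1 & H2)].
  - apply RtoC_inj in H. lra.
  - apply RtoC_inj in H2. lra. }
specialize (Hq HR).
exists (sqrt delta). pose proof (sqrt_lt_R0 delta Hd). split; auto.
apply lower_bound_coker; auto; [apply L_sa|].
intros x H1 H2. apply sq_le; [apply norm_pos|].
specialize (Hq x (proj2 (dom_B x) (conj H1 H2))).
rewrite B_eq, (selfadjoint_rip L (L x) x L_sa H2 H1), rip_self in Hq by auto.
replace (sqrt delta * vnorm (L x) * (sqrt delta * vnorm (L x))) with
  ((sqrt delta * sqrt delta) * (vnorm (L x) * vnorm (L x))) by ring.
now rewrite sqrt_sqrt by lra.
Qed.

Lemma ranL_iff y : ranL B y <-> orth K y.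
Proof.
destruct L_lower_bound as (c & Hc & H). exact (Ran_iff_orth_Ker L c y L_sa Hc H).
Qed.

Lemma ranL_subspace : subspace (ranL B).
Proof. apply Ran_subspace, L_lin. Qed.

Lemma L_K k : K k -> dom L k /\ L k = vzero.
Proof. now intros [H1 H2]. Qed.

Lemma projK_spec x : K (proj K x) /\ orth K (x ⊖ proj K x).
Proof. apply proj_spec. apply coker_split, L_sa. Qed.

Lemma projK_eq x k : K k -> orth K (x ⊖ k) -> proj K x = k.
Proof. apply proj_eq, K_subspace. Qed.

Lemma projK_linmap : linmap (proj K).
Proof.
split.
- intros x y. destruct (projK_spec x) as [H1 H2]. destruct (projK_spec y) as [H3 H4].
  apply projK_eq; [now apply K_subspace|].
  replace (x ⊕ y ⊖ (proj K x ⊕ proj K y)) with ((x ⊖ proj K x) ⊕ (y ⊖ proj K y)) by vec.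
  now apply orth_subspace.
- intros a x. destruct (projK_spec x) as [H1 H2].
  apply projK_eq; [now apply K_subspace|].
  replace (a • x ⊖ a • proj K x) with (a • (x ⊖ proj K x)) by vec.
  now apply orth_subspace.
Qed.

Lemma projK_contraction x : vnorm (proj K x) <= vnorm x.
Proof.
destruct (projK_spec x) as [H1 H2]. apply nrm_le.
assert (H : rip (x ⊖ proj K x) (proj K x) = 0) by (unfold rip; now rewrite H2).
rewrite rip_minus_l, rip_self in H. pose proof (rip_le x (proj K x)).
pose proof (norm_pos x). pose proof (norm_pos (proj K x)). nra.
Qed.

Lemma projK_is_linear : is_linear (proj K).
Proof. apply (linmap_is_linear _ 1); [apply projK_linmap|]. intro x. rewrite Rmult_1_l. apply projK_contraction. Qed.

Lemma projK_K k : K k -> proj K k = k.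
Proof.
intro Hk. apply projK_eq; auto. replace (k ⊖ k) with (vzero : E) by vec. apply orth_subspace.
Qed.

Lemma projK_ranL y : ranL B y -> proj K y = vzero.
Proof.
intro Hy. apply projK_eq; [apply K_subspace|]. replace (y ⊖ vzero) with y by vec. now apply ranL_iff.
Qed.

Lemma projK_zero_ranL y : proj K y = vzero -> ranL B y.
Proof.
intro H. apply ranL_iff. destruct (projK_spec y) as [_ H1]. rewrite H in H1.
now replace (y ⊖ vzero) with y in H1 by vec.
Qed.

(** The difference lies in [K] and has zero projection there. This is how closed formulas for the
    solution are compared. *)
Lemma V_eq x y : dom L x -> dom L y -> L x = L y -> proj K x = proj K y -> x = y.
Proof.
intros Hx Hy HL HK. apply minus_eq_zero. destruct (lin_minus L x y L_lin Hx Hy) as [H1 H2].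
assert (Hk : K (x ⊖ y)). { split; auto. change (L (x ⊖ y) = vzero). rewrite H2, HL. vec. }
rewrite <- (projK_K _ Hk), linmap_minus, HK by apply projK_linmap. vec.
Qed.

Lemma Lam_plus_inverse y : ranL B y ->
  dom L (inverse (Lam_plus B) y) /\ ranL B (inverse (Lam_plus B) y) /\ L (inverse (Lam_plus B) y) = y.
Proof.
intro Hy. destruct (Ran_reduced L y L_sa Hy) as (x & H1 & H2 & H3).
assert (H : exists x, dom (Lam_plus B) x /\ Lam_plus B x = y).
{ exists x. split; auto. split; auto. now apply ranL_iff. }
destruct (epsilon_spec (inhabits (vzero : E)) _ H) as [[H4 H5] H6].
change (epsilon (inhabits (vzero : E)) (fun x => dom (Lam_plus B) x /\ Lam_plus B x = y)) with (inverse (Lam_plus B) y) in *.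
split; [|split]; auto.
Qed.

(** For u in an orthonormal basis of [K], <J L z, u> = -<z, L J u>, where [hIII] allows [L] to be
    moved across. So [P] is the finite-rank map with coefficients <z, -L J u>; its bound in V is
    immediate since [L] kills [K]. *)
Lemma opP_spec : is_linear (opP J B) /\ (forall x, dom L (opP J B x)) /\
  (forall z, dom L z -> opP J B z = proj K (J (L z))).
Proof.
assert (H : exists P : E -> E, is_linear P /\ (forall x, spV B (P x)) /\
      (exists M, forall x, normV B (P x) <= M * vnorm x) /\
      (forall z, spV B z -> P z = proj (spK B) (J (Lam B z)))).
{ destruct K_basis as (l & H1 & H2 & H3).
  set (P := finite_rank (fun u => ⊖ L (J u)) l).
  assert (HP : forall x, K (P x)) by (intro x; apply finite_rank_in; auto using K_subspace).
  assert (HPl : is_linear P) by apply finite_rank_is_linear.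
  exists P. split; [|split; [|split]]; auto.
  - intro x. now apply L_K.
  - destruct (is_linear_bound P HPl) as (M & _ & HM). exists M. intro x. unfold normV.
    fold L. rewrite (proj2 (L_K _ (HP x))). change (vnorm (vzero : E) + vnorm (P x) <= M * vnorm x).
    rewrite nrm_zero, Rplus_0_l. apply HM.
  - intros z Hz. fold K L. symmetry. apply projK_eq; auto.
    intros s Hs. rewrite <- (H3 s Hs). apply inner_0_sym. apply finite_rank_orth. intros u Hu.
    apply inner_0_sym. rewrite inner_minus_l. unfold P. rewrite finite_rank_coord by auto.
    assert (HJu : dom L (J u)) by (apply hIII; now apply H2).
    rewrite J_adjoint, !inner_opp_r, (selfadjoint_sym L z (J u) L_sa Hz HJu). ring. }
destruct (epsilon_spec (inhabits (fun x : E => x)) _ H) as (H1 & H2 & _ & H3).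
split; [|split]; auto.
Qed.

Lemma opP_K z : dom L z -> K (opP J B z).
Proof. intro Hz. destruct opP_spec as (_ & _ & H). rewrite H by auto. apply projK_spec. Qed.

(** * The operator H and its range *)

Let H := opH J B.

Lemma H_lin : linear_operator H.
Proof. now apply selfadjoint_linear. Qed.

Lemma H_eq z : dom H z -> H z = Ci • L (J (L z)).
Proof. intros [H1 H2]. exact (proj2 (lin_scal L Ci _ L_lin H2)). Qed.

Lemma ranH_ranL y : ranH J B y -> ranL B y.
Proof.
intros (z & [H1 H2] & <-). exists (Ci • J (L z)). split; [|reflexivity].
exact (proj1 (lin_scal L Ci _ L_lin H2)).
Qed.

(** [f] lies in [Ran H] iff [f = L v] with [v ⊥ J K]; writing [v = g - k] with
    [g ⊥ K] this becomes a closed condition on [g = L^-1 f], as [proj K J K] is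
    finite-dimensional. *)
Lemma ranH_iff f : ranH J B f <->
  exists g, dom L g /\ orth K g /\ L g = f /\ exists k, K k /\ proj K (J g) = proj K (J k).
Proof.
destruct J_linmap as [J1 J2]. split.
- intros (z & [H1 H2] & <-). set (v := Ci • J (L z)).
  assert (Hv : dom L v) by exact (proj1 (lin_scal L Ci _ L_lin H2)).
  destruct (projK_spec v) as [Hk Ho]. destruct (L_K _ Hk) as [Hk1 Hk2].
  destruct (lin_minus L _ _ L_lin Hv Hk1) as [Hd1 Hd2].
  exists (v ⊖ proj K v). split; [|split; [|split]]; auto.
  + rewrite Hd2, Hk2. unfold v. change (L v ⊖ vzero = L v). vec.
  (* [J v] is -i L z, hence in [Ran L] and without component in [K]; so J(v - proj K v) and J(- proj
     K v) have the same projection to [K]. *)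
  + exists (⊖ proj K v). split; [now apply subspace_opp; [apply K_subspace|]|].
    rewrite linmap_minus by apply J_linmap.
    replace (⊖ proj K v) with (Rs (-1) (proj K v)) by vec. rewrite J2.
    rewrite linmap_minus by apply projK_linmap.
    destruct projK_linmap as [_ P2]. rewrite P2.
    rewrite (projK_ranL (J v)); [vec|].
    unfold v. rewrite J2, J_square. apply ranL_subspace. apply subspace_opp; [apply ranL_subspace|].
    now exists z.
- intros (g & Hg & Ho & <- & k & Hk & Hgk).
  destruct (L_K _ Hk) as [Hk1 Hk2]. destruct (lin_minus L g k L_lin Hg Hk1) as [Hd1 Hd2].
  (* Equality of the projections says J(g - k) = L y for some y. Then z = i y satisfies i J L z = g
     - k, whose image under [L] is that of [g]. *)
  assert (Hr : ranL B (J (g ⊖ k))).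
  { apply projK_zero_ranL. rewrite linmap_minus by apply J_linmap.
    rewrite linmap_minus by apply projK_linmap. rewrite Hgk. vec. }
  destruct Hr as (y & Hy & HLy). change (L y = J (g ⊖ k)) in HLy.
  destruct (lin_scal L Ci y L_lin Hy) as [Hz1 Hz2].
  assert (HJ : J (L (Ci • y)) = ⊖ (Ci • (g ⊖ k))).
  { rewrite Hz2, HLy, J2, J_square. change (Ci • ⊖ (g ⊖ k) = ⊖ (Ci • (g ⊖ k))). vec. }
  exists (Ci • y). split.
  + split; auto. change (dom L (J (L (Ci • y)))). rewrite HJ.
    apply subspace_opp; [apply dom_subspace, L_lin|]. exact (proj1 (lin_scal L Ci _ L_lin Hd1)).
  + change (L (Ci • J (L (Ci • y))) = L g). rewrite HJ.
    replace (Ci • ⊖ (Ci • (g ⊖ k))) with (Ci • (Copp Ci • (g ⊖ k))) by vec. rewrite Ci_oppCi, Hd2, Hk2. vec.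
Qed.

Lemma ranH_subspace : subspace (ranH J B).
Proof. apply Ran_subspace, H_lin. Qed.

(** The lower bound makes the preimage [g] of [ranH_iff] depend continuously on [f], and the
    subspace [M] is closed because it is spanned by the images of a finite spanning family of
    [K]. *)
Lemma ranH_closed : seq_closed (ranH J B).
Proof.
set (M := fun m => exists k, K k /\ m = proj K (J k)).
destruct J_linmap as [J1 J2]. destruct projK_linmap as [P1 P2].
assert (HMs : subspace M).
{ split; [|split].
  - exists vzero. split; [apply K_subspace|]. rewrite (linmap_zero J) by apply J_linmap. symmetry. apply linmap_zero, projK_linmap.
  - intros x y (k & Hk & ->) (k' & Hk' & ->). exists (k ⊕ k'). split; [now apply K_subspace|]. now rewrite J1, P1.
  - intros a x (k & Hk & ->). exists (a • k). split; [now apply K_subspace|]. now rewrite J2, P2. }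
assert (HMc : seq_closed M).
{ apply finite_dim_closed; auto. destruct K_finite_dim as (n & e & He & Hspan).
  exists n, (fun k => proj K (J (e k))). split.
  - intro k. exists (e k). auto.
  - intros x (k & Hk & ->). destruct (Hspan k Hk) as [c ->]. exists c. clear Hspan Hk.
    induction n as [|n IH].
    + rewrite !sum_O. now rewrite J2, P2.
    + rewrite !sum_Sn.
      match goal with |- proj K (J (plus ?a (scal ?b ?d))) = plus ?p (scal ?b ?q) =>
        change (proj K (J (a ⊕ b • d)) = p ⊕ b • q) end.
      now rewrite J1, P1, J2, P2, IH. }
intros u f Hu Hf. destruct L_lower_bound as (c & Hc & HB).
destruct (choice _ (fun n => proj1 (ranH_iff (u n)) (Hu n))) as [g Hg].
assert (Hfr : ranL B f).
{ apply ranL_iff. apply (orth_closed K u); auto. intro n. apply ranL_iff, ranH_ranL, Hu. }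
destruct (Ran_reduced L f L_sa Hfr) as (g' & G1 & G2 & G3).
assert (Hgc : cv g g').
{ apply (cv_lip u f _ _ (/ c)); auto. intro n. destruct (Hg n) as (A1 & A2 & A3 & _).
  destruct (lin_minus L _ _ L_lin A1 G1) as [D1 D2].
  pose proof (HB _ D1 (subspace_minus _ _ _ (orth_subspace _) A2 G2)) as HH. rewrite D2, A3, G3 in HH.
  apply (Rmult_le_reg_l c); auto. rewrite <- Rmult_assoc, Rinv_r, Rmult_1_l by lra. auto. }
apply ranH_iff. exists g'. split; [|split; [|split]]; auto.
apply (HMc (fun n => proj K (J (g n)))).
- intro n. destruct (Hg n) as (_ & _ & _ & k & Hk & Hk'). now exists k.
- apply is_linear_cv; [apply projK_is_linear|]. now apply is_linear_cv.
Qed.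

Lemma projR_spec x : ranH J B (proj (ranH J B) x) /\ orth (ranH J B) (x ⊖ proj (ranH J B) x).
Proof. apply proj_spec. apply projection_exists; [apply ranH_subspace|apply ranH_closed]. Qed.

Lemma kerH0_subspace : subspace (kerH0 J B).
Proof.
destruct (Ker_subspace H H_lin) as (A1 & A2 & A3). destruct ranL_subspace as (B1 & B2 & B3).
unfold kerH0. split; [|split].
- now split.
- intros x y [X1 X2] [Y1 Y2]. split; auto.
- intros a x [X1 X2]. split; auto.
Qed.

(** The range of [H] lies inside [Ran L], so subtracting the projection onto it stays in [Ran L] and
    lands in [Ker H] by selfadjointness. *)
Lemma proj_kerH0 z : ranL B z ->
  kerH0 J B (proj (kerH0 J B) z) /\ proj (kerH0 J B) z = z ⊖ proj (ranH J B) z.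
Proof.
intro Hz. destruct (projR_spec z) as [H1 H2].
assert (Hk : kerH0 J B (z ⊖ proj (ranH J B) z)).
{ split; [now apply orth_Ran_Ker|]. apply subspace_minus; auto using ranL_subspace, ranH_ranL. }
assert (Heq : proj (kerH0 J B) z = z ⊖ proj (ranH J B) z).
{ apply proj_eq; auto using kerH0_subspace.
  replace (z ⊖ (z ⊖ proj (ranH J B) z)) with (proj (ranH J B) z) by vec.
  intros s [Hs _]. apply inner_0_sym. now apply (Ker_orth_Ran H). }
rewrite Heq. auto.
Qed.

(** A preimage orthogonal to [Ker H] lies in [Ran H], because this range is closed. *)
Lemma opHR_inverse y : ranH J B y ->
  ranH J B (inverse (opHR J B) y) /\ dom H (inverse (opHR J B) y) /\ H (inverse (opHR J B) y) = y.
Proof.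
intro Hy. destruct (Ran_reduced H y hIV Hy) as (x & H1 & H2 & H3).
assert (Hex : exists x, dom (opHR J B) x /\ opHR J B x = y).
{ exists x. split; auto. split; auto. apply biorth; [apply ranH_subspace|apply ranH_closed|].
  intros z Hz. apply H2. now apply orth_Ran_Ker. }
destruct (epsilon_spec (inhabits (vzero : E)) _ Hex) as [[H4 H5] H6].
change (epsilon (inhabits (vzero : E)) (fun x => dom (opHR J B) x /\ opHR J B x = y)) with (inverse (opHR J B) y) in *.
split; [|split]; auto.
Qed.

(** * The two groups and the explicit solution *)

Let U := expH J B.
Let UR := expHR J B.

Lemma U_spec : is_unitary_group (fun _ => True) H U.
Proof. exact (epsilon_spec (inhabits (fun (_ : R) (x : E) => x)) _ (stone H hIV)). Qed.

Lemma UR_spec : is_unitary_group (ranH J B) (opHR J B) UR.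
Proof.
exact (epsilon_spec (inhabits (fun (_ : R) (x : E) => x)) _
  (ex_intro (is_unitary_group (Ran H) (restrict H (Ran H))) U (unitary_group_Ran H U H_lin U_spec))).
Qed.

Lemma opHR_lin : linear_operator (opHR J B).
Proof.
destruct ranH_subspace as (A1 & A2 & A3). pose proof (dom_subspace H H_lin) as (D1 & D2 & D3).
split; [|split].
- now split.
- intros x y [X1 X2] [Y1 Y2]. destruct (lin_plus H x y H_lin X2 Y2) as [P1 P2]. split; [|exact P2]. split; auto.
- intros a x [X1 X2]. destruct (lin_scal H a x H_lin X2) as [P1 P2]. split; [|exact P2]. split; auto.
Qed.

Lemma UR_evolution x t : ranH J B x -> dom H x ->
  ranH J B (UR t x) /\ dom H (UR t x) /\ H (UR t x) = UR t (H x) /\ der (fun s => UR s x) t (Copp Ci • H (UR t x)).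
Proof.
intros H1 H2.
assert (HS : forall y, dom (opHR J B) y -> ranH J B (opHR J B y)) by (intros y [_ Hy]; now exists y).
destruct (unitary_evolution _ _ UR ranH_subspace opHR_lin HS UR_spec x (conj H1 H2) t) as ([A1 A2] & A3 & A4).
auto.
Qed.

Lemma U_evolution x t : dom H x ->
  dom H (U t x) /\ H (U t x) = U t (H x) /\ der (fun s => U s x) t (Copp Ci • H (U t x)).
Proof. intros Hx. apply (unitary_evolution (fun _ => True)); auto using full_subspace, H_lin, U_spec. Qed.

Variable X0 : E.
Hypothesis hX0 : spV B X0.

Let Z0 := L X0.
Let p0 := proj (kerH0 J B) Z0.
Let pR := proj (ranH J B) Z0.
Let w0 := inverse (opHR J B) pR.

(* the primitive of [t |-> expH t (L X0)] that vanishes at [0] *)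
Let W t := Rs t p0 ⊕ Ci • (UR t w0 ⊖ w0).

Lemma Z0_ranL : ranL B Z0.
Proof. now exists X0. Qed.

Lemma p0_spec : dom H p0 /\ H p0 = vzero /\ ranL B p0 /\ Z0 = p0 ⊕ pR.
Proof.
destruct (proj_kerH0 Z0 Z0_ranL) as [[[H1 H2] H3] H4]. split; [|split; [|split]]; auto.
unfold p0. rewrite H4. unfold pR. vec.
Qed.

Lemma w0_spec : ranH J B w0 /\ dom H w0 /\ H w0 = pR.
Proof. apply opHR_inverse. apply projR_spec. Qed.

(** On [p0] the group is constant. [pR] need not lie in the domain of [H], so the two groups are
    compared on [w0], by uniqueness of strong solutions, and the result is carried to pR = H w0 by
    commutation with [H]. *)
Lemma U_Z0 t : U t Z0 = p0 ⊕ UR t pR.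
Proof.
destruct p0_spec as (A1 & A2 & A3 & A4). destruct w0_spec as (B1 & B2 & B3).
destruct U_spec as (_ & U2 & _ & _ & U5 & _). destruct UR_spec as (_ & _ & _ & _ & UR5 & _).
assert (Hp : U t p0 = p0).
{ apply (schrodinger_unique H (fun t => U t p0) (fun _ => p0) hIV); auto.
  - intro s. destruct (U_evolution p0 s A1) as (C1 & _ & C3). now split.
  - intro s. split; auto. rewrite A2. replace (Copp Ci • vzero) with (vzero : E) by vec. apply der_const. }
assert (Hw : U t w0 = UR t w0).
{ apply (schrodinger_unique H (fun t => U t w0) (fun t => UR t w0) hIV).
  - intro s. destruct (U_evolution w0 s B2) as (C1 & _ & C3). now split.
  - intro s. destruct (UR_evolution w0 s B1 B2) as (_ & C1 & _ & C3). now split.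
  - rewrite U5, UR5; auto. }
rewrite A4, U2, Hp by auto. f_equal. rewrite <- B3.
destruct (U_evolution w0 t B2) as (_ & <- & _). destruct (UR_evolution w0 t B1 B2) as (_ & _ & <- & _).
now rewrite Hw.
Qed.

(** [W] is a strong solution of W' = Z0 - i H W: [H] kills [p0], and i times the derivative of UR w0
    is H UR w0 = UR pR. *)
Lemma W_spec t : dom H (W t) /\ ranL B (W t) /\ Copp Ci • H (W t) = U t Z0 ⊖ Z0 /\ der W t (U t Z0).
Proof.
destruct p0_spec as (A1 & A2 & A3 & A4). destruct w0_spec as (B1 & B2 & B3).
destruct (UR_evolution w0 t B1 B2) as (C1 & C2 & C3 & C4). rewrite B3 in C3.
destruct (lin_minus H _ _ H_lin C2 B2) as [D1 D2]. destruct (lin_scal H Ci _ H_lin D1) as [D3 D4].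
destruct (lin_scal H (RtoC t) _ H_lin A1) as [D5 D6]. destruct (lin_plus H _ _ H_lin D5 D3) as [D7 D8].
split; [exact D7|split; [|split]].
- destruct ranL_subspace as (R1 & R2 & R3). apply R2; auto. apply R3. apply subspace_minus; auto using ranL_subspace, ranH_ranL.
- unfold W. rewrite D8, D6, D4, D2, A2, C3, B3, U_Z0, A4.
  replace (Rs t vzero ⊕ Ci • (UR t pR ⊖ pR)) with (Ci • (UR t pR ⊖ pR)) by vec. rewrite oppCi_Ci. vec.
- rewrite U_Z0. unfold W. apply (der_plus (fun t => Rs t p0) (fun t => Ci • (UR t w0 ⊖ w0))).
  + replace p0 with (Rs 1 p0) by vec. apply (der_ext (fun s => Rs s p0)); [intro; vec|].
    apply (der_rfun (fun s => s)). apply derivable_pt_lim_id.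
  + rewrite <- (Ci_oppCi (UR t pR)). apply (der_scal Ci (fun s => UR s w0 ⊖ w0)).
    replace (Copp Ci • UR t pR) with (Copp Ci • UR t pR ⊖ vzero) by vec.
    apply (der_minus (fun s => UR s w0) (fun _ => w0)); [|apply der_const]. now rewrite <- C3.
Qed.

Lemma W_0 : W 0 = vzero.
Proof.
destruct w0_spec as (B1 & B2 & B3). destruct UR_spec as (_ & _ & _ & _ & UR5 & _).
unfold W. rewrite UR5 by auto. vec.
Qed.

Lemma W_dom t : dom L (W t) /\ dom L (J (L (W t))) /\ L (J (L (W t))) = U t Z0 ⊖ Z0.
Proof.
destruct (W_spec t) as ([H1 H2] & _ & H3 & _). split; [|split]; auto.
rewrite <- H3. rewrite H_eq by (now split).
now rewrite oppCi_Ci.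
Qed.

Let F t : E :=
       plus (plus (plus
         (inverse (Lam_plus B) (expH J B t (Lam B X0)))
         (proj (spK B) X0))
         (scal (RtoC t) (opP J B (proj (kerH0 J B) (Lam B X0)))))
         (let w := inverse (opHR J B) (proj (ranH J B) (Lam B X0)) in
          scal Ci (opP J B (minus (expHR J B t w) w))).

Lemma UZ0_ranL t : ranL B (U t Z0).
Proof.
rewrite U_Z0. destruct p0_spec as (A1 & A2 & A3 & A4). destruct UR_spec as (U1 & _).
apply ranL_subspace; auto. apply ranH_ranL, U1, projR_spec.
Qed.

Lemma F_eq t : F t = inverse (Lam_plus B) (U t Z0) ⊕ proj K X0 ⊕ opP J B (W t).
Proof.
destruct opP_spec as (P1 & _). destruct (is_linear_linmap _ P1) as [P2 P3].
unfold W. rewrite P2, !P3. fold U UR L Z0 p0 pR w0.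
transitivity (inverse (Lam_plus B) (U t Z0) ⊕ proj K X0 ⊕ Rs t (opP J B p0) ⊕ Ci • opP J B (UR t w0 ⊖ w0)); [reflexivity|vec].
Qed.

Lemma F_spec t : dom L (F t) /\ L (F t) = U t Z0 /\ proj K (F t) = proj K X0 ⊕ opP J B (W t).
Proof.
destruct (Lam_plus_inverse (U t Z0) (UZ0_ranL t)) as (A1 & A2 & A3).
destruct (W_dom t) as (W1 & W2 & W3). pose proof (opP_K _ W1) as PK.
destruct (projK_spec X0) as [XK _].
destruct (L_K _ PK) as [B1 B2]. destruct (L_K _ XK) as [B3 B4].
rewrite F_eq.
destruct (lin_plus L _ _ L_lin A1 B3) as [C1 C2]. destruct (lin_plus L _ _ L_lin C1 B1) as [C3 C4].
split; [|split]; auto.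
- rewrite C4, C2, A3, B2, B4. vec.
- destruct projK_linmap as [Q1 _]. rewrite !Q1. rewrite (projK_ranL _ A2), (projK_K _ XK), (projK_K _ PK). vec.
Qed.

(** By [V_eq]: the images under [L] agree since L J L W is the increment of U Z0, and the components
    in [K] agree since [P] is proj K J L on V. *)
Lemma F_integrated t : F t = J (L (W t)) ⊕ X0.
Proof.
destruct (F_spec t) as (A1 & A2 & A3). destruct (W_dom t) as (W1 & W2 & W3).
destruct (lin_plus L _ _ L_lin W2 hX0) as [C1 C2].
apply V_eq; auto.
- rewrite A2, C2, W3. fold Z0. vec.
- destruct projK_linmap as [Q1 _]. rewrite A3, Q1. destruct opP_spec as (_ & _ & P3). rewrite P3 by auto. vec.
Qed.

Lemma F_0 : F 0 = X0.
Proof.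
rewrite F_integrated, W_0. rewrite (proj2 (lin_zero L L_lin)), (linmap_zero J) by apply J_linmap. vec.
Qed.

Lemma normV_eq x : normV B x = vnorm (L x) + vnorm x.
Proof. reflexivity. Qed.

Lemma U_cont t : cont (fun s => U s Z0) t.
Proof. apply continuous_cont. destruct U_spec as (_ & _ & _ & _ & _ & _ & U7 & _). now apply U7. Qed.

(** The component of an increment in [K] is [P] of an increment of [W]; the rest is bounded by 1/c
    times its image under [L], an increment of the unitary orbit. *)
Lemma F_continuousV : continuousV B F.
Proof.
split; [intro t; apply F_spec|]. intro t.
apply (proj2 (filterlim_locally_ball_norm (U := R_NormedModule) (F := locally t) _ 0)).
intro eps. destruct L_lower_bound as (c & Hc & HB).
destruct opP_spec as (P1 & _). destruct (is_linear_bound _ P1) as (M & HM & HPM).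
set (k := 2 + / c). assert (Hic : 0 < / c) by now apply Rinv_0_lt_compat.
destruct (U_cont t (eps / (2 * k))) as (d1 & Hd1 & H1).
{ apply Rdiv_lt_0_compat; [apply cond_pos|unfold k; lra]. }
destruct (der_cont W t _ (proj2 (proj2 (proj2 (W_spec t)))) (eps / (2 * M))) as (d2 & Hd2 & H2).
{ apply Rdiv_lt_0_compat; [apply cond_pos|lra]. }
exists (mkposreal _ (Rmin_pos _ _ Hd1 Hd2)). intros s Hs.
change (Rabs (s - t) < Rmin d1 d2) in Hs.
specialize (H1 s ltac:(eapply Rlt_le_trans; [apply Hs|apply Rmin_l])).
specialize (H2 s ltac:(eapply Rlt_le_trans; [apply Hs|apply Rmin_r])).
change (Rabs (normV B (F s ⊖ F t) - 0) < eps). rewrite Rminus_0_r, normV_eq.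
destruct (F_spec s) as (S1 & S2 & S3). destruct (F_spec t) as (T1 & T2 & T3).
destruct (lin_minus L _ _ L_lin S1 T1) as [D1 D2].
set (d := F s ⊖ F t) in *. destruct (projK_spec d) as [Q1 Q2].
assert (HP : proj K d = opP J B (W s ⊖ W t)).
{ unfold d. rewrite linmap_minus, S3, T3 by apply projK_linmap.
  rewrite linmap_minus by now apply is_linear_linmap. vec. }
destruct (L_K _ Q1) as [Q3 Q4]. destruct (lin_minus L _ _ L_lin D1 Q3) as [E1 E2].
pose proof (HB _ E1 Q2) as H3. rewrite E2, Q4 in H3. replace (L d ⊖ vzero) with (L d) in H3 by vec.
rewrite D2, S2, T2 in H3.
assert (H4 : vnorm (d ⊖ proj K d) <= / c * vnorm (U s Z0 ⊖ U t Z0)).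
{ apply (Rmult_le_reg_l c); auto. rewrite <- Rmult_assoc, Rinv_r, Rmult_1_l by lra. auto. }
pose proof (HPM (W s ⊖ W t)) as H5. rewrite <- HP in H5.
pose proof (nrm_le_dist d (proj K d)) as H6.
rewrite D2, S2, T2. set (q := vnorm (U s Z0 ⊖ U t Z0)) in *.
assert (Hq : 0 <= q) by apply norm_pos. pose proof (norm_pos d).
rewrite Rabs_right by lra.
apply (Rmult_lt_compat_l k) in H1; [|unfold k; lra].
apply (Rmult_lt_compat_l M) in H2; auto.
replace (k * (eps / (2 * k))) with (eps / 2) in H1 by (field; unfold k; lra).
replace (M * (eps / (2 * M))) with (eps / 2) in H2 by (field; lra).
unfold k in H1. lra.
Qed.

(** * Riemann integrals in the norm of V *)

Lemma L_Riemann_sum (X : R -> E) ptd : (forall s, dom L (X s)) ->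
  dom L (Riemann_sum (V := realify E) X ptd) /\
  L (Riemann_sum (V := realify E) X ptd) = Riemann_sum (V := realify E) (fun s => L (X s)) ptd.
Proof.
intro HX. unfold Riemann_sum. match goal with |- context [seq.pairmap _ ?a _] => generalize a end. induction (SF_t ptd) as [|p q IH]; intro a; simpl.
- apply lin_zero, L_lin.
- destruct (IH p) as [H1 H2].
  destruct (lin_scal L (RtoC (fst p - fst a)) (X (snd p)) L_lin (HX _)) as [H3 H4].
  destruct (lin_plus L _ _ L_lin H3 H1) as [H5 H6]. split; [exact H5|].
  etransitivity; [exact H6|]. rewrite H2, H4. reflexivity.
Qed.

Let sgn_sum (X : R -> E) (t : R) ptd : E := Rs (sign (t - 0)) (Riemann_sum (V := realify E) X ptd).

Lemma L_sgn_sum (X : R -> E) t ptd : (forall s, dom L (X s)) ->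
  dom L (sgn_sum X t ptd) /\ L (sgn_sum X t ptd) = sgn_sum (fun s => L (X s)) t ptd.
Proof.
intro HX. destruct (L_Riemann_sum X ptd HX) as [H1 H2].
destruct (lin_scal L (RtoC (sign (t - 0))) _ L_lin H1) as [H3 H4]. split; auto.
unfold sgn_sum. now rewrite H4, H2.
Qed.

Lemma is_RInt_sgn_sum (X : R -> E) (t : R) (Y : E) : is_RInt (V := realify E) X 0 t Y <->
  forall eps, 0 < eps -> Riemann_fine 0 t (fun ptd => vnorm (sgn_sum X t ptd ⊖ Y) < eps).
Proof.
unfold is_RInt. rewrite (filterlim_locally_ball_norm (U := realify E)). split.
- intros HH eps He. exact (HH (mkposreal eps He)).
- intros HH eps. exact (HH eps (cond_pos eps)).
Qed.

Lemma is_RIntV_sgn_sum (X : R -> E) (t : R) (Y : E) : is_RIntV B X 0 t Y <->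
  dom L Y /\ forall eps, 0 < eps -> Riemann_fine 0 t (fun ptd => normV B (sgn_sum X t ptd ⊖ Y) < eps).
Proof.
unfold is_RIntV. rewrite (filterlim_locally_ball_norm (U := R_NormedModule)).
assert (Hr : forall x (eps : R), ball_norm (V := R_NormedModule) 0 eps (normV B x) <-> normV B x < eps).
{ intros x eps. change (Rabs (normV B x - 0) < eps <-> normV B x < eps).
  rewrite Rminus_0_r, Rabs_right; [easy|]. rewrite normV_eq. pose proof (norm_pos (L x)). pose proof (norm_pos x). lra. }
split; intros [HY HH]; split; auto.
- intros eps He. specialize (HH (mkposreal eps He)). revert HH. apply filter_imp. intros ptd Hp. now apply Hr in Hp.
- intros eps. specialize (HH eps (cond_pos eps)). revert HH. apply filter_imp. intros ptd Hp. now apply Hr.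
Qed.

(** The norm of V is a sum and [L] commutes with Riemann sums, so convergence in V is joint
    convergence of the sums for X and for L X. *)
Lemma is_RIntV_iff (X : R -> E) (t : R) (Y : E) : (forall s, dom L (X s)) ->
  is_RIntV B X 0 t Y <-> dom L Y /\ is_RInt (V := realify E) X 0 t Y /\
    is_RInt (V := realify E) (fun s => L (X s)) 0 t (L Y).
Proof.
intro HX. rewrite is_RIntV_sgn_sum, !is_RInt_sgn_sum.
assert (Hn : forall ptd, dom L Y -> normV B (sgn_sum X t ptd ⊖ Y) =
  vnorm (sgn_sum (fun s => L (X s)) t ptd ⊖ L Y) + vnorm (sgn_sum X t ptd ⊖ Y)).
{ intros ptd HY. rewrite normV_eq. destruct (L_sgn_sum X t ptd HX) as [H1 H2].
  destruct (lin_minus L _ _ L_lin H1 HY) as [_ H3]. now rewrite H3, H2. }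
split.
- intros [HY HH]. split; [|split]; auto; intros eps He; generalize (HH eps He); apply filter_imp;
    intros ptd Hp; rewrite Hn in Hp by auto; pose proof (norm_pos (sgn_sum (fun s => L (X s)) t ptd ⊖ L Y));
    pose proof (norm_pos (sgn_sum X t ptd ⊖ Y)); lra.
- intros (HY & H1 & H2). split; auto. intros eps He.
  assert (He2 : 0 < eps / 2) by lra.
  generalize (filter_and _ _ (H1 _ He2) (H2 _ He2)).
  apply filter_imp. intros ptd [A1 A2]. rewrite Hn by auto. lra.
Qed.

(** Both limits run along the same filter of partitions, so one sequence of partitions serves both
    integrals and the closed graph of [L] applies. *)
Lemma RInt_closed (X : R -> E) (t : R) (Y w : E) : (forall s, dom L (X s)) ->
  is_RInt (V := realify E) X 0 t Y -> is_RInt (V := realify E) (fun s => L (X s)) 0 t w ->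
  dom L Y /\ L Y = w.
Proof.
intros HX. rewrite !is_RInt_sgn_sum. intros H1 H2.
assert (Hex : forall n : nat, exists ptd, vnorm (sgn_sum X t ptd ⊖ Y) < / (INR n + 1) /\
  vnorm (sgn_sum (fun s => L (X s)) t ptd ⊖ w) < / (INR n + 1)).
{ intro n. pose proof (RinvN_pos n) as Hp.
  exact (filter_ex _ (filter_and _ _ (H1 _ Hp) (H2 _ Hp))). }
destruct (choice _ Hex) as [p Hp].
assert (Hcv : forall (u : nat -> E) (l : E), (forall n : nat, vnorm (u n ⊖ l) < / (INR n + 1)) -> cv u l).
{ intros u l Hu eps He. destruct (archimed_cor1 eps He) as (N & HN1 & HN2).
  exists N. intros n Hn. eapply Rlt_trans; [apply Hu|]. eapply Rle_lt_trans; [|apply HN1].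
  apply Rinv_le_contravar; [now apply lt_0_INR|]. apply le_INR in Hn. lra. }
apply (selfadjoint_closed L (fun n => sgn_sum X t (p n))); [apply L_sa| | |].
- intro n. now apply L_sgn_sum.
- apply Hcv. intro n. apply Hp.
- apply (cv_ext (fun n => sgn_sum (fun s => L (X s)) t (p n))).
  + intro n. symmetry. now apply L_sgn_sum.
  + apply Hcv. intro n. apply Hp.
Qed.

(** Real and complex structure share the uniform structure, so completeness carries over;
    [ex_RInt_continuous] and [is_RInt_derive] are applied in this module. *)
Definition realify_complete : CompleteNormedModule R_AbsRing :=
  CompleteNormedModule.Pack R_AbsRing E
    (CompleteNormedModule.Class R_AbsRing E (NormedModule.class _ (realify E))
      (CompleteNormedModule.mixin _ _ (CompleteNormedModule.class C_AbsRing E))) E.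

Lemma continuousV_cont (X : R -> E) t : continuousV B X -> cont X t /\ cont (fun s => L (X s)) t.
Proof.
intros [HX HC]. specialize (HC t).
assert (HH : forall eps, 0 < eps -> exists d, 0 < d /\ forall s, Rabs (s - t) < d -> normV B (X s ⊖ X t) < eps).
{ intros eps He. destruct (proj1 (filterlim_locally_ball_norm (U := R_NormedModule) (F := locally t) _ 0) HC (mkposreal eps He)) as [d Hd].
  exists d. split; [apply cond_pos|]. intros s Hs. specialize (Hd s Hs).
  change (Rabs (normV B (X s ⊖ X t) - 0) < eps) in Hd. rewrite Rminus_0_r in Hd.
  apply Rabs_def2 in Hd. tauto. }
split; intros eps He; destruct (HH eps He) as (d & Hd & Hd'); exists d; split; auto; intros s Hs;
  specialize (Hd' s Hs); rewrite normV_eq in Hd';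
  pose proof (norm_pos (X s ⊖ X t)); pose proof (norm_pos (L (X s ⊖ X t))).
- lra.
- destruct (lin_minus L _ _ L_lin (HX s) (HX t)) as [_ H2]. rewrite H2 in *. lra.
Qed.

(** The integral Y of [F] exists by continuity. Since W' = L F and W(0) = 0, closedness of [L] gives
    L Y = W, so J B Y = J L W is the increment of [F]. *)
Lemma F_mild : mild_solution J B F.
Proof.
intro t. pose proof F_continuousV as HFC. pose proof (fun s => proj1 (F_spec s)) as HFd.
destruct (ex_RInt_continuous (V := realify_complete) F 0 t) as [Y HY].
{ intros z _. apply continuous_cont. now apply continuousV_cont. }
assert (HW : is_RInt (V := realify E) (fun s => L (F s)) 0 t (W t)).
{ assert (HR : is_RInt (V := realify_complete) (fun s => L (F s)) 0 t (minus (W t) (W 0))).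
  { apply (is_RInt_derive (V := realify_complete) W (fun s => L (F s))).
    - intros s _. apply (der_is_derive W s). destruct (F_spec s) as (_ & -> & _). apply W_spec.
    - intros s _. apply continuous_cont. now apply continuousV_cont. }
  change (is_RInt (V := realify E) (fun s => L (F s)) 0 t (W t ⊖ W 0)) in HR.
  rewrite W_0 in HR. now replace (W t ⊖ vzero) with (W t) in HR by vec. }
destruct (RInt_closed F t Y (W t) HFd HY HW) as [HY1 HY2].
destruct (W_dom t) as (W1 & W2 & W3).
exists Y. split; [|split].
- apply is_RIntV_iff; auto. split; [|split]; auto. now rewrite HY2.
- apply dom_B. rewrite HY2. auto.
- change (F t ⊖ F 0 = J (B Y)). rewrite B_eq, HY2, F_0, F_integrated; auto; [vec|]. now rewrite HY2.
Qed.

(* [L] applied to the integral of a solution solves [w' = Z0 - i H w], as [W] does. *)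
Lemma mild_unique (X : R -> E) : continuousV B X -> mild_solution J B X -> X 0 = X0 -> forall t, X t = F t.
Proof.
intros HC HM H0.
destruct (choice _ HM) as [Y HY]. pose proof HC as [HXd _].
assert (HYs : forall t, dom L (Y t) /\ dom L (L (Y t)) /\ X t = J (L (L (Y t))) ⊕ X0 /\
  is_RInt (V := realify E) (fun s => L (X s)) 0 t (L (Y t))).
{ intro t. destruct (HY t) as (A1 & A2 & A3). apply is_RIntV_iff in A1; auto.
  change (dom B (Y t)) in A2. apply dom_B in A2. destruct A2 as [A2 A4]. split; [|split; [|split]]; auto.
  - change (X t ⊖ X 0 = J (B (Y t))) in A3. rewrite B_eq, H0 in A3 by auto. rewrite <- A3. vec.
  - apply A1. }
(* J L (L Y) = X - X0 lies in V, which is what the domain of [H] asks of [L (Y t)]. *)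
assert (Hdom : forall t, dom H (L (Y t))).
{ intro t. destruct (HYs t) as (A1 & A2 & A3 & A4). split; auto.
  change (dom L (J (L (L (Y t))))). replace (J (L (L (Y t)))) with (X t ⊖ X0) by (rewrite A3; vec).
  exact (proj1 (lin_minus L _ _ L_lin (HXd t) hX0)). }
assert (HLX : forall t, L (X t) = Z0 ⊕ Copp Ci • H (L (Y t))).
{ intro t. destruct (HYs t) as (A1 & A2 & A3 & A4). rewrite A3.
  destruct (lin_plus L (J (L (L (Y t)))) X0 L_lin (proj2 (Hdom t)) hX0) as [_ Hp]. rewrite Hp.
  rewrite H_eq by auto. fold Z0.
  rewrite oppCi_Ci. fold L. vec. }
assert (Hder : forall t, der (fun t => L (Y t)) t (Z0 ⊕ Copp Ci • H (L (Y t)))).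
{ intro t. rewrite <- HLX. apply der_is_derive.
  apply (is_derive_RInt (V := realify E) (fun s => L (X s)) (fun t => L (Y t)) 0).
  - exists (mkposreal 1 Rlt_0_1). intros s _. apply HYs.
  - apply continuous_cont. now apply continuousV_cont. }
(* The equation at time 0 gives J L (L Y(0)) = 0, so L Y(0) lies in [K]; it also lies in [Ran L],
   the complement of [K]. *)
assert (HY0 : L (Y 0) = vzero).
{ destruct (HYs 0) as (A1 & A2 & A3 & A4). apply (orth_self K).
  - split; auto. change (L (L (Y 0)) = vzero).
    assert (HJ : J (L (L (Y 0))) = vzero).
    { rewrite H0 in A3. replace (J (L (L (Y 0)))) with ((J (L (L (Y 0))) ⊕ X0) ⊖ X0) by vec. rewrite <- A3. vec. }
    pose proof (J_square (L (L (Y 0)))) as HH. rewrite HJ, linmap_zero in HH by apply J_linmap.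
    change (vzero = ⊖ L (L (Y 0))) in HH. replace (L (L (Y 0))) with (⊖ ⊖ L (L (Y 0))) by vec. rewrite <- HH. vec.
  - apply ranL_iff. now exists (Y 0). }
(* Subtracting [W] removes the inhomogeneous term Z0, so the difference can be compared with the
   zero solution. *)
assert (HYW : forall t, L (Y t) ⊖ W t = vzero).
{ apply (schrodinger_unique H (fun t => L (Y t) ⊖ W t) (fun _ => vzero) hIV).
  - intro t. destruct (W_spec t) as (A1 & _ & A2 & A3).
    destruct (lin_minus H _ _ H_lin (Hdom t) A1) as [D1 D2]. split; auto. rewrite D2.
    replace (Copp Ci • (H (L (Y t)) ⊖ H (W t))) with
      ((Z0 ⊕ Copp Ci • H (L (Y t))) ⊖ (Z0 ⊕ Copp Ci • H (W t))) by vec.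
    apply der_minus; auto. rewrite A2. replace (Z0 ⊕ (U t Z0 ⊖ Z0)) with (U t Z0) by vec. auto.
  - intro t. destruct (lin_zero H H_lin) as [Hz1 Hz2]. split; auto. rewrite Hz2.
    replace (Copp Ci • vzero) with (vzero : E) by vec. apply der_const.
  - rewrite HY0, W_0. vec. }
intro t. destruct (HYs t) as (_ & _ & -> & _). rewrite F_integrated.
now rewrite (minus_eq_zero _ _ (HYW t)).
Qed.

Lemma spectral_representation :
  (exists! X : R -> E, continuousV B X /\ mild_solution J B X /\ X 0 = X0) /\
  (forall X : R -> E, continuousV B X -> mild_solution J B X -> X 0 = X0 -> forall t : R, X t = F t).
Proof.
split; [|exact mild_unique]. exists F. split.
- split; [exact F_continuousV|split; [exact F_mild|exact F_0]].
- intros X (H1 & H2 & H3). apply functional_extensionality. intro t. symmetry. now apply mild_unique.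
Qed.

End Hamiltonian.

Theorem proposition3p2 (E : HilbertSpace) (J : E -> E) (B : operator E)
  (J_bounded : is_linear J)
  (J_skew : op_eq (adjoint (everywhere J)) (everywhere (fun x => opp (J x))))
  (J_square : forall x, J (J x) = opp x)
  (B_selfadjoint : selfadjoint B)
  (B_nonneg : nonnegative B)
  (hI : exists delta : R, 0 < delta /\
     forall z : C, in_spectrum B z ->
       z = RtoC 0 \/ exists s : R, delta <= s /\ z = RtoC s)
  (hII : finite_dimensional (Ker B))
  (hIII : forall x, spK B x -> spV B (J x))
  (hIV : selfadjoint (opH J B))
  (X0 : E) (hX0 : spV B X0) :
  (exists! X : R -> E,
     continuousV B X /\ mild_solution J B X /\ X 0 = X0) /\
  (forall X : R -> E,
     continuousV B X -> mild_solution J B X -> X 0 = X0 ->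
     forall t : R,
       X t =
       plus (plus (plus
         (inverse (Lam_plus B) (expH J B t (Lam B X0)))
         (proj (spK B) X0))
         (scal (RtoC t) (opP J B (proj (kerH0 J B) (Lam B X0)))))
         (let w := inverse (opHR J B) (proj (ranH J B) (Lam B X0)) in
          scal Ci (opP J B (minus (expHR J B t w) w)))).
Proof. now apply spectral_representation. Qed.
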